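(* Let $p$ be a prime and $n=4$. Let $\mathbf{D}_p(\mathsf X)=\sum_{\delta=0}^{\infty}\mathbf{T}(p^{\delta})\mathsf X^{\delta}$ be the generating series of Hecke operators of genus $4$ and let $\Omega$ be the spherical map (applied coefficientwise in $\mathsf X$). Then, in the ring of formal power series in $\mathsf X$ over $\mathbb{Q}[x_0,x_1,x_2,x_3,x_4]$, $$\Omega(\mathbf{D}_p(\mathsf X))=\frac{P_4(\mathsf X)}{Q_4(\mathsf X)},$$ where $$\begin{aligned}Q_4(\mathsf X)=\;&(1-x_0\mathsf X)(1-x_0x_1\mathsf X)(1-x_0x_2\mathsf X)(1-x_0x_3\mathsf X)(1-x_0x_4\mathsf X)\\ &\times(1-x_0x_1x_2\mathsf X)(1-x_0x_1x_3\mathsf X)(1-x_0x_1x_4\mathsf X)(1-x_0x_2x_3\mathsf X)\\ &\times(1-x_0x_2x_4\mathsf X)(1-x_0x_3x_4\mathsf X)(1-x_0x_1x_2x_3\mathsf X)(1-x_0x_1x_2x_4\mathsf X)\\ &\times(1-x_0x_1x_3x_4\mathsf X)(1-x_0x_2x_3x_4\mathsf X)(1-x_0x_1x_2x_3x_4\mathsf X)\end{aligned}$$ and $P_4(\mathsf X)=\sum_{k=0}^{14}K_k\,\mathsf X^k$ with the following coefficients $K_k=K_k(p,x_0,x_1,x_2,x_3,x_4)$, where $s_{abcd}$ denotes the monomial symmetric polynomial in $x_1,x_2,x_3,x_4$ with exponents $a,b,c,d$: $K_0=1$, $\quad K_1=0$, $K_2=-\frac{x_0^2}{p^2}\Big[p(s_{2211}+s_{2110}+s_{1100})+(p^2+p+1)(s_{2111}+s_{1110})+(2p^2+4p+1)s_{1111}\Big]$,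 $K_3=\frac{x_0^3}{p^3}\Big[(p^2+p)(s_{3222}+s_{3221}+s_{3211}+s_{3111}+s_{2220}+s_{2210}+s_{2110}+s_{1110})+(p^3+5p^2+5p+1)(s_{2222}+s_{2221}+s_{2211}+s_{2111}+s_{1111})\Big]$, $K_4=-\frac{x_0^4}{p^4}\Big[p^2(s_{4322}+s_{4221}+s_{3220}+s_{2210})+p(p^2+p+1)(s_{4222}+s_{3333}+s_{3331}+s_{3311}+s_{3111}+s_{2220}+s_{1111})+p(p^2+4p+1)(s_{3332}+s_{3321}+s_{3211}+s_{2111})+p(3p^2+6p+4)(s_{3322}+s_{3221}+s_{2211})+(5p^3+15p^2+6p+1)(s_{3222}+s_{2221})+(12p^3+22p^2+16p+1)s_{2222}\Big]$, $K_5=\frac{x_0^5}{p^4}\Big[(p^2+p)(s_{4433}+s_{4432}+s_{4422}+s_{4331}+s_{4321}+s_{4221}+s_{3311}+s_{3211}+s_{2211})+(4p^2+5p+1)(s_{4333}+s_{4332}+s_{4322}+s_{4222}+s_{3331}+s_{3321}+s_{3221}+s_{2221})+(-p^4+14p^2+18p+5)(s_{3333}+s_{3332}+s_{3322}+s_{3222}+s_{2222})\Big]$, $K_6=\frac{x_0^6}{p^6}\Big[p^2(p^3-5p-4)(s_{4432}+s_{4322}+s_{3222}+s_{4443})+p(p^5+5p^4-17p^2-15p-1)(s_{4333}+s_{3332})-p^2(p+1)(s_{4331}+s_{3321}+s_{5332}+s_{5433})+p(3p^4-12p^2-6p-1)(s_{4332}+s_{3322}+s_{4433})+p^2(p^3-3p-1)(s_{4222}+s_{3331}+s_{2222}+s_{4422}+s_{4442}+s_{4444}+s_{5333})+p^3(s_{6333}-s_{5443}-s_{5432}-s_{5322}-s_{4431}-s_{4321}+s_{3330}-s_{3221})+(2p^6+12p^5-32p^3-22p^2-4p+1)s_{3333}\Big]$,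 $K_7=-\frac{x_0^7}{p^5}\Big[p(p^2-1)(s_{5544}+s_{5543}+s_{5533}+s_{5442}+s_{5432}+s_{5332}+s_{4422}+s_{4322}+s_{3322})+(p^4+4p^3-4p-1)(s_{5444}+s_{5443}+s_{5433}+s_{5333}+s_{4442}+s_{4432}+s_{4332}+s_{3332})+(5p^4+14p^3-14p-5)(s_{4444}+s_{4443}+s_{4433}+s_{4333}+s_{3333})\Big]$, $K_8=\frac{x_0^8}{p^6}\Big[(p^5+15p^4+17p^3-5p-1)(s_{5444}+s_{4443})+p^3(-s_{7444}+s_{6554}+s_{6543}+s_{6433}+s_{5542}+s_{5432}-s_{4441}+s_{4332})+p(4p^3+5p^2-1)(s_{5554}+s_{5543}+s_{5433}+s_{4333})+p^3(p+1)(s_{6544}+s_{6443}+s_{5442}+s_{4432})+p(p^3+3p^2-1)(s_{4442}+s_{5333}+s_{5533}+s_{5555}+s_{6444}+s_{5553}+s_{3333})-(p^6-4p^5-22p^4-32p^3+12p+2)s_{4444}+p(p^4+6p^3+12p^2-3)(s_{5544}+s_{5443}+s_{4433})\Big]$, $K_9=-\frac{x_0^9}{p^6}\Big[p^2(p+1)(s_{6655}+s_{6654}+s_{6644}+s_{6553}+s_{6543}+s_{6443}+s_{5533}+s_{5433}+s_{4433})+p^2(p^2+5p+4)(s_{6555}+s_{6554}+s_{6544}+s_{6444}+s_{5553}+s_{5543}+s_{5443}+s_{4443})+(5p^4+18p^3+14p^2-1)(s_{5555}+s_{5554}+s_{5544}+s_{5444}+s_{4444})\Big]$, $K_{10}=\frac{x_0^{10}}{p^5}\Big[(p^2+p+1)(s_{4444}+s_{5553}+s_{6444}+s_{6644}+s_{6664}+s_{6666}+s_{7555})+(p^2+4p+1)(s_{5444}+s_{6544}+s_{6654}+s_{6665})+p(s_{5543}+s_{6553}+s_{7554}+s_{7655})+(4p^2+6p+3)(s_{5544}+s_{6554}+s_{6655})+(p^3+6p^2+15p+5)(s_{5554}+s_{6555})+(p^3+16p^2+22p+12)s_{5555}\Big]$,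 $K_{11}=-\frac{x_0^{11}}{p^6}\Big[(p^2+p)(s_{7666}+s_{7665}+s_{7655}+s_{7555}+s_{6664}+s_{6654}+s_{6554}+s_{5554})+(p^3+5p^2+5p+1)(s_{6666}+s_{6665}+s_{6655}+s_{6555}+s_{5555})\Big]$, $K_{12}=\frac{x_0^{12}}{p^6}\Big[(p^2+p+1)(s_{6665}+s_{7666})+(p^2+4p+2)s_{6666}+p(s_{7665}+s_{7766}+s_{6655})\Big]$, $K_{13}=0$, $\quad K_{14}=-\frac{x_0^{14}}{p^6}s_{7777}$.
   Context: Symmetric polynomials: for integers $a\ge b\ge c\ge d\ge 0$, $s_{abcd}$ is the monomial symmetric polynomial in $x_1,x_2,x_3,x_4$, i.e. the sum, each monomial counted once, of all distinct monomials $x_1^{i_1}x_2^{i_2}x_3^{i_3}x_4^{i_4}$ with $(i_1,i_2,i_3,i_4)$ a permutation of $(a,b,c,d)$. Hecke operators: for $n\ge1$ let $J_n=\begin{pmatrix}\mathbf 0_n&\mathbf I_n\\-\mathbf I_n&\mathbf 0_n\end{pmatrix}$, let $\mathrm S=\mathrm{GSp}_n^+(\mathbb Q)=\{M\in \mathrm M_{2n}(\mathbb Q)\mid {}^tMJ_nM=\mu(M)J_n,\ \mu(M)>0\}$ and $\Gamma=\mathrm{Sp}_n(\mathbb Z)\subset \mathrm{M}_{2n}(\mathbb Z)$ the Siegel modular group of genus $n$ (here $n=4$, so matrices are $8\times 8$). For $M\in\mathrm S$ let $(M)=\Gamma M\Gamma$ be its double coset, viewed as an element of the Hecke ring of the pair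 $(\Gamma,\mathrm S)$. For a positive integer $a$, $$\mathbf T(a)=\sum_{M\in\mathrm{SD}_n(a)}(M),$$ where $\mathrm{SD}_n(a)$ is the set of integer matrices $\mathrm{diag}(d_1,\dots,d_n;e_1,\dots,e_n)$ with positive entries such that $d_i\mid d_{i+1}$, $d_n\mid e_n$, $e_{i+1}\mid e_i$ and $d_ie_i=a$. For a prime $p$, the operators $\mathbf T(p^\delta)$ lie in the local Hecke algebra $\mathcal L_{n,\mathbb Z}=\mathbb Z[\mathbf T(p),\mathbf T_1(p^2),\dots,\mathbf T_n(p^2)]$, where $\mathbf T(p)=(\mathrm{diag}(1,\dots,1;p,\dots,p))$ and $\mathbf T_i(p^2)=(\mathrm{diag}(1,\dots,1,p,\dots,p;p^2,\dots,p^2,p,\dots,p))$ with blocks of sizes $n-i,i,n-i,i$. Spherical map (Satake, in Andrianov's normalization): $\Omega:\mathcal L_{n,\mathbb Z}\to\mathbb Q[x_0,x_1,\dots,x_n]$ is the ring homomorphism defined as follows. Write $X\in\mathcal L_{n,\mathbb Z}$ as a finite integral combination of left cosets $\sum_i a_i\,(\Gamma M_i)$ (each double coset being identified with the sum of the left cosets $\Gamma M$ it contains), with representatives chosen of the form $$M_i=\begin{pmatrix}p^{\delta_i}\,{}^tD_i^{-1}&B_i\\ \mathbf 0&D_i\end{pmatrix},$$ $D_i$ upper triangular with diagonal entries $p^{d_{i1}},p^{d_{i2}},\dots,p^{d_{in}}$ in this order. Then $$\Omega(X)=\sum_i a_i\,x_0^{\delta_i}\prod_{j=1}^n (x_jp^{-j})^{d_{ij}}.$$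 For instance $\Omega(\mathbf T(p))=x_0\prod_{j=1}^n(1+x_j)$. It is extended coefficientwise to formal power series in $\mathsf X$. *)

(* Defs.v *)
From mathcomp Require Import all_boot all_order all_algebra.
From mathcomp Require Import boolp classical_sets fsbigop.
From mathcomp Require Import freeg mpoly.

Set Implicit Arguments.
Unset Strict Implicit.
Unset Printing Implicit Defensive.

Import GRing.Theory.
Local Open Scope classical_set_scope.
Local Open Scope ring_scope.

Definition symplectic_form (R : pzRingType) (n : nat) : 'M[R]_(n + n) :=
  block_mx 0 1%:M (- 1%:M) 0.

(* Sp_n(Z), seen inside the rational matrices. *)
Definition siegel_group (n : nat) : set 'M[rat]_(n + n) :=
  [set map_mx intr g | g in
    [set g : 'M[int]_(n + n) |
      g^T *m symplectic_form int n *m g = symplectic_form int n]].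

Definition GSp_pos (n : nat) : set 'M[rat]_(n + n) :=
  [set M | exists2 mu : rat, (0 < mu) &
    M^T *m symplectic_form rat n *m M = mu *: symplectic_form rat n].

Definition left_coset (n : nat) (M : 'M[rat]_(n + n)) : set 'M[rat]_(n + n) :=
  [set g *m M | g in @siegel_group n].

Definition double_coset (n : nat) (M : 'M[rat]_(n + n)) :
    set 'M[rat]_(n + n) :=
  [set N | exists g h, [/\ siegel_group g, siegel_group h &
                           N = g *m M *m h]].

(* Finite integral combinations of sets of matrices. The Hecke ring of the
   pair (Sp_n(Z), GSp_n^+(Q)) is the additive subgroup of the combinations of
   left cosets that are invariant under right translation by Sp_n(Z); its
   product is not needed below. *)
Notation hecke_module n := {freeg (set 'M[rat]_(n + n)) / int}.

(* A double coset is the sum of the left cosets it contains; the sum is over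
   a finite set when M is in GSp_n^+(Q). *)
Definition hecke_coset (n : nat) (M : 'M[rat]_(n + n)) : hecke_module n :=
  \sum_(C \in [set left_coset N | N in double_coset M])
    (<< C >> : hecke_module n).

(* The condition d_n | e_n is the clause with i.+1 = n. *)
Definition SD (n a : nat) : set 'M[rat]_(n + n) :=
  [set M | exists d e : 'I_n -> nat,
    [/\ forall i, (0 < d i)%N && (0 < e i)%N,
        forall i j : 'I_n, j = i.+1 :> nat -> ((d i %| d j) && (e j %| e i))%N,
        forall i : 'I_n, i.+1 = n -> (d i %| e i)%N,
        forall i, (d i * e i)%N = a &
        M = block_mx (diag_mx (\row_i (d i)%:R)) 0
                     0 (diag_mx (\row_i (e i)%:R))]].

Definition hecke_T (n a : nat) : hecke_module n :=
  \sum_(M \in @SD n a) hecke_coset M.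

(* delta and d record that M is one of the representatives used to compute
   the spherical map: M = (p^delta D^{-T}, B; 0, D) with D upper triangular
   with diagonal p^(d 0), p^(d 1), ... *)
Definition is_spherical_repr (n p delta : nat) (d : 'I_n -> nat)
    (M : 'M[rat]_(n + n)) : Prop :=
  exists B D : 'M[rat]_n,
    [/\ GSp_pos M,
        forall i j : 'I_n, (j < i)%N -> D i j = 0,
        forall i, D i i = p%:R ^+ d i &
        M = block_mx (p%:R ^+ delta *: (invmx D)^T) B 0 D].

Definition spherical_monomial (n p delta : nat) (d : 'I_n -> nat) :
    {mpoly rat[n.+1]} :=
  'X_(inord 0) ^+ delta
  * \prod_(j < n) (p%:R ^- j.+1 *: 'X_(inord j.+1)) ^+ d j.

(* If C is a left coset, all its representatives of the required form give the
   same monomial. *)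
Definition spherical_coset (n p : nat) (C : set 'M[rat]_(n + n)) :
    {mpoly rat[n.+1]} :=
  xget 0 [set m | exists delta d,
    m = spherical_monomial p delta d /\
    exists2 M, C M & is_spherical_repr p delta d M].

Definition spherical_map (n p : nat) (X : hecke_module n) :
    {mpoly rat[n.+1]} :=
  \sum_(C <- dom X) spherical_coset p C *~ coeff C X.

(* A formal power series is represented by its sequence of coefficients. *)
Definition hecke_series (n p : nat) : nat -> hecke_module n :=
  fun delta => hecke_T n (p ^ delta).

(* f = P / Q in the ring of formal power series over R. *)
Definition is_fps_quotient (R : comUnitRingType) (f : nat -> R)
    (P Q : {poly R}) : Prop :=
  Q`_0 \is a GRing.unit /\
  forall k, \sum_(i < k.+1) Q`_i * f (k - i)%N = P`_k.

Definition x0 : {mpoly rat[5]} := 'X_(inord 0).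
Definition x1 : {mpoly rat[5]} := 'X_(inord 1).
Definition x2 : {mpoly rat[5]} := 'X_(inord 2).
Definition x3 : {mpoly rat[5]} := 'X_(inord 3).
Definition x4 : {mpoly rat[5]} := 'X_(inord 4).

(* [permutations] enumerates the distinct rearrangements without repetition. *)
Definition s (a b c d : nat) : {mpoly rat[5]} :=
  \sum_(i <- permutations [:: a; b; c; d])
    x1 ^+ nth 0%N i 0 * x2 ^+ nth 0%N i 1 * x3 ^+ nth 0%N i 2
    * x4 ^+ nth 0%N i 3.

Definition Q4 : {poly {mpoly rat[5]}} :=
  (1 - x0 *: 'X) * (1 - (x0 * x1) *: 'X) * (1 - (x0 * x2) *: 'X)
  * (1 - (x0 * x3) *: 'X) * (1 - (x0 * x4) *: 'X)
  * (1 - (x0 * x1 * x2) *: 'X) * (1 - (x0 * x1 * x3) *: 'X)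
  * (1 - (x0 * x1 * x4) *: 'X) * (1 - (x0 * x2 * x3) *: 'X)
  * (1 - (x0 * x2 * x4) *: 'X) * (1 - (x0 * x3 * x4) *: 'X)
  * (1 - (x0 * x1 * x2 * x3) *: 'X) * (1 - (x0 * x1 * x2 * x4) *: 'X)
  * (1 - (x0 * x1 * x3 * x4) *: 'X) * (1 - (x0 * x2 * x3 * x4) *: 'X)
  * (1 - (x0 * x1 * x2 * x3 * x4) *: 'X).

Definition K0 (p : rat) : {mpoly rat[5]} := 1.

Definition K1 (p : rat) : {mpoly rat[5]} := 0.

Definition K2 (p : rat) : {mpoly rat[5]} :=
  - (p ^- 2 *: x0 ^+ 2) * (
    p *: (s 2 2 1 1 + s 2 1 1 0 + s 1 1 0 0)
    + (p ^+ 2 + p + 1) *: (s 2 1 1 1 + s 1 1 1 0)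
    + (2 * p ^+ 2 + 4 * p + 1) *: s 1 1 1 1).

Definition K3 (p : rat) : {mpoly rat[5]} :=
  (p ^- 3 *: x0 ^+ 3) * (
    (p ^+ 2 + p) *: (s 3 2 2 2 + s 3 2 2 1 + s 3 2 1 1 + s 3 1 1 1 +
        s 2 2 2 0 + s 2 2 1 0 + s 2 1 1 0 + s 1 1 1 0)
    + (p ^+ 3 + 5 * p ^+ 2 + 5 * p + 1) *: (s 2 2 2 2 + s 2 2 2 1 +
        s 2 2 1 1 + s 2 1 1 1 + s 1 1 1 1)).

Definition K4 (p : rat) : {mpoly rat[5]} :=
  - (p ^- 4 *: x0 ^+ 4) * (
    (p ^+ 2) *: (s 4 3 2 2 + s 4 2 2 1 + s 3 2 2 0 + s 2 2 1 0)
    + (p * (p ^+ 2 + p + 1)) *: (s 4 2 2 2 + s 3 3 3 3 + s 3 3 3 1 +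
        s 3 3 1 1 + s 3 1 1 1 + s 2 2 2 0 + s 1 1 1 1)
    + (p * (p ^+ 2 + 4 * p + 1)) *: (s 3 3 3 2 + s 3 3 2 1 + s 3 2 1 1 +
        s 2 1 1 1)
    + (p * (3 * p ^+ 2 + 6 * p + 4)) *: (s 3 3 2 2 + s 3 2 2 1 + s 2 2 1 1)
    + (5 * p ^+ 3 + 15 * p ^+ 2 + 6 * p + 1) *: (s 3 2 2 2 + s 2 2 2 1)
    + (12 * p ^+ 3 + 22 * p ^+ 2 + 16 * p + 1) *: s 2 2 2 2).

Definition K5 (p : rat) : {mpoly rat[5]} :=
  (p ^- 4 *: x0 ^+ 5) * (
    (p ^+ 2 + p) *: (s 4 4 3 3 + s 4 4 3 2 + s 4 4 2 2 + s 4 3 3 1 +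
        s 4 3 2 1 + s 4 2 2 1 + s 3 3 1 1 + s 3 2 1 1 + s 2 2 1 1)
    + (4 * p ^+ 2 + 5 * p + 1) *: (s 4 3 3 3 + s 4 3 3 2 + s 4 3 2 2 +
        s 4 2 2 2 + s 3 3 3 1 + s 3 3 2 1 + s 3 2 2 1 + s 2 2 2 1)
    + (-p ^+ 4 + 14 * p ^+ 2 + 18 * p + 5) *: (s 3 3 3 3 + s 3 3 3 2 +
        s 3 3 2 2 + s 3 2 2 2 + s 2 2 2 2)).

Definition K6 (p : rat) : {mpoly rat[5]} :=
  (p ^- 6 *: x0 ^+ 6) * (
    (p ^+ 2 * (p ^+ 3 - 5 * p - 4)) *: (s 4 4 3 2 + s 4 3 2 2 + s 3 2 2 2 +
        s 4 4 4 3)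
    + (p * (p ^+ 5 + 5 * p ^+ 4 - 17 * p ^+ 2 - 15 * p - 1)) *: (s 4 3 3 3 +
        s 3 3 3 2)
    - (p ^+ 2 * (p + 1)) *: (s 4 3 3 1 + s 3 3 2 1 + s 5 3 3 2 + s 5 4 3 3)
    + (p * (3 * p ^+ 4 - 12 * p ^+ 2 - 6 * p - 1)) *: (s 4 3 3 2 + s 3 3 2 2
        + s 4 4 3 3)
    + (p ^+ 2 * (p ^+ 3 - 3 * p - 1)) *: (s 4 2 2 2 + s 3 3 3 1 + s 2 2 2 2
        + s 4 4 2 2 + s 4 4 4 2 + s 4 4 4 4 + s 5 3 3 3)
    + (p ^+ 3) *: (s 6 3 3 3 - s 5 4 4 3 - s 5 4 3 2 - s 5 3 2 2 - s 4 4 3 1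
        - s 4 3 2 1 + s 3 3 3 0 - s 3 2 2 1)
    + (2 * p ^+ 6 + 12 * p ^+ 5 - 32 * p ^+ 3 - 22 * p ^+ 2 - 4 * p + 1) *:
        s 3 3 3 3).

Definition K7 (p : rat) : {mpoly rat[5]} :=
  - (p ^- 5 *: x0 ^+ 7) * (
    (p * (p ^+ 2 - 1)) *: (s 5 5 4 4 + s 5 5 4 3 + s 5 5 3 3 + s 5 4 4 2 +
        s 5 4 3 2 + s 5 3 3 2 + s 4 4 2 2 + s 4 3 2 2 + s 3 3 2 2)
    + (p ^+ 4 + 4 * p ^+ 3 - 4 * p - 1) *: (s 5 4 4 4 + s 5 4 4 3 +
        s 5 4 3 3 + s 5 3 3 3 + s 4 4 4 2 + s 4 4 3 2 + s 4 3 3 2 +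
        s 3 3 3 2)
    + (5 * p ^+ 4 + 14 * p ^+ 3 - 14 * p - 5) *: (s 4 4 4 4 + s 4 4 4 3 +
        s 4 4 3 3 + s 4 3 3 3 + s 3 3 3 3)).

Definition K8 (p : rat) : {mpoly rat[5]} :=
  (p ^- 6 *: x0 ^+ 8) * (
    (p ^+ 5 + 15 * p ^+ 4 + 17 * p ^+ 3 - 5 * p - 1) *: (s 5 4 4 4 +
        s 4 4 4 3)
    + (p ^+ 3) *: (- s 7 4 4 4 + s 6 5 5 4 + s 6 5 4 3 + s 6 4 3 3 +
        s 5 5 4 2 + s 5 4 3 2 - s 4 4 4 1 + s 4 3 3 2)
    + (p * (4 * p ^+ 3 + 5 * p ^+ 2 - 1)) *: (s 5 5 5 4 + s 5 5 4 3 +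
        s 5 4 3 3 + s 4 3 3 3)
    + (p ^+ 3 * (p + 1)) *: (s 6 5 4 4 + s 6 4 4 3 + s 5 4 4 2 + s 4 4 3 2)
    + (p * (p ^+ 3 + 3 * p ^+ 2 - 1)) *: (s 4 4 4 2 + s 5 3 3 3 + s 5 5 3 3
        + s 5 5 5 5 + s 6 4 4 4 + s 5 5 5 3 + s 3 3 3 3)
    - (p ^+ 6 - 4 * p ^+ 5 - 22 * p ^+ 4 - 32 * p ^+ 3 + 12 * p + 2) *:
        s 4 4 4 4
    + (p * (p ^+ 4 + 6 * p ^+ 3 + 12 * p ^+ 2 - 3)) *: (s 5 5 4 4 +
        s 5 4 4 3 + s 4 4 3 3)).

Definition K9 (p : rat) : {mpoly rat[5]} :=
  - (p ^- 6 *: x0 ^+ 9) * (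
    (p ^+ 2 * (p + 1)) *: (s 6 6 5 5 + s 6 6 5 4 + s 6 6 4 4 + s 6 5 5 3 +
        s 6 5 4 3 + s 6 4 4 3 + s 5 5 3 3 + s 5 4 3 3 + s 4 4 3 3)
    + (p ^+ 2 * (p ^+ 2 + 5 * p + 4)) *: (s 6 5 5 5 + s 6 5 5 4 + s 6 5 4 4
        + s 6 4 4 4 + s 5 5 5 3 + s 5 5 4 3 + s 5 4 4 3 + s 4 4 4 3)
    + (5 * p ^+ 4 + 18 * p ^+ 3 + 14 * p ^+ 2 - 1) *: (s 5 5 5 5 + s 5 5 5 4
        + s 5 5 4 4 + s 5 4 4 4 + s 4 4 4 4)).

Definition K10 (p : rat) : {mpoly rat[5]} :=
  (p ^- 5 *: x0 ^+ 10) * (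
    (p ^+ 2 + p + 1) *: (s 4 4 4 4 + s 5 5 5 3 + s 6 4 4 4 + s 6 6 4 4 +
        s 6 6 6 4 + s 6 6 6 6 + s 7 5 5 5)
    + (p ^+ 2 + 4 * p + 1) *: (s 5 4 4 4 + s 6 5 4 4 + s 6 6 5 4 +
        s 6 6 6 5)
    + p *: (s 5 5 4 3 + s 6 5 5 3 + s 7 5 5 4 + s 7 6 5 5)
    + (4 * p ^+ 2 + 6 * p + 3) *: (s 5 5 4 4 + s 6 5 5 4 + s 6 6 5 5)
    + (p ^+ 3 + 6 * p ^+ 2 + 15 * p + 5) *: (s 5 5 5 4 + s 6 5 5 5)
    + (p ^+ 3 + 16 * p ^+ 2 + 22 * p + 12) *: s 5 5 5 5).

Definition K11 (p : rat) : {mpoly rat[5]} :=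
  - (p ^- 6 *: x0 ^+ 11) * (
    (p ^+ 2 + p) *: (s 7 6 6 6 + s 7 6 6 5 + s 7 6 5 5 + s 7 5 5 5 +
        s 6 6 6 4 + s 6 6 5 4 + s 6 5 5 4 + s 5 5 5 4)
    + (p ^+ 3 + 5 * p ^+ 2 + 5 * p + 1) *: (s 6 6 6 6 + s 6 6 6 5 +
        s 6 6 5 5 + s 6 5 5 5 + s 5 5 5 5)).

Definition K12 (p : rat) : {mpoly rat[5]} :=
  (p ^- 6 *: x0 ^+ 12) * (
    (p ^+ 2 + p + 1) *: (s 6 6 6 5 + s 7 6 6 6)
    + (p ^+ 2 + 4 * p + 2) *: s 6 6 6 6
    + p *: (s 7 6 6 5 + s 7 7 6 6 + s 6 6 5 5)).

Definition K13 (p : rat) : {mpoly rat[5]} := 0.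

Definition K14 (p : rat) : {mpoly rat[5]} :=
  - (p ^- 6 *: x0 ^+ 14) * s 7 7 7 7.

Definition P4 (p : rat) : {poly {mpoly rat[5]}} :=
  \poly_(k < 15) nth 0 [:: K0 p; K1 p; K2 p; K3 p; K4 p; K5 p; K6 p; K7 p;
    K8 p; K9 p; K10 p; K11 p; K12 p; K13 p; K14 p] k.

(* Main.v *)
Require Import Defs.
From mathcomp Require Import boolp classical_sets fsbigop freeg.
From mathcomp Require Import all_boot all_order all_algebra.
From mathcomp Require Import mxabelem mpoly.
From mathcomp Require Import ring zify.

(** Why the theorem is true. Every left coset contained in T(p^delta) has
    a representative (p^delta D^-T, S D; 0, D), where D runs over the integral
    matrices with p^delta D^-1 integral, up to left multiplication by GL_n(Z),
    and S over the symmetric matrices modulo integral ones with S D integral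
    ([coset_rep_complete], [coset_rep_inj]); each coset occurs exactly once
    because double cosets of distinct elementary divisor matrices are disjoint
    ([simil_SNF], [sp_diag_inj]). So Omega(T(p^delta)) is x_0^delta times the
    sum over D of b(D) prod_j (x_j p^-j)^(d_j), where b(D) counts the matrices
    S ([spherical_map_hecke_T]).

    The sum over D is organised by peeling off one layer of the lattice L =
    Z^n D at a time. The lattice L + p Z^n corresponds to a subspace of F_p^n,
    described by its reduced row echelon form, that is by a set K of pivots
    and by the entries X outside of the pivot columns. Writing D = D' E with E
    the corresponding basis of L + p Z^n, the matrix D' is subject to a single
    condition: its columns indexed by K are independent modulo p
    ([layer_split], [layer_row]). Let v_J(delta) be the sum restricted to
    those D whose columns in J are independent modulo p. Since b(D' E) =
    p^(r(r+1)/2) b(D') with r = n - |K| ([card_symker_layer]), and since the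
    number of echelon forms with pivots K and independent columns J is a
    product over the columns outside of K ([card_tails]), all powers of p
    combine into v_J(delta + 1) = sum_K A_JK v_K(delta) with A_JK = prod_(c
    notin K) x_c (1 - [c in J] p^(j_c - k_c)), where j_c and k_c count the
    elements of J and K smaller than c ([layer_sumS], [transfer_coefE]).

    For n = 4 this is a linear recursion of size 16. Its matrix A is
    triangular: if A_JK is nonzero, then J = K or the first index where J and
    K differ belongs to K. The diagonal entries are the 16 products x_I. Let
    q_i be the coefficients of prod_I (1 - x_I z) and e the row vector
    selecting the empty set. The row vectors r_k = sum_(i <= k) q_i e A^(k-i)
    satisfy r_(k+1) = r_k A + q_(k+1) e, the k-th coefficient of the numerator
    is x_0^k times the sum of the entries of r_k ([row_dotE]), and r_16 = 0 as
    the theorem of Cayley and Hamilton predicts. The r_k are polynomials in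
    x_1, ..., x_4 and 1/p with integral coefficients; evaluating the recursion
    on sparse polynomials shows that r_16 = 0 and that the sum of the entries
    of r_k is the stated K_k ([numerator_checkT]). *)

Set Implicit Arguments.
Unset Strict Implicit.
Unset Printing Implicit Defensive.

Import Order.TTheory GRing.Theory Num.Theory.
Local Open Scope ring_scope.

(** * Symplectic similitudes over the integers *)

Definition simil n (mu : int) (N : 'M[int]_(n + n)) : Prop :=
  N^T *m symplectic_form int n *m N = mu *: symplectic_form int n.

Lemma tr_symplectic_form n :
  (symplectic_form int n)^T = - symplectic_form int n.
Proof.
by rewrite /symplectic_form tr_block_mx !trmx0 linearN /= trmx1 opp_block_mx
  !oppr0 opprK.
Qed.

Lemma symplectic_form_sqr n :
  symplectic_form int n *m symplectic_form int n = - 1%:M.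
Proof.
rewrite /symplectic_form mulmx_block !mul0mx !mulmx0 !mulmxN mulNmx !mulmx1
  !addr0 add0r.
by rewrite [in RHS]scalar_mx_block opp_block_mx !oppr0.
Qed.

Lemma simil1 n : simil 1 (1%:M : 'M_(n + n)).
Proof. by rewrite /simil trmx1 mul1mx mulmx1 scale1r. Qed.

Lemma similM n mu nu (M N : 'M[int]_(n + n)) :
  simil mu M -> simil nu N -> simil (mu * nu) (M *m N).
Proof.
move=> hM hN; rewrite /simil trmx_mul.
have -> : N^T *m M^T *m symplectic_form int n *m (M *m N)
   = N^T *m (M^T *m symplectic_form int n *m M) *m N by rewrite !mulmxA.
by rewrite hM -scalemxAr -scalemxAl hN scalerA.
Qed.

Lemma trmxZ (R : pzRingType) m n (c : R) (M : 'M[R]_(m, n)) : (c *: M)^T =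
  c *: M^T.
Proof. by apply/matrixP=> i j; rewrite !mxE. Qed.

Lemma scalemx_inj m n (c : int) (X Y : 'M[int]_(m, n)) : c != 0 ->
  c *: X = c *: Y -> X = Y.
Proof.
by move=> c0 /matrixP h; apply/matrixP=> i j; have := h i j; rewrite !mxE;
  apply: mulfI.
Qed.

(** The determinants are nonzero and matrices over Z embed in matrices
    over Q, so a left quasi-inverse is a right quasi-inverse; the adjugate
    gives a proof that stays inside Z. *)
Lemma mulmx_scalarC n (c : int) (A B : 'M[int]_n) : c != 0 ->
  A *m B = c%:M -> B *m A = c%:M.
Proof.
move=> c0 h.
have : \det A * \det B != 0 by rewrite -det_mulmx h det_scalar expf_neq0.
rewrite mulf_eq0 negb_or => /andP[dA dB].
have h2 : A *m (B *m A) = A *m c%:M by rewrite mulmxA h scalar_mxC.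
have : \adj A *m (A *m (B *m A)) = \adj A *m (A *m c%:M) by rewrite h2.
rewrite !(mulmxA (\adj A)) mul_adj_mx !mul_scalar_mx.
exact: scalemx_inj.
Qed.

(** The inverse of a similitude, up to its multiplier. *)
Lemma simil_adj n mu (N : 'M[int]_(n + n)) : simil mu N ->
  (- (symplectic_form int n *m N^T *m symplectic_form int n)) *m N = mu%:M.
Proof.
move=> h; rewrite mulNmx -!mulmxA (mulmxA _ _ N) h -scalemxAr
  symplectic_form_sqr scalerN opprK.
by rewrite scalemx1.
Qed.

Lemma simil_tr n mu (N : 'M[int]_(n + n)) : mu != 0 -> simil mu N ->
  simil mu N^T.
Proof.
move=> mu0 /simil_adj /(mulmx_scalarC mu0) h.
rewrite /simil trmxK.
have : N *m - (symplectic_form int n *m N^T *m symplectic_form int n) *m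
  symplectic_form int n
  = mu *: symplectic_form int n by rewrite h mul_scalar_mx.
by rewrite mulmxN mulNmx -!mulmxA symplectic_form_sqr !mulmxN mulmx1 opprK
  mulmxA.
Qed.

(** The usual relations between the blocks; the equation for the fourth
    block is the transpose of the second relation. *)
Lemma simil_block n mu (A B C D : 'M[int]_n) :
  simil mu (block_mx A B C D) <->
  [/\ A^T *m C = C^T *m A, A^T *m D - C^T *m B = mu%:M & B^T *m D = D^T *m B].
Proof.
have E : (block_mx A B C D)^T *m symplectic_form int n *m block_mx A B C D =
  block_mx (A^T *m C - C^T *m A) (A^T *m D - C^T *m B)
    (B^T *m C - D^T *m A) (B^T *m D - D^T *m B).
  rewrite /symplectic_form tr_block_mx !mulmx_block !mulmx0 !mulmxN !mulmx1
    !add0r !addr0 !mulNmx.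
  by congr block_mx; rewrite addrC.
rewrite /simil E /symplectic_form scale_block_mx !scaler0 scalerN scalemx1;
  split.
  case/eq_block_mx=> h1 h2 _ h4; split=> //; apply/eqP; rewrite -subr_eq0;
    apply/eqP=> //.
case=> -> h2 ->; rewrite !subrr h2; congr block_mx.
rewrite -[LHS]trmxK -[RHS]trmxK; congr trmx.
by rewrite linearB /= !trmx_mul !trmxK -opprB h2 linearN /= tr_scalar_mx.
Qed.

Definition is_sp n (g : 'M[int]_(n + n)) := simil 1 g.

Lemma is_spM n (g h : 'M[int]_(n + n)) : is_sp g -> is_sp h -> is_sp (g *m h).
Proof. by move=> a b; have := similM a b; rewrite mulr1. Qed.

Lemma oppr_sp n (g : 'M[int]_(n + n)) : is_sp g -> is_sp (- g).
Proof.
move=> h; rewrite /is_sp /simil.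
have -> : (- g)^T = - g^T by apply/matrixP=> i j; rewrite !mxE.
by rewrite !mulNmx mulmxN opprK.
Qed.

Lemma symplectic_form_sp n : is_sp (symplectic_form int n).
Proof.
by rewrite /is_sp /simil tr_symplectic_form mulNmx symplectic_form_sqr opprK
  mul1mx scale1r.
Qed.

Lemma is_spV n (g : 'M[int]_(n + n)) : is_sp g ->
  exists2 h, is_sp h & h *m g = 1%:M /\ g *m h = 1%:M.
Proof.
move=> gs; exists (- (symplectic_form int n *m g^T *m symplectic_form int n)).
  apply/oppr_sp/is_spM; last exact: symplectic_form_sp.
  by apply/is_spM; [exact: symplectic_form_sp | exact: simil_tr].
have h := simil_adj gs; split=> //; exact: mulmx_scalarC (oner_neq0 _) h.
Qed.

(** The block diagonal elements; this one is symplectic when V is the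
    inverse transpose of U. *)
Definition levi n (U V : 'M[int]_n) : 'M[int]_(n + n) := block_mx U 0 0 V.

Lemma levi_sp n (U : 'M[int]_n) : U \in unitmx -> is_sp (levi (invmx U)^T U).
Proof.
move=> Uu; apply/simil_block; split; rewrite ?trmx0 ?mul0mx ?mulmx0 ?trmxK
  ?subr0 //.
by rewrite mulVmx.
Qed.

Lemma levi_sp_tr n (U : 'M[int]_n) : U \in unitmx -> is_sp (levi U (invmx U)^T).
Proof.
move=> Uu; apply/simil_block; split; rewrite ?trmx0 ?mul0mx ?mulmx0 ?subr0 //.
by rewrite -trmx_mul mulVmx // trmx1.
Qed.

Lemma shear_sp n (T : 'M[int]_n) : T^T = T -> is_sp (block_mx 1%:M T 0 1%:M).
Proof.
by move=> hT; apply/simil_block; split; rewrite ?trmx0 ?mul0mx ?mulmx0 ?trmx1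
  ?mul1mx ?mulmx1 ?subr0.
Qed.

(** The orthogonal sum of two symplectic spaces, with the coordinates
    ordered so that the two Lagrangian halves stay together. It is the
    induction step of all arguments on the genus. *)
Definition esum m n (P : 'M[int]_(m + m)) (N : 'M[int]_(n + n)) :
  'M[int]_((m + n) + (m + n)) :=
  block_mx (block_mx (ulsubmx P) 0 0 (ulsubmx N)) (block_mx (ursubmx P) 0 0
    (ursubmx N))
           (block_mx (dlsubmx P) 0 0 (dlsubmx N)) (block_mx (drsubmx P) 0 0
             (drsubmx N)).

Lemma esum_block m n (a b c d : 'M[int]_m) (A B C D : 'M[int]_n) :
  esum (block_mx a b c d) (block_mx A B C D) =
  block_mx (block_mx a 0 0 A) (block_mx b 0 0 B) (block_mx c 0 0 C)
    (block_mx d 0 0 D).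
Proof.
by rewrite /esum !block_mxKul !block_mxKur !block_mxKdl !block_mxKdr.
Qed.

Lemma esumM m n (P Q : 'M[int]_(m + m)) (M N : 'M[int]_(n + n)) :
  esum P M *m esum Q N = esum (P *m Q) (M *m N).
Proof.
rewrite -(submxK P) -(submxK Q) -(submxK M) -(submxK N) !esum_block !mulmx_block
  !esum_block.
by rewrite !add_block_mx !mulmx0 !mul0mx !addr0 !add0r.
Qed.

Lemma esum_simil m n mu (P : 'M[int]_(m + m)) (N : 'M[int]_(n + n)) :
  simil mu P -> simil mu N -> simil mu (esum P N).
Proof.
rewrite -(submxK P) -(submxK N) esum_block !simil_block.
case=> h1 h2 h3 [k1 k2 k3]; rewrite !tr_block_mx !trmx0 !mulmx_block !mulmx0
  !mul0mx !addr0 !add0r.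
split; first by rewrite h1 k1.
  by rewrite opp_block_mx add_block_mx !oppr0 !addr0 h2 k2 -scalar_mx_block.
by rewrite h3 k3.
Qed.

(** * Moving a vector onto the first axis *)

(** The Smith form of a matrix with one column. *)
Lemma unit_col n (c : 'cV[int]_(1 + n)) :
  exists2 U : 'M[int]_(1 + n), U \in unitmx & exists a : 'M[int]_1, U *m c =
    col_mx a 0.
Proof.
have [L Lu [R Ru [d _ ->]]] := int_Smith_normal_form c.
exists (invmx L); first by rewrite unitmx_inv.
exists ((d`_0)%:M *m R); rewrite -mulmxA mulKmx // -[LHS]vsubmxK.
have -> : \matrix_(i, j) (d`_i *+ (i == j :> nat)) = col_mx (d`_0)%:M 0 :>
  'M[int]_(1 + n, 1).
  by apply/matrixP=> i j; rewrite !mxE ord1; case: splitP => k hk;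
    rewrite !mxE ?ord1 hk ?ord1.
by rewrite mul_col_mx col_mxKu col_mxKd mul0mx.
Qed.

(** In genus 1 the symplectic group is SL_2, and a Bezout relation between
    the two entries is the first row of the required matrix. *)
Lemma sp2_col (v : 'cV[int]_(1 + 1)) :
  exists2 P : 'M[int]_(1 + 1), is_sp P & exists a : 'M[int]_1, P *m v =
    col_mx a 0.
Proof.
rewrite -[v]vsubmxK [usubmx v]mx11_scalar [dsubmx v]mx11_scalar.
move: (usubmx v 0 0) (dsubmx v 0 0) => x y {v}.
have [g0|g0] := eqVneq (gcdz x y) 0.
  have /eqP := g0; rewrite gcdz_eq0 => /andP[_ /eqP ->].
  by exists 1%:M; [exact: simil1 | exists x%:M; rewrite mul1mx raddf0].
have [u [w uw]] := Bezoutz x y.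
have /dvdzP[x' hx] := dvdz_gcdl x y; have /dvdzP[y' hy] := dvdz_gcdr x y.
move: (gcdz x y) g0 uw hx hy => g g0 uw hx hy.
have e1 : u * x' + w * y' = 1.
  by apply: (mulIf g0); rewrite mul1r -[RHS]uw hx hy; ring.
exists (block_mx u%:M w%:M (- y')%:M x'%:M).
  apply/simil_block; rewrite !tr_scalar_mx -!scalar_mxM; split; rewrite 1?mulrC
    //.
  by rewrite -raddfB /= -e1; congr (_%:M); ring.
exists (u * x + w * y)%:M; rewrite mul_block_col -!scalar_mxM -!raddfD /=;
  congr col_mx.
by rewrite hx hy (_ : _ + _ = 0) ?raddf0 //; ring.
Qed.

Definition col0 n (a : 'M[int]_1) : 'cV[int]_((1 + n) + (1 + n)) :=
  col_mx (col_mx a 0) 0.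

Lemma esum_col n (P : 'M[int]_(1 + 1)) (x y : 'M[int]_1) (v w : 'cV[int]_n) :
  esum P 1%:M *m col_mx (col_mx x v) (col_mx y w) =
  col_mx (col_mx (usubmx (P *m col_mx x y)) v)
    (col_mx (dsubmx (P *m col_mx x y)) w).
Proof.
rewrite -{1 2 3}(submxK P) scalar_mx_block esum_block !mul_block_col !mul0mx
  !mul1mx !addr0 !add0r.
by rewrite !add_col_mx !addr0 !add0r col_mxKu col_mxKd.
Qed.

(** First the lower half is brought to one nonzero entry by GL_n(Z), then
    that entry is removed by the copy of SL_2 acting on the first hyperbolic
    plane, and finally the upper half is reduced by GL_n(Z). *)
Lemma sp_col n (v : 'cV[int]_((1 + n) + (1 + n))) :
  exists2 g, is_sp g & exists a, g *m v = col0 n a.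
Proof.
have [U Uu [c Uc]] := unit_col (dsubmx v).
have [P Ps [b Pb]] := sp2_col (col_mx (usubmx ((invmx U)^T *m usubmx v)) c).
have [W Wu [a Wa]] := unit_col (col_mx b (dsubmx ((invmx U)^T *m usubmx v))).
exists (levi W (invmx W)^T *m (esum P 1%:M *m levi (invmx U)^T U)).
  apply: is_spM; first exact: levi_sp_tr.
  apply: is_spM; last exact: levi_sp.
  by apply: esum_simil => //; exact: simil1.
exists a; rewrite -!mulmxA -{1}(vsubmxK v) /levi mul_block_col !mul0mx addr0
  add0r Uc.
rewrite -{1}(vsubmxK (_ *m usubmx v)) esum_col Pb col_mxKu col_mxKd
  mul_block_col !mul0mx addr0 add0r Wa.
by rewrite /col0 col_mx0 mulmx0.
Qed.

(** * Similitudes that fix the first axis *)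

Lemma col0E n (N : 'M[int]_((1 + n) + (1 + n))) :
  N *m col0 n 1%:M = col_mx (col_mx (ulsubmx (ulsubmx N)) (dlsubmx (ulsubmx N)))
                       (col_mx (ulsubmx (dlsubmx N)) (dlsubmx (dlsubmx N))).
Proof.
rewrite -{1}(submxK N) -{1}(submxK (ulsubmx N)) -{1}(submxK (dlsubmx N)) /col0.
by rewrite !mul_block_col !mulmx0 !mulmx1 !addr0.
Qed.

(** The vanishing of the first column forces, by the symplectic relations,
    the vanishing of the rest of the corresponding lower row; the remaining
    rows and columns form a similitude of genus n. When the first row is also
    trivial, the two leftover columns are orthogonal to that similitude, which
    is nondegenerate, so that they vanish too. *)
Lemma peel_block n (mu : int) (a : 'M[int]_1) (a01 b01 c01 d01 : 'M[int]_(1, n))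
  (b00 d00 : 'M[int]_1)
    (b10 d10 : 'M[int]_(n, 1)) (A' B' C' D' : 'M[int]_n) : mu != 0 ->
  simil mu (block_mx (block_mx a a01 0 A') (block_mx b00 b01 b10 B')
                     (block_mx 0 c01 0 C') (block_mx d00 d01 d10 D')) ->
  [/\ a *m d00 = mu%:M, c01 = 0, d01 = 0, simil mu (block_mx A' B' C' D') &
      a01 = 0 -> b01 = 0 -> b10 = 0 /\ d10 = 0].
Proof.
move=> mu0 /simil_block[]; rewrite [mu%:M]scalar_mx_block !tr_block_mx
  !mulmx_block !trmx0.
rewrite !mulmx0 !mul0mx ?addr0 ?add0r opp_block_mx add_block_mx ?oppr0 ?addr0.
rewrite [a]mx11_scalar tr_scalar_mx.
move: (a 0 0) => {}a.
case/eq_block_mx => _ h1 _ h2 /eq_block_mx[k1 k2 k3 k4] /eq_block_mx[l1 l2 l3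
  l4].
have a0 : a != 0.
  apply: contraNneq mu0 => a0; move/matrixP: k1 => /(_ 0 0).
  by rewrite a0 raddf0 mul0mx !mxE eqxx mulr1n => ->.
have zero (v : 'M[int]_(1, n)) : a%:M *m v = 0 -> v = 0.
  by rewrite mul_scalar_mx => h; apply: (scalemx_inj a0); rewrite h scaler0.
have c0 := zero _ h1; have d0 := zero _ k2; subst c01 d01.
have sN : simil mu (block_mx A' B' C' D').
  apply/simil_block; split.
  - by rewrite trmx0 mul0mx mulmx0 !add0r in h2.
  - by rewrite trmx0 mul0mx mulmx0 !add0r in k4.
  - by rewrite trmx0 mul0mx mulmx0 !add0r in l4.
split=> // a010 b010; subst a01 b01.
rewrite !trmx0 !mul0mx !add0r in k3 l3.
have e0 : (block_mx A' B' C' D')^T *m symplectic_form int n *m col_mx b10 d10 =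
  0.
  rewrite /symplectic_form tr_block_mx mulmx_block !mulmx0 !add0r !addr0 !mulmx1
    !mulmxN !mulmx1.
  rewrite mul_block_col !mulNmx l3 addNr -col_mx0; congr col_mx.
  by rewrite addrC; move: k3.
have /(mulmx_scalarC mu0) hN := simil_adj sN.
have : block_mx A' B' C' D' *m - (symplectic_form int n *m (block_mx A' B' C'
  D')^T *m symplectic_form int n) *m col_mx b10 d10 = 0.
  rewrite -mulmxA mulNmx mulmxN -[X in _ *m X](mulmxA _ _ (col_mx _ _))
    -(mulmxA _ _^T).
  by rewrite (mulmxA _^T) e0 !mulmx0 oppr0.
rewrite hN mul_scalar_mx => e1.
have /eq_col_mx[-> ->] : col_mx b10 d10 = col_mx 0 0 => //.
by rewrite col_mx0; apply: (scalemx_inj mu0); rewrite e1 scaler0.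
Qed.

(** * Triangular representatives and elementary divisors *)

Lemma block_block n1 n2 n3 n4 (N : 'M[int]_((n1 + n2) + (n3 + n4))) : N =
  block_mx (block_mx (ulsubmx (ulsubmx N)) (ursubmx (ulsubmx N))
    (dlsubmx (ulsubmx N)) (drsubmx (ulsubmx N)))
 (block_mx (ulsubmx (ursubmx N)) (ursubmx (ursubmx N)) (dlsubmx (ursubmx N))
   (drsubmx (ursubmx N)))
 (block_mx (ulsubmx (dlsubmx N)) (ursubmx (dlsubmx N)) (dlsubmx (dlsubmx N))
   (drsubmx (dlsubmx N)))
 (block_mx (ulsubmx (drsubmx N)) (ursubmx (drsubmx N)) (dlsubmx (drsubmx N))
   (drsubmx (drsubmx N))).
Proof. by rewrite !submxK. Qed.

Lemma col0_block n (a : 'M[int]_1) (N : 'M[int]_((1 + n) + (1 + n))) :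
  N *m col0 n 1%:M = col0 n a ->
  exists a01 b00 b01 b10 c01 d00 d01 d10, exists A' B' C' D', N =
   block_mx (block_mx a a01 0 A') (block_mx b00 b01 b10 B')
                     (block_mx 0 c01 0 C') (block_mx d00 d01 d10 D').
Proof.
have -> : col0 n a = col_mx (col_mx a 0) (col_mx 0 0) by rewrite col_mx0.
rewrite col0E.
case/eq_col_mx => /eq_col_mx[ha h0] /eq_col_mx[h1 h2].
rewrite {1}(block_block N) ha h0 h1 h2.
by do 12!eexists.
Qed.

(** Induction on the genus: a symplectic matrix moves the first column
    onto the first axis, and the lower row and column of the first plane then
    vanish automatically. *)
Lemma simil_upper n (mu : int) (N : 'M[int]_(n + n)) : mu != 0 -> simil mu N ->
  exists2 g, is_sp g & dlsubmx (g *m N) = 0.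
Proof.
move=> mu0; elim: n N => [|n IH]; last rewrite -[n.+1]/(1 + n)%N; move=> N sN.
  by exists 1%:M; [exact: simil1 | apply/matrixP=> -[]].
have [g gs [a ga]] := @sp_col n (N *m col0 n 1%:M).
rewrite mulmxA in ga.
have [a01 [b00 [b01 [b10 [c01 [d00 [d01 [d10 [A' [B' [C' [D' E]]]]]]]]]]]] :=
  col0_block ga.
have := similM gs sN; rewrite mul1r E =>
  /(peel_block mu0)[_ hc hd /IH[g' gs' hg'] _].
exists (esum 1%:M g' *m g).
  by apply: is_spM => //; apply: esum_simil => //; exact: simil1.
rewrite -mulmxA E hc -{1}(submxK g') scalar_mx_block esum_block mulmx_block
  block_mxKdl.
rewrite -(submxK g') mulmx_block block_mxKdl in hg'.
by rewrite !mulmx_block !mul0mx !mulmx0 ?addr0 ?add0r add_block_mx ?addr0 ?add0r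
  hg' block_mx0.
Qed.

(** The elementary divisor matrix diag(p^(a_i); p^(delta - a_i)). *)
Definition sp_diag n (p delta : nat) (a : 'I_n -> nat) : 'M[int]_(n + n) :=
  block_mx (diag_mx (\row_i (p ^ a i)%N%:R)) 0 0
    (diag_mx (\row_i (p ^ (delta - a i))%N%:R)).

Lemma sp_diagS n p delta (a : 'I_(1 + n) -> nat) : a (lshift n 0) = 0%N ->
  sp_diag p delta a =
  esum (block_mx 1%:M 0 0 (p ^ delta)%N%:R%:M) (sp_diag p delta (fun i =>
    a (rshift 1 i))).
Proof.
move=> a0; rewrite /sp_diag esum_block.
have E (f : 'I_(1 + n) -> int) : diag_mx (\row_i f i) =
   block_mx (f (lshift n 0))%:M 0 0 (diag_mx (\row_i f (rshift 1 i))).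
  rewrite -[LHS]submxK; congr block_mx; apply/matrixP=> i j;
    by rewrite !mxE ?ord1 ?eqxx ?eq_rshift ?eq_lrshift ?eq_rlshift.
by rewrite !E a0 expn0 subn0 !block_mx0.
Qed.

Lemma sp_diag_shift n p delta (a : 'I_n -> nat) : (forall i, (a i).*2 <=
  delta)%N ->
  sp_diag p delta.+2 (fun i => (a i).+1) = p%:R *: sp_diag p delta a.
Proof.
move=> ha; rewrite /sp_diag scale_block_mx !scaler0; congr block_mx;
  apply/matrixP => i j; rewrite !mxE.
  by rewrite [RHS]mulrnAr -natrM -expnS.
rewrite [RHS]mulrnAr -natrM -expnS; congr (_%:R *+ _); congr (p ^ _)%N.
by have := ha i; lia.
Qed.

Lemma prime_coprime_unit (p delta : nat) (a d : int) : prime p ->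
  ~~ (p%:Z %| a)%Z ->
  a * d = (p ^ delta)%N%:R -> a = 1 \/ a = -1.
Proof.
move=> pp pa h.
have /dvdn_pfactor : (`|a| %| p ^ delta)%N.
  by apply/dvdnP; exists `|d|%N; rewrite mulnC -abszM h natz.
case=> // k _ hk; case: k hk => [|k] hk; first by move: hk; rewrite expn0; lia.
by move: pa; rewrite dvdzE hk expnS dvdn_mulr.
Qed.

(** A column with an entry prime to p is primitive, because its content
    divides the multiplier p^delta. It can therefore be moved to the first
    basis vector exactly. *)
Lemma simil_primitive_col n p delta (N : 'M[int]_((1 + n) + (1 + n))) i0 j0 :
  prime p ->
    simil (p ^ delta)%N%:R N -> ~~ (p%:Z %| N i0 j0)%Z ->
  exists g h, [/\ is_sp g, is_sp h & g *m N *m h *m col0 n 1%:M = col0 n 1%:M].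
Proof.
move=> pp sN ndvd.
have pnz : ((p ^ delta)%N%:R : int) != 0 by rewrite pnatr_eq0 -lt0n expn_gt0
  prime_gt0.
have col0Z (a : 'M[int]_1) : col0 n a = a 0 0 *: col0 n 1%:M.
  by rewrite /col0 !scale_col_mx !scaler0 scalemx1 -mx11_scalar.
have [g1 /is_spV[h1 hs [hg _]] [b gb]] := @sp_col n (delta_mx j0 0).
have [v Ev] : exists v, v = N *m h1 *m col0 n 1%:M by eexists.
have Nv : N *m delta_mx j0 0 = b 0 0 *: v.
  by rewrite Ev scalemxAr -col0Z -gb -!mulmxA (mulmxA h1) hg mul1mx.
have pv : ~~ (p%:Z %| v i0 (0 : 'I_1)%R)%Z.
  apply: contra ndvd => pv; move/matrixP: Nv => /(_ i0 0).
  rewrite -colE !mxE => ->; exact: dvdz_mull.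
have [g2 g2s [c gc]] := @sp_col n v.
have [h2 _ [hg2 _]] := is_spV g2s.
have pc : ~~ (p%:Z %| c (0 : 'I_1)%R (0 : 'I_1)%R)%Z.
  apply: contra pv => pc.
  have -> : v = c 0 0 *: (h2 *m col0 n 1%:M) by rewrite scalemxAr -col0Z -gc
    mulmxA hg2 mul1mx.
  by rewrite mxE dvdz_mulr.
have sN2 : simil (p ^ delta)%N%:R (g2 *m N *m h1).
  by have := similM (similM g2s sN) hs; rewrite mul1r mulr1.
have E2 : g2 *m N *m h1 *m col0 n 1%:M = col0 n c by rewrite -!mulmxA (mulmxA N)
  -Ev.
have [a01 [b00 [b01 [b10 [c01 [d00 [d01 [d10 [A' [B' [C' [D' E]]]]]]]]]]]] :=
  col0_block E2.
rewrite E in sN2.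
have [cd _ _ _ _] := peel_block pnz sN2.
have /(prime_coprime_unit pp pc) cc : c 0 0 * d00 0 0 = (p ^ delta)%N%:R.
  move/matrixP: cd => /(_ 0 0); rewrite mxE big_ord1 => ->.
  by rewrite mxE eqxx mulr1n.
case: cc => hc.
  by exists g2, h1; split=> //; rewrite E2 col0Z hc scale1r.
exists (- g2), h1; split=> //; first exact: oppr_sp.
by rewrite !mulNmx E2 col0Z hc scaleN1r opprK.
Qed.

(** Once the first column is the first basis vector, the first row is
    cleared from the right by an element of the Siegel parabolic, and the
    similitude decomposes as an orthogonal sum. *)
Lemma simil_split n (mu : int) (N : 'M[int]_((1 + n) + (1 + n))) : mu != 0 ->
  simil mu N ->
  N *m col0 n 1%:M = col0 n 1%:M ->
  exists2 h, is_sp h & exists2 N', simil mu N' & N *m h =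
    esum (block_mx 1%:M 0 0 mu%:M) N'.
Proof.
move=> mu0 sN N0.
have [a01 [b00 [b01 [b10 [c01 [d00 [d01 [d10 [A' [B' [C' [D' E]]]]]]]]]]]] :=
  col0_block N0.
have trc : (col0 n 1%:M)^T = row_mx (row_mx 1%:M 0) 0 :> 'rV[int]_((1 + n) +
  (1 + n)).
  by rewrite /col0 !tr_col_mx !trmx0 trmx1.
have rowE (P : 'M[int]_((1 + n) + (1 + n))) : (col0 n 1%:M)^T *m P =
    row_mx (row_mx (ulsubmx (ulsubmx P)) (ursubmx (ulsubmx P)))
           (row_mx (ulsubmx (ursubmx P)) (ursubmx (ursubmx P))).
  by rewrite trc {1}(block_block P) !mul_row_block !mul0mx !mul1mx !addr0.
pose V : 'M[int]_(1 + n) := block_mx 1%:M (- a01) 0 1%:M.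
have Vu : V \in unitmx by rewrite unitmxE det_ublock !det1 mulr1 unitr1.
pose W := (invmx V)^T.
pose b := row_mx b00 b01 *m W.
(* The first row of T must be the negative of what the Levi factor leaves
   in the upper right block; the first column is forced by symmetry. *)
pose T : 'M[int]_(1 + n) := - block_mx (lsubmx b) (rsubmx b) (rsubmx b)^T 0.
have Ts : T^T = T.
  by rewrite /T linearN /= tr_block_mx trmxK trmx0 [lsubmx b]mx11_scalar
    tr_scalar_mx.
pose h := levi V W *m block_mx 1%:M T 0 1%:M.
have hs : is_sp h by apply: is_spM; [exact: levi_sp_tr | exact: shear_sp].
exists h => //.
have sNh : simil mu (N *m h) by have := similM sN hs; rewrite mulr1.
have h0 : h *m col0 n 1%:M = col0 n 1%:M.
  rewrite /h -mulmxA /col0 !mul_block_col !mul0mx !mul1mx !mulmx0 !addr0.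
  by rewrite add0r mulmx0 /V mul_block_col !mulmx0 !mul0mx mulmx1 !addr0.
have Nh0 : N *m h *m col0 n 1%:M = col0 n 1%:M by rewrite -mulmxA h0.
have r0 : (col0 n 1%:M)^T *m (N *m h) = row_mx (row_mx 1%:M 0) 0.
  rewrite mulmxA rowE E block_mxKul block_mxKur !(block_mxKul, block_mxKur) /h
    mulmxA.
  rewrite mul_row_block !mulmx0 addr0 add0r -/b mul_row_block !mulmx1 !mulmx0
    addr0.
  have -> : row_mx 1%:M a01 *m V = row_mx 1%:M 0.
    by rewrite mul_row_block !mulmx1 !mul1mx mulmx0 addr0 addNr.
  congr row_mx; rewrite /T mulmxN mul_row_block !mul1mx !mul0mx !addr0 hsubmxK.
  exact: addNr.
have [a01' [b00' [b01' [b10'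
  [c01' [d00' [d01' [d10' [A1 [B1 [C1 [D1 E1]]]]]]]]]]]] := col0_block Nh0.
move: r0; rewrite rowE E1 -[X in _ = row_mx _ X]row_mx0 block_mxKul block_mxKur
  !(block_mxKul, block_mxKur).
case/eq_row_mx => /eq_row_mx[_ ha] /eq_row_mx[hb0 hb1].
rewrite E1 in sNh.
have [hd hc1 hd1 sN' /(_ ha hb1)[hb10 hd10]] := peel_block mu0 sNh.
rewrite mul1mx in hd.
exists (block_mx A1 B1 C1 D1) => //.
by rewrite esum_block ha hb0 hb1 hc1 hd1 hb10 hd10 hd.
Qed.

Lemma simil_scale n mu c (N : 'M[int]_(n + n)) : simil mu (c *: N) ->
  c ^+ 2 *: (N^T *m symplectic_form int n *m N) = mu *: symplectic_form int n.
Proof.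
rewrite /simil (_ : (c *: N)^T = c *: N^T); last by apply/matrixP=> i j;
  rewrite !mxE.
by rewrite -!scalemxAl -scalemxAr scalerA.
Qed.

(** Symplectic elementary divisors for multipliers that are powers of p.
    If p divides the matrix, divide it out and use induction on delta;
    otherwise some column is primitive, a hyperbolic plane splits off, and
    induction on the genus applies. *)
Lemma simil_SNF n p delta (N : 'M[int]_(n + n)) : prime p ->
  simil (p ^ delta)%N%:R N ->
  exists g h a, [/\ is_sp g, is_sp h, forall i j : 'I_n, (i <= j)%N ->
    (a i <= a j)%N,
    forall i, ((a i).*2 <= delta)%N & N = g *m sp_diag p delta a *m h].
Proof.
move=> pp; elim: n delta N => [|n IHn]; last rewrite -[n.+1]/(1 + n)%N; move=>
  delta.
  move=> N _; exists 1%:M, 1%:M, (fun=> 0%N); split;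
    do ?[exact: simil1 | by case].
  by apply/matrixP=> -[].
have [k] := ubnP delta; elim: k delta => // k IHk delta /ltnSE ledk N sN.
have pnz d : ((p ^ d)%N%:R : int) != 0 by rewrite pnatr_eq0 -lt0n expn_gt0
  prime_gt0.
have pz : (p%:R : int) != 0 by have := pnz 1%N; rewrite expn1.
have [/forallP all_dvd|] := boolP [forall i, [forall j, (p%:Z %| N i j)%Z]].
  pose N1 := map_mx (fun x => (x %/ p%:Z)%Z) N.
  have EN : N = p%:R *: N1.
    by apply/matrixP=> i j; rewrite !mxE natz mulrC divzK //;
      exact: (forallP (all_dvd i)).
  have d2 : (1 < delta)%N.
    rewrite ltnNge; apply/negP => d1.
    move: sN; rewrite EN => /simil_scale/matrixP.
    move=> /(_ (lshift _ (lshift n 0)) (rshift _ (lshift n 0))).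
    rewrite [RHS]mxE [LHS]mxE.
    have -> : symplectic_form int (1 + n) (lshift _ (lshift n 0))
      (rshift _ (lshift n 0)) = 1.
      by rewrite /symplectic_form block_mxEur mxE eqxx.
    move: (_ (lshift _ _) _) => z; rewrite mulr1 => hz.
    have : (p ^ 2 %| p ^ delta)%N.
      apply/dvdnP; exists `|z|%N; move/(congr1 absz): hz.
      by rewrite !abszM !natz /= => <-; rewrite mulnC expnS expn1.
    by rewrite (dvdn_Pexp2l _ _ (prime_gt1 pp)) => h2; move: (leq_trans h2 d1).
  case: delta d2 => [|[|delta]] // _ in ledk sN *.
  have sN1 : simil (p ^ delta)%N%:R N1.
    move: sN; rewrite EN => /simil_scale h.
    apply: (@scalemx_inj _ _ (p%:R ^+ 2)); first by rewrite expf_neq0.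
    by rewrite h scalerA -natrX -natrM -expnD.
  have [||g [h [a [gs hs ma da EN1]]]] := IHk delta _ N1 => //.
    by apply: leq_trans ledk.
  exists g, h, (fun i => (a i).+1); split=> //.
  rewrite sp_diag_shift // EN EN1 -scalemxAr -scalemxAl.
  by [].
case/forallPn => i0 /forallPn[j0 ndvd].
have [g1 [h1 [gs1 hs1 E1]]] := simil_primitive_col pp sN ndvd.
have sN1 : simil (p ^ delta)%N%:R (g1 *m N *m h1).
  by have := similM (similM gs1 sN) hs1; rewrite mul1r mulr1.
have [h2 hs2 [N' sN' E2]] := simil_split (pnz _) sN1 E1.
have [g3 [h3 [a [gs3 hs3 ma da E3]]]] := IHn _ _ sN'.
have [g1' gs1' [gg1 _]] := is_spV gs1.
have [h1' hs1' [_ hh1]] := is_spV hs1.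
have [h2' hs2' [_ hh2]] := is_spV hs2.
have sp1 : is_sp (1%:M : 'M[int]_(1 + 1)) by exact: simil1.
pose a' (i : 'I_(1 + n)) := if split i is inr j then a j else 0%N.
have a'r j : a' (rshift 1 j) = a j by rewrite /a' (unsplitK (inr j)).
have a'l j : a' (lshift n j) = 0%N by rewrite /a' (unsplitK (inl j)).
exists (g1' *m esum 1%:M g3), (esum 1%:M h3 *m h2' *m h1'), a'; split.
- by apply: is_spM => //; exact: esum_simil.
- by apply: is_spM => //; apply: is_spM => //; exact: esum_simil.
- move=> i j; case: (split_ordP i) => i' ->; case: (split_ordP j) => j' ->;
  rewrite ?a'l ?a'r //=.
  by rewrite ord1 leqNgt ltnS => /negP[].
  by rewrite leq_add2l => /ma.
- by move=> i; case: (split_ordP i) => i' ->; rewrite ?a'l ?a'r.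
rewrite sp_diagS ?a'l // (_ : sp_diag p delta (fun i => a' (rshift 1 i)) =
  sp_diag p delta a); last first.
  by congr block_mx; apply/matrixP=> i j; rewrite !mxE a'r.
rewrite !mulmxA -(mulmxA g1') esumM mul1mx -(mulmxA g1') esumM mulmx1 -E3 -E2.
rewrite !mulmxA gg1 mul1mx -!mulmxA (mulmxA h2) hh2 mul1mx hh1 mulmx1.
by [].
Qed.

(** * Reduced row echelon forms over a finite field *)

Section RREF.
Variables (F : finFieldType) (n : nat).
Implicit Types (K J : {set 'I_n}) (X M V : 'M[F]_n).

Definition proj K : 'M[F]_n := diag_mx (\row_i (i \in K)%:R).

Definition echelon_tail K X : bool :=
  [forall i, forall j, (X i j != 0) ==> [&& i \in K, j \notin K & (i < j)%N]].

Lemma echelon_tailP K X :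
  reflect (forall i j, ~~ [&& i \in K, j \notin K & (i < j)%N] -> X i j = 0)
    (echelon_tail K X).
Proof.
apply: (iffP 'forall_forallP) => [h i j|h i j].
  by move=> /negP hij; apply/eqP; apply: contraNT (introN idP hij) => hX;
    exact: (implyP (h i j)).
by apply/implyP; apply: contraNT => /h ->.
Qed.

Lemma projE K i j : proj K i j = ((i == j) && (i \in K))%:R.
Proof.
rewrite !mxE; case: eqP => [->|_]; by rewrite ?mulr1n ?mulr0n.
Qed.

Lemma mul_projE K M i j : (proj K *m M) i j = (i \in K)%:R * M i j.
Proof. by rewrite /proj mul_diag_mx !mxE. Qed.

Lemma mulr_projE m K (M : 'M[F]_(m, n)) i j : (M *m proj K) i j =
  M i j * (j \in K)%:R.
Proof. by rewrite /proj mul_mx_diag !mxE. Qed.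

Lemma proj_tail K X : echelon_tail K X -> proj K *m X = X.
Proof.
move=> /echelon_tailP h; apply/matrixP=> i j; rewrite mul_projE.
case iK: (i \in K); rewrite ?mul1r //.
by rewrite mul0r h // iK.
Qed.

Lemma tail_proj K X : echelon_tail K X -> X *m proj K = 0.
Proof.
move=> /echelon_tailP h; apply/matrixP=> i j; rewrite mulr_projE mxE.
case jK: (j \in K); rewrite ?mulr0 // mulr1 h // jK /= andbF //.
Qed.

Lemma tail_tail K X Y : echelon_tail K X -> echelon_tail K Y -> X *m Y = 0.
Proof. by move=> hX hY; rewrite -(proj_tail hY) mulmxA tail_proj // mul0mx. Qed.

Lemma proj_idem K : proj K *m proj K = proj K.
Proof.
by apply/matrixP=> i j; rewrite mul_projE !projE; case: (i \in K);
  rewrite ?mul1r ?mul0r ?andbF.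
Qed.

(** Rows outside of the pivot set are zero instead of being omitted, so
    that the reduced row echelon form of a subspace is a square idempotent
    matrix. *)
Definition echelon K X : 'M[F]_n := proj K + X.

Lemma echelon_mul K X Y : echelon_tail K X -> echelon_tail K Y ->
  echelon K X *m echelon K Y = echelon K Y.
Proof.
move=> hX hY; rewrite /echelon mulmxDl !mulmxDr proj_idem (proj_tail hY)
  (tail_proj hX) (tail_tail hX hY).
by rewrite !addr0.
Qed.

Lemma echelon_sub m (A : 'M_(m, n)) K X : echelon_tail K X ->
  (A <= echelon K X)%MS -> A *m echelon K X = A.
Proof. by move=> hX /submxP[D ->]; rewrite -mulmxA (echelon_mul hX hX). Qed.

Lemma echelon_ltE K X (i j : 'I_n) : echelon_tail K X -> (j < i)%N ->
  (echelon K X) i j = 0.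
Proof.
move=> /echelon_tailP hX ji; rewrite /echelon mxE projE hX ?addr0;
  last by rewrite (ltnNge i) (ltnW ji) !andbF.
by case: eqP => // eij; rewrite eij ltnn in ji.
Qed.

Lemma echelon_diagE K X i : echelon_tail K X -> (echelon K X) i i =
  (i \in K)%:R.
Proof.
by move=> /echelon_tailP hX; rewrite /echelon mxE projE eqxx hX ?addr0 // ltnn
  !andbF.
Qed.

(** Both matrices are upper triangular, so the diagonal of their product
    is the product of their diagonals. *)
Lemma echelon_pivot_sub K X K' X' : echelon_tail K X -> echelon_tail K' X' ->
  (echelon K X <= echelon K' X')%MS -> K \subset K'.
Proof.
move=> hX hX' /(echelon_sub hX') /matrixP h; apply/subsetP => i iK.
have := h i i; rewrite [LHS]mxE (echelon_diagE _ hX) iK (bigD1 i) //=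
  !echelon_diagE // iK mul1r.
rewrite big1 ?addr0 => [|k ki].
  by case: (i \in K') => // /esym/eqP; rewrite oner_eq0.
have [ik|] := ltnP i k; first by rewrite (echelon_ltE hX') // mulr0.
rewrite leq_eqVlt val_eqE (negPf ki) /= => ki'.
by rewrite (echelon_ltE hX) // mul0r.
Qed.

Lemma echelon_inj K X K' X' : echelon_tail K X -> echelon_tail K' X' ->
  (echelon K X :=: echelon K' X')%MS -> K = K' /\ X = X'.
Proof.
move=> hX hX' h.
have eK : K = K'.
  apply/eqP; rewrite eqEsubset; apply/andP; split.
    by apply: (echelon_pivot_sub hX hX'); rewrite h.
  by apply: (echelon_pivot_sub hX' hX); rewrite h.
split=> //; rewrite -eK in hX' h.
have : echelon K X *m echelon K X' = echelon K X by apply: echelon_sub => //;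
  rewrite h.
by rewrite (echelon_mul hX hX') => /addrI.
Qed.

(** The pivots are the leading positions of the vectors of the row space.
    A vector with a given leading position can be corrected successively at
    the later pivots, and a vector of the row space that vanishes at all
    pivots is zero since its leading position would be a pivot. *)
Lemma echelon_exists V : exists K X, echelon_tail K X /\ (V :=: echelon K X)%MS.
Proof.
pose lead (v : 'rV[F]_n) (i : 'I_n) := (v 0 i == 1) && [forall j : 'I_n,
  (j < i)%N ==> (v 0 j == 0)].
have leadP (v : 'rV[F]_n) (i : 'I_n) : reflect (v 0 i = 1 /\ forall j : 'I_n,
  (j < i)%N -> v 0 j = 0) (lead v i).
  apply: (iffP andP) => -[/eqP h1 h2]; split=> //.
    by move=> j ji; exact/eqP/(implyP (forallP h2 j)).
  by apply/forallP=> j; apply/implyP=> /h2/eqP.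
pose K := [set i | [exists v : 'rV[F]_n, (v <= V)%MS && lead v i]].
have KP i : i \in K -> exists2 v : 'rV[F]_n, (v <= V)%MS & lead v i.
  by rewrite inE => /existsP[v /andP[]]; exists v.
have reduced i (m : nat) : i \in K -> exists2 w : 'rV[F]_n, (w <= V)%MS &
  lead w i /\
    forall j : 'I_n, j \in K -> (i < j)%N -> (j < m)%N -> w 0 j = 0.
  move=> iK; elim: m => [|m [w wV [wl hw]]]; first by have [v vV vl] := KP i iK;
    exists v.
  have [/existsP[j /and3P[jK ij /eqP jm]]|no] :=
      boolP [exists j : 'I_n, [&& j \in K, (i < j)%N & j == m :> nat]].
    have [v vV /leadP[v1 v0]] := KP j jK.
    exists (w - w 0 j *: v); first by rewrite addmx_sub // eqmx_opp scalemx_sub.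
    have low (k : 'I_n) : (k < j)%N -> (w - w 0 j *: v) 0 k = w 0 k.
      by move=> kj; rewrite !mxE v0 // mulr0 subr0.
    split.
      case/leadP: wl => w1 w0; apply/leadP; split; first by rewrite low.
      by move=> k ki; rewrite low ?w0 // (ltn_trans ki).
    move=> k kK ik; rewrite ltnS leq_eqVlt => /orP[/eqP km|km].
      have -> : k = j by apply/val_inj; rewrite /= km jm.
      by rewrite !mxE v1 mulr1 subrr.
    by rewrite low ?jm // hw.
  exists w => //; split=> // j jK ij; rewrite ltnS leq_eqVlt => /orP[jm|];
    last exact: hw.
  by case/existsP: no; exists j; rewrite jK ij jm.
have /fin_all_exists[w hw] (i : 'I_n) : exists w : 'rV[F]_n, i \in K ->
    [/\ (w <= V)%MS, lead w i & forall j : 'I_n, j \in K -> (i < j)%N -> w 0 j =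
      0].
  case iK: (i \in K); last by exists 0.
  have [w wV [wl w0]] := reduced i n iK; exists w => _; split=> // j jK ij;
    exact: w0.
pose X : 'M[F]_n := \matrix_i (if i \in K then w i - delta_mx 0 i else 0).
have hX : echelon_tail K X.
  apply/echelon_tailP=> i j; rewrite mxE.
  case iK: (i \in K); last by rewrite mxE.
  have [_ /leadP[wi w0] wK] := hw i iK.
  rewrite !mxE eqxx /= negb_and negbK -leqNgt => /orP[jK|].
    case: (ltngtP i j) => [ij|ji|/val_inj eij].
    - by rewrite wK // -val_eqE (gtn_eqF ij) subrr.
    - by rewrite w0 // -val_eqE (ltn_eqF ji) subrr.
    - by rewrite -eij wi eqxx subrr.
  rewrite leq_eqVlt => /orP[/eqP/val_inj ->|ji]; first by rewrite wi eqxx subrr.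
  by rewrite w0 // -val_eqE (ltn_eqF ji) subrr.
have rowM i : row i (echelon K X) = if i \in K then w i else 0.
  apply/rowP=> j; rewrite /echelon !mxE; case iK: (i \in K).
    rewrite !mxE eqxx /= [j == i]eq_sym; case: (i == j); rewrite ?mulr1n
      ?mulr0n; by rewrite addrC subrK.
  by rewrite mul0rn !mxE addr0.
exists K, X; split=> //; apply/eqmxP/andP; split; last first.
  apply/row_subP=> i; rewrite rowM; case iK: (i \in K); last exact: sub0mx.
  by have [] := hw i iK.
apply/row_subP=> i; set v := row i V.
have vV : (v <= V)%MS by exact: row_sub.
pose u := v - v *m echelon K X.
have uV : (u <= V)%MS.
  rewrite addmx_sub // eqmx_opp; apply: submx_trans (submxMl _ _) _.
  apply/row_subP=> k; rewrite rowM; case kK: (k \in K); last exact: sub0mx.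
  by have [] := hw k kK.
have uK : u *m proj K = 0.
  rewrite /u /echelon mulmxBl -mulmxA mulmxDl proj_idem tail_proj // addr0 subrr
    //.
have u0 : u = 0.
  apply/eqP/negPn/negP => unz.
  have /existsP[j0 hj0] : [exists j, u 0 j != 0].
    apply: contraR unz; rewrite negb_exists => /forallP h.
    by apply/eqP/rowP=> j; rewrite [RHS]mxE; apply/eqP/negPn; exact: h.
  have [j uj jmin] := @arg_minnP _ j0 (fun j => u 0 j != 0) val hj0.
  have jK : j \in K.
    rewrite inE; apply/existsP; exists ((u 0 j)^-1 *: u); rewrite scalemx_sub
      //=.
    apply/leadP; rewrite mxE mulVf //; split=> // k kj; rewrite mxE.
    have [->|uk] := eqVneq (u 0 k) 0; first by rewrite mulr0.
    by have := jmin k uk; rewrite leqNgt kj.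
  move/matrixP: uK => /(_ 0 j); rewrite mulr_projE jK mulr1 [RHS]mxE => uj0.
  by rewrite uj0 eqxx in uj.
apply/submxP; exists v; apply/eqP; rewrite -subr_eq0; exact/eqP.
Qed.

(** The columns of M with index in J are linearly independent. *)
Definition cols_free J M := \rank (M *m proj J) == #|J|.

Lemma rank_proj J : \rank (proj J) = #|J|.
Proof.
pose w : 'M[F]_(#|J|, n) := \matrix_(a, j) (enum_val a == j)%:R.
have ww : w *m w^T = 1%:M.
  apply/matrixP=> a b; rewrite !mxE (bigD1 (enum_val a)) //= !mxE eqxx mul1r
    big1 ?addr0.
    by rewrite (inj_eq enum_val_inj) eq_sym.
  by move=> k ka; rewrite !mxE eq_sym (negPf ka) mul0r.
have wJ : w *m proj J = w.
  apply/matrixP=> a j; rewrite mulr_projE !mxE; case: eqP => [<-|_];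
    last by rewrite mul0r.
  by rewrite enum_valP mulr1.
have Jw : (proj J <= w)%MS.
  apply/row_subP=> i; case iJ: (i \in J).
    apply/submxP; exists (delta_mx 0 (enum_rank_in iJ i)); rewrite -rowE.
    by apply/rowP=> j; rewrite !mxE enum_rankK_in // iJ eq_sym; case: eqP =>
      //= ->.
  rewrite (_ : row i _ = 0) ?sub0mx //.
  by apply/rowP=> j; rewrite !mxE iJ; case: (i == j).
have wJ' : (w <= proj J)%MS by rewrite -wJ submxMl.
have -> : \rank (proj J) = \rank w by apply/eqP; rewrite eqn_leq !mxrankS.
apply/eqP; rewrite eqn_leq rank_leq_row /=.
by rewrite -{1}(mxrank1 F #|J|) -ww mxrankM_maxl.
Qed.

Lemma cols_free0 M : cols_free set0 M.
Proof.
by rewrite /cols_free cards0 -leqn0 -(cards0 'I_n) -rank_proj mxrankM_maxr.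
Qed.

Lemma cols_free_eqmx J M N : (M :=: N)%MS -> cols_free J M = cols_free J N.
Proof. by move=> h; rewrite /cols_free (eqmxMr (proj J) h). Qed.

Lemma cols_freeP J M : reflect (exists Z, Z *m M *m proj J = proj J)
  (cols_free J M).
Proof.
rewrite /cols_free -rank_proj; apply: (iffP eqP) => [h|[Z hZ]].
  have : (proj J <= M *m proj J)%MS.
    by rewrite -(geq_leqif (mxrank_leqif_sup (submxMl M (proj J)))) h.
  by case/submxP=> Z hZ; exists Z; rewrite -mulmxA -hZ.
apply/eqP; rewrite eqn_leq mxrankM_maxr -{1}hZ -mulmxA mxrankM_maxr.
by [].
Qed.

(** If the columns of M in K are independent, M has a left inverse on the
    coordinates in K, and these coordinates determine the vectors in the row
    space of the echelon form. *)
Lemma cols_free_echelon K X M : echelon_tail K X -> cols_free K M ->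
  (M *m echelon K X :=: echelon K X)%MS.
Proof.
move=> hX /cols_freeP[Z hZ]; apply/eqmxP; rewrite submxMl /=.
have pE : proj K *m echelon K X = echelon K X.
  by rewrite /echelon mulmxDr proj_idem proj_tail.
by apply/submxP; exists Z; rewrite -{1}pE -hZ -!mulmxA pE.
Qed.

End RREF.

(** * The layers of a lattice *)

Section Layers.
Variables (p n : nat).
Hypothesis pp : prime p.
Implicit Types (K J : {set 'I_n}) (X M V : 'M['F_p]_n) (D : 'M[int]_n).

Definition redp (m1 m2 : nat) (D : 'M[int]_(m1, m2)) : 'M['F_p]_(m1, m2) :=
  map_mx intr D.
Definition lift X : 'M[int]_n := map_mx (fun x : 'F_p => (x : nat)%:Z) X.

(** A basis of the lattice between p Z^n and Z^n whose image modulo p has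
    the echelon form with pivots K and tail X. *)
Definition layer_mx K X : 'M[int]_n :=
  diag_mx (\row_i (if i \in K then 1 else p%:R)) + lift X.

(** p times the inverse of the previous matrix. Its rows generate the
    lattice of all vectors whose coordinates in K are divisible by p, which is
    why only K matters for the remaining layers. *)
Definition layer_cmx K X : 'M[int]_n :=
  (1%:M - lift X) *m diag_mx (\row_i (if i \in K then p%:R else 1)).

Lemma pFp0 : (p%:R : 'F_p) = 0.
Proof. by apply/eqP; rewrite -(dvdn_pcharf (pchar_Fp pp)). Qed.

Lemma redpM m1 m2 m3 (D : 'M[int]_(m1, m2)) (D' : 'M[int]_(m2, m3)) : redp
  (D *m D') = redp D *m redp D'.
Proof. exact: map_mxM. Qed.

Lemma redpD m1 m2 (D D' : 'M[int]_(m1, m2)) : redp (D + D') = redp D + redp D'.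
Proof. exact: map_mxD. Qed.

Lemma redp_scale m1 m2 (D : 'M[int]_(m1, m2)) : redp (p%:R *: D) = 0.
Proof.
by rewrite /redp map_mxZ rmorph_nat pFp0 scale0r.
Qed.

Lemma redp_eq0 m1 m2 (D : 'M[int]_(m1, m2)) : redp D = 0 ->
  exists D' : 'M[int]_(m1, m2), D = p%:R *: D'.
Proof.
move=> /matrixP h; exists (map_mx (fun x => (x %/ p%:Z)%Z) D).
apply/matrixP=> i j; rewrite !mxE natz mulrC divzK //.
by rewrite (dvdz_pcharf (pchar_Fp pp)); have := h i j; rewrite !mxE => ->.
Qed.

Lemma redp_lift X : redp (lift X) = X.
Proof. by apply/matrixP=> i j; rewrite !mxE /= -[RHS]natr_Zp. Qed.

Lemma redp1 m : redp (1%:M : 'M[int]_m) = 1%:M.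
Proof. exact: map_mx1. Qed.

Lemma redp_layer_mx K X : redp (layer_mx K X) = echelon K X.
Proof.
rewrite redpD redp_lift /echelon; congr (_ + _); apply/matrixP=> i j.
rewrite projE !mxE; case: eqP => [->|_]; rewrite ?mulr0n //= mulr1n.
by case: ifP => _; rewrite ?rmorph1 // rmorph_nat pFp0.
Qed.

Lemma redp_layer_cmx K X : redp (layer_cmx K X) = (1%:M - X) *m proj _ (~: K).
Proof.
rewrite redpM; congr (_ *m _).
  by rewrite /redp map_mxB map_mx1 -[in RHS](redp_lift X).
apply/matrixP=> i j; rewrite projE !mxE; case: eqP => [->|_]; rewrite ?mulr0n
  //= mulr1n inE.
by case: (_ \in _); rewrite ?rmorph1 // rmorph_nat pFp0.
Qed.

Lemma lift_sqr K X : echelon_tail K X -> lift X *m lift X = 0.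
Proof.
move=> /echelon_tailP hX; apply/matrixP=> i j; rewrite !mxE big1 // => k _;
  rewrite !mxE.
case kK: (k \in K); first by rewrite (hX i k) ?mul0r // kK !andbF.
by rewrite (hX k j) ?mulr0 // kK.
Qed.

Lemma mul_layer_cmx K X : echelon_tail K X -> layer_cmx K X *m layer_mx K X =
  p%:R%:M.
Proof.
move=> hX; rewrite /layer_cmx /layer_mx -mulmxA mulmxDr mulmx_diag.
have -> : diag_mx (\row_j ((\row_i (if i \in K then p%:R else 1)) 0 j *
      (\row_i (if i \in K then 1 else p%:R)) 0 j)) = p%:R%:M :> 'M[int]_n.
  apply/matrixP=> i j; rewrite !mxE; case: (_ \in _); by rewrite ?mulr1 ?mul1r.
have -> : diag_mx (\row_i (if i \in K then p%:R else 1)) *m lift X = p%:R *: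
  lift X.
  apply/matrixP=> i j; rewrite mul_diag_mx !mxE; case iK: (_ \in _) => //.
  by move/echelon_tailP: hX => hX; rewrite hX ?mulr0 // iK.
rewrite -(scalemx1 _ p%:R) -scalerDr -scalemxAr mulmxDr mulmx1 mulmxBl mul1mx
  (lift_sqr hX) subr0 subrK.
reflexivity.
Qed.

Lemma p_neq0 : (p%:R : int) != 0.
Proof. by rewrite pnatr_eq0 -lt0n prime_gt0. Qed.

Lemma mul_layer_mx_cmx K X : echelon_tail K X -> layer_mx K X *m layer_cmx K X =
  p%:R%:M.
Proof. move=> hX; exact: (mulmx_scalarC p_neq0 (mul_layer_cmx hX)). Qed.

Lemma layer_mx_cancel m (D1 D2 : 'M[int]_(m, n)) K X : echelon_tail K X ->
  D1 *m layer_mx K X = D2 *m layer_mx K X -> D1 = D2.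
Proof.
move=> hX /(congr1 (mulmx^~ (layer_cmx K X))); rewrite /=
  -!mulmxA mul_layer_mx_cmx // !mul_mx_scalar.
exact: scalemx_inj p_neq0.
Qed.

(** p^delta D^-1 is integral. *)
Definition divides_pow delta D := exists D', D' *m D = (p ^ delta)%N%:R%:M.

Lemma redp_pow delta m : redp ((p ^ delta.+1)%N%:R%:M : 'M[int]_m) = 0.
Proof. by rewrite expnS natrM -scale_scalar_mx redp_scale. Qed.

Lemma pow_neq0 delta : ((p ^ delta)%N%:R : int) != 0.
Proof. by rewrite pnatr_eq0 -lt0n expn_gt0 prime_gt0. Qed.

(** E = layer_mx K X is the basis of the lattice Z^n D + p Z^n, so that D
    = D1 E. From E = Z D + p Y one gets 1 = Z D1 + Y (p E^-1), and p E^-1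
    vanishes modulo p on the coordinates in K: this gives the condition on D1.
    *)
Lemma layer_split delta D : divides_pow delta.+1 D -> exists K X D',
  [/\ echelon_tail K X, D = D' *m layer_mx K X, divides_pow delta D',
      cols_free K (redp D') & (redp D :=: echelon K X)%MS].
Proof.
case=> Ds hDs.
have hDsC := mulmx_scalarC (pow_neq0 _) hDs.
have [K [X [hX eK]]] := echelon_exists (redp D).
have hE : echelon K X *m redp (layer_cmx K X) = 0.
  by rewrite -redp_layer_mx -redpM mul_layer_mx_cmx // -scalemx1 redp_scale.
have [D' hD'] : exists D', D *m layer_cmx K X = p%:R *: D'.
  apply: redp_eq0; rewrite redpM.
  have /submxP[Z ->] : (redp D <= echelon K X)%MS by rewrite eK.
  by rewrite -mulmxA hE mulmx0.
have eD : D = D' *m layer_mx K X.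
  apply: (scalemx_inj p_neq0); rewrite scalemxAl -hD' -mulmxA mul_layer_cmx //.
  by rewrite mul_mx_scalar.
have /submxP[Z hZ] : (echelon K X <= redp D)%MS by rewrite eK.
have [W hW] : exists W, layer_mx K X *m Ds = p%:R *: W.
  apply: redp_eq0; rewrite redpM redp_layer_mx hZ -mulmxA -redpM hDsC redp_pow
    mulmx0.
  by [].
exists K, X, D'; split=> //.
  exists W; apply: (scalemx_inj p_neq0); apply: (scalemx_inj p_neq0).
  have : (p%:R *: W) *m (p%:R *: D') = p%:R *: (p%:R *: (p ^ delta)%N%:R%:M).
    rewrite -hW -hD' mulmxA -(mulmxA _ Ds) hDs mul_mx_scalar -scalemxAl
      mul_layer_mx_cmx //.
    rewrite -!(scalemx1 _ (_%:R : int)) !scalerA; congr (_ *: _).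
    by rewrite -!natrM expnS mulnC mulnA.
  by rewrite -scalemxAl -scalemxAr.
apply/cols_freeP.
have [Y hY] : exists Y, layer_mx K X - lift Z *m D = p%:R *: Y.
  by apply: redp_eq0; rewrite /redp map_mxB -/(redp _) -/(redp _) redpM
    redp_layer_mx redp_lift hZ subrr.
exists Z.
have h1 : 1%:M = lift Z *m D' + Y *m layer_cmx K X.
  apply: (@layer_mx_cancel _ _ _ K X) => //.
  rewrite mul1mx mulmxDl -(mulmxA (lift Z)) -(mulmxA Y) mul_layer_cmx //
    mul_mx_scalar -hY -eD addrC subrK.
  by [].
have := congr1 (@redp n n) h1; rewrite redp1 redpD (redpM (lift Z)) (redpM Y)
  redp_lift redp_layer_cmx => h2.
have := congr1 (mulmx^~ (proj _ K)) h2; rewrite /= mul1mx (mulmxDl (Z *m _))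
  -(mulmxA (redp Y)) -(mulmxA (1%:M - X)).
have -> : proj 'F_p (~: K) *m proj _ K = 0.
  by apply/matrixP=> i j; rewrite mul_projE projE inE mxE; case: (i \in K);
    rewrite ?mul0r ?andbF ?mulr0.
by rewrite !mulmx0 addr0 => <-.
Qed.

Lemma layer_row K X D' : echelon_tail K X -> cols_free K (redp D') ->
  (redp (D' *m layer_mx K X) :=: echelon K X)%MS.
Proof.
by move=> hX hD; rewrite redpM redp_layer_mx; exact: cols_free_echelon.
Qed.

Lemma layer_divides delta K X D' : echelon_tail K X -> divides_pow delta D' ->
  divides_pow delta.+1 (D' *m layer_mx K X).
Proof.
move=> hX [Ds hDs]; exists (layer_cmx K X *m Ds).
rewrite -mulmxA (mulmxA Ds) hDs mulmxA mul_mx_scalar -scalemxAl mul_layer_cmx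
  //.
by rewrite -scalemx1 scalerA -natrM mulnC -expnS scalemx1.
Qed.

(** The pairs (K, X) are the subspaces of F_p^n that project onto the
    coordinates in J. *)
Definition layers J : seq ({set 'I_n} * 'M['F_p]_n) :=
  [seq KX <- enum predT | echelon_tail KX.1 KX.2 && cols_free J
    (echelon KX.1 KX.2)].

(** Representatives, modulo GL_n(Z) on the left, of the integral matrices
    D with p^delta D^-1 integral and with independent columns in J modulo p.
    They are products of layers; consecutive layers are linked only through
    the pivot set of the later factor. *)
Fixpoint lattice_reps delta J : seq 'M[int]_n :=
  if delta is d.+1 then
    [seq D *m layer_mx KX.1 KX.2 | KX <- layers J, D <- lattice_reps d KX.1]
  else [:: 1%:M].

Lemma mem_layers J K X : ((K, X) \in layers J) = echelon_tail K X && cols_free J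
  (echelon K X).
Proof. by rewrite mem_filter mem_enum andbT. Qed.

Lemma lattice_reps_ind (P : nat -> {set 'I_n} -> 'M[int]_n -> Prop) :
  (forall J, P 0%N J 1%:M) ->
  (forall delta J K X D, echelon_tail K X -> cols_free J (echelon K X) ->
     D \in lattice_reps delta K -> P delta K D -> P delta.+1 J (D *m layer_mx K
       X)) ->
  forall delta J D, D \in lattice_reps delta J -> P delta J D.
Proof.
move=> P0 PS; elim=> [|delta IH] J D /=; first by rewrite inE => /eqP ->.
case/allpairsPdep => -[K X] [D' [/=]]; rewrite mem_layers => /andP[hX hJ] hD ->.
by apply: PS => //; apply: IH.
Qed.

Lemma lattice_reps_divides delta J D : D \in lattice_reps delta J ->
  divides_pow delta D.
Proof.
move: delta J D; apply: lattice_reps_ind => [J|delta J K X D hX _ _ hD];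
  last exact: layer_divides.
by exists 1%:M; rewrite mulmx1.
Qed.

Lemma lattice_reps_cols_free delta J D : D \in lattice_reps delta J ->
  cols_free J (redp D).
Proof.
move: delta J D; apply: lattice_reps_ind => [J|delta J K X D hX hJ hD hK].
  by apply/cols_freeP; exists 1%:M; rewrite redp1 !mul1mx.
by rewrite (cols_free_eqmx J (layer_row hX hK)).
Qed.

(** Induction on delta, splitting off one layer. *)
Lemma lattice_reps_exist delta J D : divides_pow delta D ->
  cols_free J (redp D) ->
  exists2 U, U \in unitmx & U *m D \in lattice_reps delta J.
Proof.
elim: delta J D => [|delta IH] J D hD hJ.
  case: hD => U hU; exists U; last by rewrite hU inE.
  by have /mulmx1_unit[] := hU.
have [K [X [D' [hX eD hD' hK eV]]]] := layer_split hD.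
have [U Uu hU] := IH _ _ hD' hK.
exists U => //; rewrite eD mulmxA; apply/allpairsPdep; exists (K, X), (U *m D');
  split=> //.
by rewrite mem_layers hX /= -(cols_free_eqmx J eV).
Qed.

Lemma redp_unit (U : 'M[int]_n) : U \in unitmx -> redp U \in unitmx.
Proof.
move=> Uu; have := congr1 (@redp n n) (mulmxV Uu); rewrite redpM redp1 =>
  /mulmx1_unit[h _].
exact: h.
Qed.

(** The first layer is determined by the row space modulo p, since the
    echelon form of a subspace is unique; it can then be cancelled. *)
Lemma lattice_reps_uniq_mod delta J D1 D2 U : D1 \in lattice_reps delta J ->
  D2 \in lattice_reps delta J ->
  U \in unitmx -> U *m D1 = D2 -> D1 = D2.
Proof.
elim: delta J D1 D2 => [|delta IH] J D1 D2 /=; first by rewrite !inE => /eqP->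
  /eqP->.
case/allpairsPdep => -[K X] [D1' [/=]]; rewrite mem_layers => /andP[hX _] h1 ->.
case/allpairsPdep => -[K' X'] [D2' [/=]]; rewrite mem_layers => /andP[hX' _]
  h2 -> Uu eU.
have eKX : (echelon K X :=: echelon K' X')%MS.
  apply: eqmx_trans (layer_row hX' (lattice_reps_cols_free h2)); rewrite -eU.
  apply: eqmx_trans (eqmx_sym (layer_row hX (lattice_reps_cols_free h1))) _.
  rewrite (redpM U); apply/eqmx_sym/eqmxMfull; rewrite row_full_unit;
    exact: redp_unit.
have [eK eX] := echelon_inj hX hX' eKX; subst K' X'.
congr (_ *m _); apply: (IH K) => //.
by apply: (layer_mx_cancel hX); rewrite -mulmxA.
Qed.

Lemma lattice_reps_uniq delta J : uniq (lattice_reps delta J).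
Proof.
elim: delta J => [|delta IH] J //=; apply: allpairs_uniq_dep => //.
  by rewrite filter_uniq // enum_uniq.
move=> _ _ /allpairsPdep[[K X] [D [h1 h2 ->]]] /allpairsPdep[[K' X']
  [D' [h1' h2' ->]]] /= eD.
move: h1 h1'; rewrite !mem_layers => /andP[hX _] /andP[hX' _].
have eKX : (echelon K X :=: echelon K' X')%MS.
  apply: eqmx_trans (layer_row hX' (lattice_reps_cols_free h2')); rewrite -eD.
  exact/eqmx_sym/(layer_row hX (lattice_reps_cols_free h2)).
have [eK eX] := echelon_inj hX hX' eKX; subst K' X'.
by rewrite (layer_mx_cancel hX eD).
Qed.

End Layers.

(** * Symmetric matrices killed by a lattice *)

(** Left and right multiplication by the projection to K show that the
    echelon form and the projection have the same rank. *)
Lemma echelon_rank (n : nat) (F : finFieldType) (K : {set 'I_n}) (X : 'M[F]_n) :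
  echelon_tail K X -> \rank (echelon K X) = #|K|.
Proof.
move=> hX; rewrite -(rank_proj F); apply/eqP; rewrite eqn_leq.
have pE : proj F K *m echelon K X = echelon K X.
  by rewrite /echelon mulmxDr proj_idem proj_tail.
have Ep : echelon K X *m proj F K = proj F K.
  by rewrite /echelon mulmxDl proj_idem tail_proj // addr0.
by rewrite -{1}pE mxrankM_maxl -{1}Ep mxrankM_maxl.
Qed.

(** Half of |S|^2 plus half of the diagonal. *)
Lemma card_pairs_le (n : nat) (S : {set 'I_n}) :
  #|[set ij : 'I_n * 'I_n | [&& (ij.1 <= ij.2)%N, ij.1 \in S & ij.2 \in S]]| =
    'C(#|S|.+1, 2).
Proof.
pose A := [set ij : 'I_n * 'I_n | [&& (ij.1 <= ij.2)%N, ij.1 \in S &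
  ij.2 \in S]].
pose B := [set ij : 'I_n * 'I_n | [&& (ij.2 <= ij.1)%N, ij.1 \in S &
  ij.2 \in S]].
have AB : #|A| = #|B|.
  rewrite -(@card_imset _ _ (fun ij : 'I_n * 'I_n => (ij.2, ij.1)));
    last by move=> [a b] [c d] [-> ->].
  apply: eq_card => -[i j].
  apply/imsetP/idP => [[[k l]]|]; rewrite !inE /=; first by move=>
    /and3P[kl kS lS] [-> ->]; rewrite kl kS lS.
  by move=> /and3P[ji iS jS]; exists (j, i); rewrite // inE ji iS jS.
have U : #|A :|: B| = (#|S| * #|S|)%N.
  rewrite -cardsX; apply: eq_card => -[i j]; rewrite !inE /=.
  by case: (i \in S); case: (j \in S); rewrite ?andbF ?andbT //=; case: leqP =>
    // /ltnW.
have I : #|A :&: B| = #|S|.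
  have dinj : injective (fun i : 'I_n => (i, i)) by move=> i j [].
  rewrite -(card_imset _ dinj); apply: eq_card => -[i j]; rewrite !inE /=.
  apply/idP/imsetP => [|[k kS [-> ->]]]; last by rewrite leqnn kS.
  case/andP=> /and3P[ij iS _] /and3P[ji _ _]; exists i => //; congr (_, _).
  by apply/val_inj/eqP; rewrite eqn_leq ji.
have := cardsUI A B; rewrite U I -AB bin2 /= => h.
rewrite -[LHS]half_double -addnn -h; congr _./2; lia.
Qed.

Section SymKer.
Variables (p n : nat).
Hypothesis pp : prime p.
Implicit Types (K J : {set 'I_n}) (X : 'M['F_p]_n) (D : 'M[int]_n).

Definition pow_diag (e : 'I_n -> nat) : 'M[int]_n :=
  diag_mx (\row_i (p ^ e i)%N%:R).

Lemma pow_diagM e f : pow_diag e *m pow_diag f = pow_diag (fun i =>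
  e i + f i)%N.
Proof.
by rewrite mulmx_diag; congr diag_mx; apply/rowP=> i; rewrite !mxE expnD natrM.
Qed.

(** The elementary divisors of D divide p^delta, so they are powers of p
    up to sign. *)
Lemma smith_pow delta D : divides_pow p delta D ->
  exists U W e, [/\ U \in unitmx, W \in unitmx, forall i, (e i <= delta)%N &
    D = U *m pow_diag e *m W].
Proof.
case=> D' hD.
have [L Lu [R Ru [d _ eD]]] := int_Smith_normal_form D.
have {}eD : D = L *m diag_mx (\row_i d`_i) *m R.
  rewrite eD; congr (_ *m _ *m _); apply/matrixP=> i j; rewrite !mxE.
  by rewrite -val_eqE.
have h (i : 'I_n) : d`_i * (R *m D' *m L) i i = (p ^ delta)%N%:R.
  (* D' is a quasi-inverse of D, so R D' L is one of the diagonal form. *)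
  have e1 : (R *m D' *m L) *m diag_mx (\row_i d`_i) = (p ^ delta)%N%:R%:M.
    have := congr1 (fun M => R *m M *m invmx R) hD.
    rewrite /= mul_mx_scalar -scalemxAl mulmxV // scalemx1 eD => <-.
    by rewrite !mulmxA mulmxK.
  by move/matrixP: e1 => /(_ i i); rewrite mul_mx_diag !mxE eqxx mulr1n mulrC.
have he (i : 'I_n) : exists e, (e <= delta)%N /\ (`|(d`_i)%R| = p ^ e)%N.
  have /dvdn_pfactor : (`|(d`_i)%R| %| p ^ delta)%N.
    by apply/dvdnP; exists `|(R *m D' *m L) i i|%N; rewrite mulnC -abszM h natz.
  by case=> // e; exists e.
have /fin_all_exists[e hed] := he.
pose s := diag_mx (\row_(i < n) (if 0 <= d`_i then 1 else -1 : int)).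
have ss : s *m s = 1%:M.
  rewrite mulmx_diag; apply/matrixP=> i j; rewrite !mxE; by case: ifP;
    rewrite ?mulrNN mulr1.
exists (L *m s), R, e; split=> //.
- by rewrite unitmx_mul Lu /=; have /mulmx1_unit[] := ss.
- by move=> i; have [] := hed i.
rewrite eD; congr (_ *m _); rewrite -mulmxA mulmx_diag; congr (_ *m diag_mx _).
apply/rowP=> i; rewrite !mxE; have [_ <-] := hed i.
by rewrite natz; case: (d`_i) => k /=; rewrite ?mul1r // mulN1r NegzE.
Qed.

Section Count.
Variable N : nat.
Hypothesis N0 : (0 < N)%N.
Let q := (p ^ N)%N.

(** The numerators Y of the symmetric matrices S = Y / p^N modulo integral
    ones such that S D is integral. *)
Definition symker D : {set 'M['Z_q]_n} :=
  [set Y | (Y^T == Y) && (Y *m map_mx intr D == 0)].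

Lemma q_gt1 : (1 < q)%N.
Proof. by rewrite -(exp1n N) ltn_exp2r // prime_gt1. Qed.

Lemma natZq_eq0 m : ((m%:R : 'Z_q) == 0) = (q %| m)%N.
Proof. by rewrite -val_eqE /= val_Zp_nat ?q_gt1. Qed.

Lemma intZq_eq0 (m : int) : ((m%:~R : 'Z_q) == 0) = (q%:Z %| m)%Z.
Proof.
by rewrite dvdzE; case: m => m; rewrite ?NegzE ?mulrNz ?oppr_eq0 -pmulrn
  natZq_eq0.
Qed.

Lemma card_torsion e : (e <= N)%N -> #|[set z : 'Z_q | z * (p ^ e)%N%:R == 0]| =
  (p ^ e)%N.
Proof.
move=> eN; pose h (k : 'I_(p ^ e)) : 'Z_q := (k * p ^ (N - e))%N%:R.
have pe0 a : (0 < p ^ a)%N by rewrite expn_gt0 prime_gt0.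
have qE : q = (p ^ e * p ^ (N - e))%N by rewrite -expnD subnKC.
have dv m : (q %| m * p ^ e)%N = (p ^ (N - e) %| m)%N by rewrite qE (mulnC m)
  dvdn_pmul2l.
have hv k : val (h k) = (k * p ^ (N - e))%N.
  by rewrite /= val_Zp_nat ?q_gt1 // modn_small // qE ltn_mul2r pe0 /=.
have hinj : injective h.
  move=> k l /(congr1 val); rewrite !hv => /eqP; rewrite eqn_pmul2r // => /eqP;
    exact: val_inj.
rewrite -[RHS]card_ord -(card_imset _ hinj); apply: eq_card => z; rewrite inE.
have -> : (z * (p ^ e)%N%:R == 0) = (p ^ (N - e) %| val z)%N.
  by rewrite -{1}[z]natr_Zp -natrM natZq_eq0 dv.
apply/idP/imsetP => [/dvdnP[k hk]|[k _ ->]]; last by rewrite hv dvdn_mull.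
have kl : (k < p ^ e)%N.
  have : (val z < q)%N by apply: leq_trans (ltn_ord z) _; rewrite Zp_cast
    ?q_gt1.
  by rewrite hk qE ltn_mul2r pe0.
by exists (Ordinal kl) => //; apply: val_inj; rewrite hv.
Qed.

(** For a diagonal matrix the condition decouples: the entry (i, j) with i
    <= j is any element killed by both p^(e_i) and p^(e_j). *)
Lemma card_symker_diag e : (forall i, (e i <= N)%N) ->
  #|symker (pow_diag e)| =
  (\prod_(ij : 'I_n * 'I_n | (ij.1 <= ij.2)%N) p ^ minn (e ij.1) (e ij.2))%N.
Proof.
move=> eN.
pose F (ij : 'I_n * 'I_n) : {set 'Z_q} :=
  if (ij.1 <= ij.2)%N then [set z | z * (p ^ minn (e ij.1) (e ij.2))%N%:R == 0]
    else [set 0].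
pose g (Y : 'M['Z_q]_n) := [ffun ij : 'I_n * 'I_n => if (ij.1 <= ij.2)%N then Y
  ij.1 ij.2 else 0].
have memE Y : Y \in symker (pow_diag e) ->
    Y^T = Y /\ forall i j, Y i j * (p ^ e j)%N%:R = 0.
  rewrite inE => /andP[/eqP hT /eqP h0]; split=> // i j.
  move/matrixP: h0 => /(_ i j); rewrite /pow_diag map_diag_mx mul_mx_diag !mxE.
  by rewrite rmorph_nat.
have ginj : {in symker (pow_diag e) &, injective g}.
  move=> Y Y' /memE[sY _] /memE[sY' _] /ffunP h; apply/matrixP=> i j.
  have [ij|/ltnW ji] := leqP i j; first by have := h (i, j); rewrite !ffunE /=
    ij.
  by have := h (j, i); rewrite !ffunE /= ji -{1}sY -{1}sY' !mxE.
have gim : g @: symker (pow_diag e) = [set f in family F].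
  apply/setP=> f; rewrite inE; apply/imsetP/familyP.
    case=> Y /memE[sY hY] -> [i j]; rewrite /F ffunE /=; case: ifP => ij;
      rewrite inE //.
    rewrite /minn; case: ifP => _; last by rewrite hY.
    by rewrite -sY mxE hY.
  move=> hf; exists (\matrix_(i, j) if (i <= j)%N then f (i, j) else f (j, i)).
    have hf' (i j : 'I_n) : (i <= j)%N ->
      f (i, j) * (p ^ minn (e i) (e j))%N%:R = 0.
      by move=> ij; have := hf (i, j); rewrite /F /= ij inE => /eqP.
    have up a b (z : 'Z_q) : (a <= b)%N -> z * (p ^ a)%N%:R = 0 ->
      z * (p ^ b)%N%:R = 0.
      by move=> /subnKC <-; rewrite expnD natrM mulrA => ->; rewrite mul0r.
    rewrite inE; apply/andP; split; apply/eqP/matrixP=> i j.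
      by rewrite !mxE; case: ltngtP => // /val_inj ->.
    rewrite /pow_diag map_diag_mx mul_mx_diag !mxE rmorph_nat.
    case: leqP => [ij|/ltnW ji].
      by apply: up (hf' _ _ ij); rewrite geq_minr.
    by apply: up (hf' _ _ ji); rewrite geq_minl.
  apply/ffunP=> -[i j]; rewrite ffunE /=; case: leqP => ij; rewrite ?mxE ?ij //.
  by have := hf (i, j); rewrite /F /= leqNgt ij /= inE => /eqP.
rewrite -(card_in_imset ginj) gim cardsE card_family foldrE big_map big_enum /=.
rewrite [RHS]big_mkcond /=; apply: eq_bigr => -[i j] _; rewrite /F /=.
case: ifP => ij; last by rewrite cards1.
by rewrite card_torsion // geq_min eN.
Qed.

(** A congruence transforms the conditions for U D W into those for D. *)
Lemma card_symker_smith U W e : U \in unitmx -> W \in unitmx ->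
  #|symker (U *m pow_diag e *m W)| = #|symker (pow_diag e)|.
Proof.
move=> Uu Wu.
have mapM (A B : 'M[int]_n) : map_mx intr (A *m B) = map_mx intr A *m map_mx
  intr B :> 'M['Z_q]_n.
  exact: map_mxM.
have [V [UV VU]] : exists V, map_mx intr U *m V = 1%:M :> 'M['Z_q]_n /\
  V *m map_mx intr U = 1%:M.
  by exists (map_mx intr (invmx U)); rewrite -!mapM mulmxV // mulVmx // map_mx1.
have [Z WZ] : exists Z, map_mx intr W *m Z = 1%:M :> 'M['Z_q]_n.
  by exists (map_mx intr (invmx W)); rewrite -!mapM mulmxV // map_mx1.
pose f (Y : 'M['Z_q]_n) := (map_mx intr U)^T *m Y *m map_mx intr U.
pose f' (Y : 'M['Z_q]_n) := V^T *m Y *m V.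
have ff' : cancel f f'.
  move=> Y; rewrite /f' /f !mulmxA -trmx_mul UV trmx1 mul1mx -mulmxA UV mulmx1
    //.
have f'f : cancel f' f.
  move=> Y; rewrite /f' /f !mulmxA -trmx_mul VU trmx1 mul1mx -mulmxA VU mulmx1
    //.
have bf : bijective f by exists f'.
rewrite -[RHS](on_card_preimset (f := f)); last by apply: onW_bij.
apply: eq_card => Y; rewrite inE 2![RHS]inE (mapM (U *m _) W) (mapM U);
  congr (_ && _).
  apply/eqP/eqP => [h|]; first by rewrite /f !trmx_mul trmxK h mulmxA.
  rewrite {1}/f !trmx_mul trmxK mulmxA => h.
  by have := congr1 f' h; rewrite ff' /f' !mulmxA -trmx_mul UV trmx1 mul1mx
    -mulmxA UV mulmx1.
apply/eqP/eqP => [|h].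
  move/(congr1 (mulmx^~ Z)); rewrite /= !mulmxA -(mulmxA _ (map_mx intr W)) WZ
    mulmx1 mul0mx => h.
  by rewrite /f -!mulmxA (mulmxA Y) h mulmx0.
have : V^T *m (f Y *m map_mx intr (pow_diag e)) = 0 by rewrite h mulmx0.
rewrite /f !mulmxA -trmx_mul UV trmx1 mul1mx => h2.
by rewrite h2 mul0mx.
Qed.
End Count.

End SymKer.

Section SymKerLayer.
Variables (p n : nat).
Hypothesis pp : prime p.
Implicit Types (K J : {set 'I_n}) (X : 'M['F_p]_n) (D : 'M[int]_n).

(** If D layer_mx K X = U diag(p^(e_i)) W, then layer_mx K X has the same
    row lattice as diag(p^min(e_i, 1)) W, so that D has the exponents max(e_i
    - 1, 0). The numbers of symmetric matrices therefore differ by the factor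
    p for each pair i <= j with e_i and e_j positive, and the number of
    positive exponents is the corank modulo p, that is the number of
    non-pivots. *)
Lemma card_symker_layer N delta K X D : (delta < N)%N -> echelon_tail K X ->
  divides_pow p delta D -> cols_free K (redp p D) ->
  #|symker p N (D *m layer_mx K X)| = (p ^ 'C(#|~: K|.+1, 2) * #|symker p N
    D|)%N.
Proof.
move=> dN hX hD hK; have N0 : (0 < N)%N by apply: leq_ltn_trans dN.
have [U [W [e [Uu Wu eD eq]]]] := smith_pow pp (layer_divides hX hD).
pose e1 i := (e i - 1)%N; pose m1 i := minn (e i) 1.
have eE : pow_diag p e = pow_diag p e1 *m pow_diag p m1.
  rewrite pow_diagM; congr (diag_mx _); apply/rowP=> i; rewrite !mxE;
    congr ((p ^ _)%N%:R).
  rewrite /e1 /m1; lia.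
pose G := pow_diag p m1 *m W.
have [Gc hGc] : exists Gc, Gc *m G = p%:R%:M.
  exists (invmx W *m pow_diag p (fun i => 1 - m1 i)%N).
  rewrite /G -mulmxA (mulmxA (pow_diag _ _)) pow_diagM.
  have -> : pow_diag p (fun i => 1 - m1 i + m1 i)%N = p%:R%:M.
    apply/matrixP=> i j; rewrite !mxE; congr (_ *+ _); congr _%:R.
    by rewrite (_ : (_ + _)%N = 1%N) ?expn1 // /m1; lia.
  by rewrite mul_scalar_mx -scalemxAr mulVmx // scalemx1.
have /submxP[Z hZ] : (echelon K X <= redp p (D *m layer_mx K X))%MS by rewrite
  (layer_row pp hX hK).
have [Y hY] : exists Y, layer_mx K X - lift Z *m (D *m layer_mx K X) = p%:R *:
  Y.
  by apply: (redp_eq0 pp); rewrite /redp map_mxB -/(redp _ _) -/(redp _ _)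
    (redpM p (lift Z)) (redp_layer_mx pp) redp_lift hZ subrr.
(* Transition matrices A and B between the two bases of the lattice. *)
pose A := lift Z *m U *m pow_diag p e1 + Y *m Gc.
have EA : layer_mx K X = A *m G.
  rewrite /A (mulmxDl (lift Z *m _ *m _)) -(mulmxA Y) hGc mul_mx_scalar -hY.
  by rewrite /G !mulmxA -(mulmxA _ (pow_diag p e1)) -eE -!(mulmxA (lift Z)) -eq
    addrC subrK.
pose al := diag_mx (\row_i (e i == 0)%N%:R) : 'M[int]_n.
pose be := diag_mx (\row_i (0 < e i)%N%:R) : 'M[int]_n.
pose B := al *m invmx U *m D + be *m W *m layer_cmx K X.
have GB : G = B *m layer_mx K X.
  rewrite /B (mulmxDl (al *m _ *m _)) -(mulmxA (be *m W)) mul_layer_cmx //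
    -(mulmxA _ D) eq.
  rewrite -!(mulmxA al) -(mulmxA U) mulKmx // mul_mx_scalar /G !mulmxA.
  rewrite scalemxAl -mulmxDl; congr (_ *m _); apply/matrixP=> i j.
  rewrite /al mul_diag_mx !mxE /m1; case: (i =P j) => [->|_]; last by rewrite
    !mulr0n !mulr0 add0r.
  by rewrite !mulr1n; case: (e j) => [|k]; rewrite ?mulr0 ?addr0 ?mul1r // mul0r
    add0r mulr1.
have AB : A *m B = 1%:M.
  by apply: (layer_mx_cancel pp hX); rewrite mul1mx -mulmxA -GB -EA.
have [_ Bu] := mulmx1_unit AB.
have eD' : D = U *m pow_diag p e1 *m B.
  apply: (layer_mx_cancel pp hX); rewrite eq -(mulmxA _ B) -GB /G eE !mulmxA.
  by [].
have eN i : (e i <= N)%N by apply: leq_trans (eD i) dN.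
have e1N i : (e1 i <= N)%N by apply: leq_trans (leq_subr _ _) (eN i).
pose c (M : 'M[int]_n) := #|symker p N M|.
have c1 : c (D *m layer_mx K X) = _ :=
  etrans (congr1 c eq) (etrans (card_symker_smith p N e Uu Wu) (card_symker_diag
    pp N0 eN)).
have c2 : c D = _ :=
  etrans (congr1 c eD') (etrans (card_symker_smith p N e1 Uu Bu)
    (card_symker_diag pp N0 e1N)).
suff : c (D *m layer_mx K X) = (p ^ 'C(#|~: K|.+1, 2) * c D)%N by [].
rewrite c1 c2 {c1 c2 c}.
have -> : #|~: K| = #|[set i | (0 < e i)%N]|.
  apply: (@addnI #|K|); rewrite cardsC.
  rewrite -(echelon_rank hX) -(layer_row pp hX hK) eq !redpM.
  rewrite mxrankMfree ?row_free_unit ?redp_unit // eqmxMfull ?row_full_unit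
    ?redp_unit //.
  have -> : redp p (pow_diag p e) = proj _ (~: [set i | (0 < e i)%N]).
    apply/matrixP=> i j; rewrite projE !mxE !inE; case: eqP => [->|_] //=.
    rewrite mulr1n rmorph_nat; case: (e j) => [|k]; first by rewrite expn0.
    by rewrite expnS natrM pFp0 // mul0r.
  by rewrite rank_proj addnC cardsC.
rewrite -card_pairs_le -sum1_card expn_sum.
rewrite big_mkcond [X in (X * _)%N]big_mkcond [X in (_ * X)%N]big_mkcond
  -big_split /=.
apply: eq_bigr => -[i j] _ /=; rewrite inE /= !inE.
case: ifP => //= ij; rewrite /e1.
case: (e i) => [|a]; case: (e j) => [|b] //=; rewrite ?subn0 ?subSS ?min0n
  ?minn0 ?expn0 //.
by rewrite minnSS !subn0 expnS expn1.
Qed.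
End SymKerLayer.

(** * Counting echelon forms with given independent columns *)

Section CountTails.
Variables (F : finFieldType) (n : nat).
Implicit Types (K J : {set 'I_n}) (X M : 'M[F]_n).

Lemma card_subspace m (A : 'M[F]_(m, n)) :
  #|[set v : 'rV[F]_n | (v <= A)%MS]| = (#|F| ^ \rank A)%N.
Proof. by rewrite -card_rowg; apply: eq_card => v; rewrite !inE. Qed.

Lemma tr_proj J : (proj F J)^T = proj F J.
Proof. by rewrite /proj tr_diag_mx. Qed.

Lemma cols_free_tr J M : cols_free J M = (\rank (proj F J *m M^T) == #|J|).
Proof. by rewrite /cols_free -mxrank_tr trmx_mul tr_proj. Qed.

Lemma row_projM m J (M : 'M[F]_(n, m)) i :
  row i (proj F J *m M) = (i \in J)%:R *: row i M.
Proof. by apply/rowP=> j; rewrite mxE mul_diag_mx !mxE. Qed.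

(** A further column keeps the family independent exactly when it is not
    in the span of the previous ones. *)
Lemma cols_freeU1 J M c : c \notin J ->
  cols_free (c |: J) M = cols_free J M && ~~ (row c M^T <= proj F J *m M^T)%MS.
Proof.
move=> cJ; rewrite !cols_free_tr cardsU1 cJ add1n.
set A := proj F J *m M^T; set r := row c M^T.
have -> : \rank (proj F (c |: J) *m M^T) = \rank (A + r)%MS.
  have sub i : i \in c |: J -> (row i M^T <= proj F (c |: J) *m M^T)%MS.
    by move=> iJ; rewrite (eq_row_sub i) // row_projM iJ scale1r.
  apply/eqmx_rank; apply/andP; split.
    apply/row_subP=> i; rewrite row_projM.
    case iJ: (i \in c |: J); rewrite ?scale0r ?sub0mx // scale1r.
    have /setU1P[->|{}iJ] := iJ; first exact: addsmxSr.
    apply: submx_trans (addsmxSl _ _).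
    by rewrite (eq_row_sub i) // row_projM iJ scale1r.
  rewrite addsmx_sub sub ?setU11 // andbT; apply/row_subP=> i;
    rewrite row_projM.
  by case iJ: (i \in J); rewrite ?scale0r ?sub0mx // scale1r sub // !inE iJ
    orbT.
have Ar := mxrank_leqif_sup (addsmxSl A r).
have up : (\rank (A + r)%MS <= \rank A + 1)%N.
  by apply: leq_trans (mxrank_adds_leqif A r) _; rewrite leq_add2l rank_leq_row.
have AJ : (\rank A <= #|J|)%N by rewrite -(rank_proj F) mxrankM_maxl.
have e : (A + r <= A)%MS = (r <= A)%MS by rewrite addsmx_sub submx_refl.
case: Ar => le1; rewrite e; case: (r <= A)%MS => /eqP h.
  by rewrite andbF -h; apply/negbTE; lia.
by rewrite andbT; lia.
Qed.

Definition below K (m : nat) : {set 'I_n} := [set k in K | (k < m)%N].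

(** The tails supported in the first m columns, subject to the condition
    on these columns only. Columns are added from left to right: the entries
    of a column lie in rows to its left, so the condition on the earlier
    columns does not see it. *)
Definition tails K J (m : nat) : {set 'M[F]_n} :=
  [set X | [&& echelon_tail K X, [forall i, forall j : 'I_n, (m <= j)%N ==>
    (X i j == 0)]
             & cols_free (below J m) (echelon K X)]].

Lemma belowS K (c : 'I_n) : below K c.+1 = if c \in K then c |: below K c else
  below K c.
Proof.
apply/setP=> i; case: ifP => cK; rewrite !inE ltnS leq_eqVlt andb_orr.
  by rewrite -val_eqE; congr (_ || _); case: eqP => [/val_inj ->|];
    rewrite ?cK ?andbF.
by case: eqP => [/val_inj ->|]; rewrite ?cK ?andbF //.
Qed.

Lemma tailsP K J m X : reflect [/\ echelon_tail K X, forall i (j : 'I_n),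
  (m <= j)%N -> X i j = 0
   & cols_free (below J m) (echelon K X)] (X \in tails K J m).
Proof.
rewrite inE; apply: (iffP and3P) => -[h1 h2 h3]; split=> //.
  by move=> i j mj; apply/eqP; exact: (implyP (forallP (forallP h2 i) j)).
by apply/forallP=> i; apply/forallP=> j; apply/implyP=> mj; rewrite h2.
Qed.

Lemma proj_tr_eq K J (X Y : 'M[F]_n) (c : 'I_n) :
  (forall i j, j \in J -> X i j = Y i j) ->
  proj F J *m (echelon K X)^T = proj F J *m (echelon K Y)^T.
Proof.
move=> h; apply/row_matrixP=> i; rewrite !row_projM; case iJ: (i \in J);
  rewrite ?scale0r // !scale1r.
by apply/rowP=> j; rewrite /echelon !mxE h.
Qed.

(** A pivot column is a coordinate vector, and the columns to its left
    vanish on that coordinate. *)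
Lemma cols_free_pivot K J X (c : 'I_n) : echelon_tail K X -> c \in K ->
  cols_free (c |: below J c) (echelon K X) = cols_free (below J c)
    (echelon K X).
Proof.
move=> hX cK; rewrite cols_freeU1 ?inE ?ltnn ?andbF //.
have -> : (row c (echelon K X)^T <= proj F (below J c) *m (echelon K X)^T)%MS =
  false; last by rewrite andbT.
apply/negbTE/negP => /submxP[a /rowP/(_ c)]; rewrite 2![LHS]mxE [RHS]mxE
  (echelon_diagE _ hX) cK.
rewrite big1 => [/eqP|i _]; first by rewrite oner_eq0.
rewrite mul_projE mxE inE; case: ltnP => ic; last by rewrite andbF mul0r mulr0.
by rewrite (echelon_ltE hX) // !mulr0.
Qed.

Lemma card_tailsS_pivot K J (c : 'I_n) : c \in K -> #|tails K J c.+1| =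
  #|tails K J c|.
Proof.
move=> cK; apply: eq_card => X; apply/tailsP/tailsP => -[hX h0 hJ]; split=> //.
- move=> i j; rewrite leq_eqVlt => /orP[/eqP/val_inj <-|]; last exact: h0.
  by move/echelon_tailP: hX => ->; rewrite // cK andbF.
- by move: hJ; rewrite belowS; case: ifP => // _; rewrite cols_free_pivot.
- by move=> i j /ltnW; exact: h0.
- by rewrite belowS; case: ifP => // _; rewrite cols_free_pivot.
Qed.

(** The new column is an arbitrary vector supported on the pivots to its
    left. When it belongs to J it must avoid the span of the earlier columns
    in J, which is a subspace of the same coordinate space, of dimension the
    number of these columns. *)
Lemma card_tailsS K J (c : 'I_n) : c \notin K ->
  (#|tails K J c.+1|%:R : int) = #|tails K J c|%:R *
    ((#|F| ^ #|below K c|)%N%:R - (c \in J)%:R * (#|F| ^ #|below J c|)%N%:R).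
Proof.
move=> cK.
pose ok (X : 'M[F]_n) (x : 'rV[F]_n) := (x <= proj F (below K c))%MS &&
  ((c \in J) ==> ~~ (x <= proj F (below J c) *m (echelon K X)^T)%MS).
pose glue (Xx : 'M[F]_n * 'rV[F]_n) : 'M[F]_n := Xx.1 + Xx.2^T *m delta_mx 0 c.
pose S := [set Xx : 'M[F]_n * 'rV[F]_n | (Xx.1 \in tails K J c) &&
  ok Xx.1 Xx.2].
have glueE X x i j : glue (X, x) i j = X i j + (j == c)%:R * x 0 i.
  rewrite /glue /= !mxE big_ord1 !mxE eqxx /= mulrC eq_sym.
  by [].
have xP (x : 'rV[F]_n) : reflect (forall i, i \notin below K c -> x 0 i = 0)
  (x <= proj F (below K c))%MS.
  apply: (iffP idP) => [/submxP[a ->] i ib|h].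
    by rewrite mulr_projE (negPf ib) mulr0.
  apply/submxP; exists x; apply/rowP=> i; rewrite mulr_projE.
  by case ib: (i \in _); rewrite ?mulr1 // mulr0 h // ib.
have imS : glue @: S = tails K J c.+1.
  apply/setP=> Y; apply/imsetP/idP.
    case=> -[X x]; rewrite inE /= =>
      /andP[/tailsP[hX h0 hJ] /andP[/xP hx hc]] ->.
    have hY : echelon_tail K (glue (X, x)).
      apply/echelon_tailP=> i j nij; rewrite glueE; move/echelon_tailP: hX =>
        hX.
      rewrite hX // add0r; case: eqP => [ejc|_]; last by rewrite mul0r.
      rewrite mul1r hx //; apply: contra nij; rewrite inE ejc => /andP[-> ->].
      by rewrite cK.
    have eqJ : proj F (below J c) *m (echelon K (glue (X, x)))^T =
      proj F (below J c) *m (echelon K X)^T.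
      apply: proj_tr_eq => // i j; rewrite glueE inE => /andP[_ jc].
      by rewrite -val_eqE (ltn_eqF jc) mul0r addr0.
    apply/tailsP; split=> //.
      move=> i j cj; rewrite glueE h0 ?(ltnW cj) // -val_eqE (gtn_eqF cj) mul0r
        addr0 //.
    rewrite belowS; case: ifP => cJ; last by rewrite cols_free_tr eqJ
      -cols_free_tr.
    rewrite cols_freeU1 ?inE ?ltnn ?andbF // cols_free_tr eqJ -cols_free_tr hJ
      /=.
    suff -> : row c (echelon K (glue (X, x)))^T = x by rewrite cJ in hc.
    apply/rowP=> i; rewrite mxE mxE /echelon mxE glueE projE (h0 _ _ (leqnn c))
      eqxx mul1r add0r.
    by case: eqP => [->|]; rewrite ?(negPf cK) ?add0r.
  move/tailsP=> [hY h0 hJ].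
  pose x : 'rV[F]_n := \row_i Y i c; pose X := Y - x^T *m delta_mx 0 c.
  have XE i j : X i j = Y i j - (j == c)%:R * Y i c.
    by rewrite /X !mxE big_ord1 !mxE eqxx /= mulrC eq_sym.
  have YE : Y = glue (X, x) by rewrite /glue /= /X subrK.
  have xc i : x 0 i = Y i c by rewrite mxE.
  exists (X, x) => //; rewrite inE /=.
  have hX : echelon_tail K X.
    apply/echelon_tailP=> i j nij; rewrite XE; move/echelon_tailP: hY => hY.
    rewrite hY //; case: (j =P c) => [ejc|_]; rewrite ?mul0r ?subr0 // -ejc hY
      // mulr0 subr0 //.
  have eqJ : proj F (below J c) *m (echelon K Y)^T = proj F (below J c) *m
    (echelon K X)^T.
    apply: proj_tr_eq => // i j; rewrite XE inE => /andP[_ jc].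
    by rewrite -val_eqE (ltn_eqF jc) mul0r subr0.
  have rowc : row c (echelon K Y)^T = x.
    apply/rowP=> i; rewrite mxE mxE /echelon mxE projE xc.
    by case: eqP => [->|]; rewrite ?(negPf cK) ?add0r.
  have hJ' : cols_free (below J c) (echelon K X).
    rewrite cols_free_tr -eqJ -cols_free_tr; move: hJ; rewrite belowS;
      case: ifP => // _.
    by rewrite cols_freeU1 ?inE ?ltnn ?andbF // => /andP[].
  apply/andP; split; last first.
    apply/andP; split.
      apply/xP=> i ib; rewrite xc; move/echelon_tailP: hY => -> //.
      by apply: contra ib => /and3P[iK _ ic]; rewrite inE iK.
    apply/implyP=> cJ; move: hJ; rewrite belowS cJ cols_freeU1 ?inE ?ltnn ?andbF
      //.
    by rewrite rowc eqJ => /andP[].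
  apply/tailsP; split=> // i j cj; rewrite XE.
  move: cj; rewrite leq_eqVlt => /orP[/eqP/val_inj ->|cj]; first by rewrite eqxx
    mul1r subrr.
  by rewrite h0 // -val_eqE (gtn_eqF cj) mul0r subrr.
have glue_inj : {in S &, injective glue}.
  move=> [X x] [X' x'] hS hS'; have := hS; rewrite inE /= =>
    /andP[/tailsP[_ h0 _] _].
  have := hS'; rewrite inE /= => /andP[/tailsP[_ h0' _] _].
  move/matrixP => h.
  have ex : x = x'.
    apply/rowP=> i; have := h i c; rewrite !glueE eqxx !mul1r (h0 _ _ (leqnn c))
      (h0' _ _ (leqnn c)).
    by rewrite !add0r.
  congr (_, _) => //; apply/matrixP=> i j; have := h i j; rewrite !glueE ex;
    exact: addIr.
have card_ok X : X \in tails K J c -> (#|[set x | ok X x]|%:R : int) =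
   (#|F| ^ #|below K c|)%N%:R - (c \in J)%:R * (#|F| ^ #|below J c|)%N%:R.
  case/tailsP=> hX h0 hJ; set U := proj F (below J c) *m (echelon K X)^T.
  have UK : (U <= proj F (below K c))%MS.
    apply/row_subP=> i; rewrite row_projM inE; case: ltnP => ic; last by rewrite
      andbF scale0r sub0mx.
    apply: scalemx_sub; apply/xP=> k kb; rewrite !mxE.
    move/echelon_tailP: hX => hX; rewrite hX; last first.
      by apply: contra kb => /and3P[kK _ ki]; rewrite inE kK (ltn_trans ki).
    rewrite addr0; case: eqP => // eki; move: kb; rewrite inE eki ic andbT =>
      /negbTE ->.
    by [].
  have rU : \rank U = #|below J c| by apply/eqP; rewrite -cols_free_tr.
  rewrite -(rank_proj F (below K c)) -card_subspace -rU -card_subspace.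
  case cJ: (c \in J); last first.
    by rewrite mul0r subr0; congr _%:R; apply: eq_card => x; rewrite !inE /ok cJ
      andbT.
  rewrite mul1r -natrB; last by apply: subset_leq_card; apply/subsetP=> x;
    rewrite !inE => /submx_trans; apply.
  congr _%:R; rewrite -cardsDS; last by apply/subsetP=> x; rewrite !inE =>
    /submx_trans; apply.
  by apply: eq_card => x; rewrite !inE /ok cJ /= andbC.
rewrite -imS (card_in_imset glue_inj).
have -> : (#|S|%:R : int) = \sum_(X in tails K J c) #|[set x | ok X x]|%:R.
  under eq_bigr do rewrite -sum1_card natr_sum.
  rewrite pair_big_dep -sum1_card natr_sum /=; apply: eq_bigl => -[X x].
  by rewrite inE /= [x \in _]inE.
by rewrite (eq_bigr _ card_ok) sumr_const [RHS]mulr_natl.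
Qed.

Lemma card_tails K J :
  (#|[set X : 'M[F]_n | echelon_tail K X && cols_free J (echelon K X)]|%:R :
    int) =
  \prod_(c | c \notin K) ((#|F| ^ #|below K c|)%N%:R - (c \in J)%:R *
    (#|F| ^ #|below J c|)%N%:R).
Proof.
have below_full L : below L n = L by apply/setP=> i; rewrite inE ltn_ord andbT.
have -> : [set X : 'M[F]_n | echelon_tail K X && cols_free J (echelon K X)] =
  tails K J n.
  apply/setP=> X; rewrite inE; apply/andP/tailsP => [[h1 h2]|[h1 _ h2]].
    by split=> //; [move=> i j; rewrite leqNgt ltn_ord | rewrite below_full].
  by rewrite below_full in h2.
pose f (c : 'I_n) : int := (#|F| ^ #|below K c|)%N%:R - (c \in J)%:R *
  (#|F| ^ #|below J c|)%N%:R.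
rewrite -/f.
suff H m : (m <= n)%N -> (#|tails K J m|%:R : int) = \prod_(c | (c \notin K) &&
  (c < m)%N) f c.
  by rewrite H //; apply: eq_bigl => c; rewrite ltn_ord andbT.
elim: m => [|m IH] mn.
  rewrite big_pred0 => [|c]; last by rewrite andbF.
  rewrite (_ : tails K J 0 = [set 0]) ?cards1 //; apply/setP=> X; rewrite !inE.
  apply/and3P/eqP => [[_ h _]|->].
    by apply/matrixP=> i j; rewrite [RHS]mxE; apply/eqP;
      exact: (implyP (forallP (forallP h i) j)).
  split.
  - by apply/echelon_tailP=> i j _; rewrite mxE.
  - by apply/forallP=> i; apply/forallP=> j; rewrite mxE eqxx implybT.
  - rewrite (_ : below J 0 = set0) ?cols_free0 //; apply/setP=> i;
    rewrite !inE ltn0 andbF //.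
pose c := Ordinal mn.
have -> : m = c :> nat by [].
have {}IH := IH (ltnW mn).
case cK: (c \in K).
  rewrite card_tailsS_pivot // -/c IH; apply: eq_bigl => i; rewrite /=
    ltnS [in RHS]leq_eqVlt.
  by case: (i =P m :> nat) => [im|] //=; rewrite (_ : i = c) ?cK //;
    apply/val_inj.
rewrite card_tailsS ?cK // IH [RHS](bigD1 c) /= ?cK ?leqnn // mulrC;
  congr (_ * _).
apply: eq_bigl => i; rewrite ltnS -andbA; congr (_ && _).
by rewrite [RHS]andbC ltn_neqAle.
Qed.

End CountTails.

(** * The transfer recursion *)

Section Transfer.
Variables (p n : nat).
Hypothesis pp : prime p.
Implicit Types (K J : {set 'I_n}) (X : 'M['F_p]_n) (D : 'M[int]_n).

(** Triangular with powers of p on the diagonal; the diagonal exponents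
    are the d_j of the spherical map. *)
Definition upper_pow D :=
  (forall i j : 'I_n, (j < i)%N -> D i j = 0) /\ exists e : 'I_n -> nat,
    forall i, D i i = p%:R ^+ e i.

Lemma layer_mx_ltE K X (i j : 'I_n) : echelon_tail K X -> (j < i)%N ->
  layer_mx K X i j = 0.
Proof.
move=> /echelon_tailP hX ji; rewrite !mxE hX ?addr0 /=; last by rewrite ltnNge
  (ltnW ji) !andbF.
by case: eqP => // eij; rewrite eij ltnn in ji.
Qed.

Lemma layer_mx_diagE K X (i : 'I_n) : echelon_tail K X ->
  layer_mx K X i i = p%:R ^+ (i \notin K).
Proof.
move=> /echelon_tailP hX; rewrite !mxE eqxx hX ?addr0 /= ?ltnn ?andbF // mulr1n.
by case: (i \in K).
Qed.

Lemma mul_upper_diag (D D' : 'M[int]_n) i :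
  (forall i j : 'I_n, (j < i)%N -> D i j = 0) -> (forall i j : 'I_n,
    (j < i)%N -> D' i j = 0) ->
  (D *m D') i i = D i i * D' i i.
Proof.
move=> h h'; rewrite mxE (bigD1 i) //= big1 ?addr0 // => k; rewrite -val_eqE
  neq_ltn => /orP[ki|ik].
  by rewrite h // mul0r.
by rewrite h' // mulr0.
Qed.

Lemma mul_upper (D D' : 'M[int]_n) :
  (forall i j : 'I_n, (j < i)%N -> D i j = 0) -> (forall i j : 'I_n,
    (j < i)%N -> D' i j = 0) ->
  forall i j : 'I_n, (j < i)%N -> (D *m D') i j = 0.
Proof.
move=> h h' i j ji; rewrite mxE big1 // => k _; have [ki|ik] := ltnP k i;
  first by rewrite h // mul0r.
by rewrite h' ?mulr0 // (leq_trans ji).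
Qed.

Lemma upper_powM D K X : echelon_tail K X -> upper_pow D ->
  upper_pow (D *m layer_mx K X).
Proof.
move=> hX [h [e he]]; have hE i j := @layer_mx_ltE K X i j hX; split;
  first exact: mul_upper.
by exists (fun i => e i + (i \notin K))%N => i; rewrite mul_upper_diag // he
  layer_mx_diagE // exprD.
Qed.

Lemma lattice_reps_upper delta J D : D \in lattice_reps p delta J ->
  upper_pow D.
Proof.
move: delta J D; apply: lattice_reps_ind => [J|delta J K X D hX _ _];
  last exact: upper_powM.
split=> [i j ji|]; last by exists (fun=> 0%N) => i; rewrite mxE eqxx expr0.
by rewrite mxE -val_eqE (gtn_eqF ji).
Qed.

Definition dexp D (i : 'I_n) : nat := logn p `|D i i|.

Lemma dexpE D i e : D i i = p%:R ^+ e -> dexp D i = e.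
Proof. by rewrite /dexp => ->; rewrite abszX natz /= pfactorK. Qed.

Lemma dexpM D K X i : echelon_tail K X -> upper_pow D ->
  dexp (D *m layer_mx K X) i = (dexp D i + (i \notin K))%N.
Proof.
move=> hX [h [e he]]; have hE k j := @layer_mx_ltE K X k j hX;
  rewrite (dexpE (he i)).
by apply: dexpE; rewrite mul_upper_diag // he layer_mx_diagE // exprD.
Qed.

Section Weighted.
Variables (R : comNzRingType) (y : 'I_n -> R) (N : nat).

(** The sum of b(D) prod_i y_i^(d_i) over the representatives D whose
    columns in J are independent modulo p, where b(D) counts symmetric
    matrices with denominator p^N. *)
Definition layer_sum delta J : R :=
  \sum_(D <- lattice_reps p delta J) #|symker p N D|%:R * \prod_i y i ^+ dexp D
    i.

Lemma layer_sum0 J : (0 < N)%N -> layer_sum 0 J = 1.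
Proof.
move=> N0; rewrite /layer_sum big_seq1 big1 => [|i _]; last first.
  by rewrite (@dexpE _ _ 0) ?expr0 // mxE eqxx.
rewrite mulr1 (_ : symker p N 1%:M = [set 0]) ?cards1 //; apply/setP=> Y;
  rewrite !inE map_mx1 mulmx1.
by case: (Y =P 0) => [->|]; rewrite ?andbF // trmx0 eqxx.
Qed.

Let regroup (a b c : nat) (P Q : R) : a = (c * b)%N -> a%:R * (P * Q) =
  c%:R * P * (b%:R * Q).
Proof. by move=> ->; rewrite natrM; ring. Qed.

(** A representative is a layer times a representative with one layer
    less. Its weight is multiplicative and the number of symmetric matrices is
    multiplied by a power of p that depends on K only, so the sum over the
    tails X contributes their number. *)
Lemma layer_sumS delta J : (delta < N)%N ->
  layer_sum delta.+1 J = \sum_(K : {set 'I_n})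
    (p ^ 'C(#|~: K|.+1, 2))%N%:R *
    (\prod_(c | c \notin K) ((p ^ #|below K c|)%N%:R - (c \in J)%:R *
      (p ^ #|below J c|)%N%:R))%:~R *
    (\prod_(c | c \notin K) y c) * layer_sum delta K.
Proof.
move=> dN; rewrite /layer_sum /= big_allpairs_dep /=.
have cF : #|'F_p| = p by rewrite card_Fp.
pose w K := (p ^ 'C(#|~: K|.+1, 2))%N%:R * (\prod_(c | c \notin K) y c) *
  layer_sum delta K.
have step K X : echelon_tail K X -> \sum_(D <- lattice_reps p delta K)
    (#|symker p N (D *m layer_mx K X)|%:R * \prod_i y i ^+ dexp (D *m layer_mx K
      X) i) = w K.
  move=> hX; rewrite /w /layer_sum mulr_sumr; apply: eq_big_seq => D hD.
  have -> : \prod_i y i ^+ dexp (D *m layer_mx K X) i =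
      (\prod_(c | c \notin K) y c) * \prod_i y i ^+ dexp D i.
    rewrite [X in X * _]big_mkcond -big_split /=; apply: eq_bigr => i _.
    rewrite (dexpM _ hX (lattice_reps_upper hD)) exprD mulrC; congr (_ * _);
      by case: (i \notin K).
  apply: regroup; exact: card_symker_layer (lattice_reps_divides hD)
    (lattice_reps_cols_free pp hD).
rewrite big_filter big_enum_cond /=.
rewrite (eq_bigr (fun KX => w KX.1)) => [|[K X] /= /andP[hX _]]; last exact:
  step.
rewrite -(pair_big_dep xpredT (fun K X => echelon_tail K X && cols_free J
  (echelon K X)) (fun K X => w K)) /=.
apply: eq_bigr => K _; rewrite sumr_const -[LHS]mulr_natl; set a := #|_|.
set P := \prod_(c | _) (_ - _).
have -> : P = a%:R by rewrite /P; have := card_tails 'F_p K J;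
  rewrite cF cardsE => <-.
by rewrite rmorph_nat /w -/(layer_sum delta K); ring.
Qed.
End Weighted.

(** Among the c elements below c, those outside of K contribute to the
    binomial coefficient when c runs over the complement of K. This is the
    identity that makes the powers of p of the normalisation x_j p^-j cancel
    those of the counts. *)
Lemma sum_gaps K : (\sum_(c | c \notin K) c.+1 = 'C(#|~: K|.+1, 2) +
  \sum_(c | c \notin K) #|below K c|)%N.
Proof.
rewrite -card_pairs_le.
have -> : #|[set ij : 'I_n * 'I_n | [&& (ij.1 <= ij.2)%N, ij.1 \in ~: K &
  ij.2 \in ~: K]]| =
   (\sum_(c | c \notin K) #|[set l in ~: K | (l <= c)%N]|)%N.
  rewrite -sum1dep_card.
  rewrite -(pair_big_dep xpredT (fun i j : 'I_n => [&& (i <= j)%N, i \in ~: K &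
    j \in ~: K]) (fun _ _ => 1%N)) /=.
  rewrite (exchange_big_dep (fun j => j \notin K)) /= => [|i j _ /and3P[_ _]];
    last by rewrite inE.
  apply: eq_bigr => c cK; rewrite -sum1dep_card; apply: eq_bigl => i.
  by rewrite !inE cK andbT andbC.
rewrite -big_split /=; apply: eq_bigr => c cK.
have -> : below K c = [set l in K | (l <= c)%N].
  apply/setP=> l; rewrite !inE [in RHS]leq_eqVlt; case: (l =P c :> nat) =>
    [/val_inj ->|] //.
  by rewrite (negPf cK).
transitivity #|[set l : 'I_n | (l <= c)%N]|.
  rewrite -sum1_card (eq_bigl (fun l : 'I_n => (l < c.+1)%N)) => [|l];
    last by rewrite inE ltnS.
  by rewrite (big_ord_narrow (ltn_ord c)) sum1_card card_ord.
rewrite -(cardsID K [set l : 'I_n | (l <= c)%N]) addnC; congr (_ + _)%N;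
  apply: eq_card => l; rewrite !inE //.
by rewrite andbC.
Qed.

End Transfer.

(** * Representatives of left cosets and their spherical monomials *)

Definition toQ m n (M : 'M[int]_(m, n)) : 'M[rat]_(m, n) := map_mx intr M.

Lemma toQ_inj m n : injective (@toQ m n).
Proof.
by move=> M M' /matrixP h; apply/matrixP=> i j; have := h i j; rewrite !mxE =>
  /intr_inj.
Qed.

Lemma toQM m n k (M : 'M[int]_(m, n)) (M' : 'M[int]_(n, k)) : toQ (M *m M') =
  toQ M *m toQ M'.
Proof. exact: map_mxM. Qed.

Lemma toQ_block m1 m2 n1 n2 (P : 'M[int]_(m1, n1)) Q R (S : 'M[int]_(m2, n2)) :
  toQ (block_mx P Q R S) = block_mx (toQ P) (toQ Q) (toQ R) (toQ S).
Proof. exact: map_block_mx. Qed.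

Lemma toQ_scalar n (c : int) : toQ (c%:M : 'M_n) = (c%:~R)%:M.
Proof. exact: map_scalar_mx. Qed.

Lemma toQ_symplectic n : toQ (symplectic_form int n) = symplectic_form rat n.
Proof. by rewrite /symplectic_form toQ_block /toQ map_mxN !map_mx0 map_mx1. Qed.

Lemma left_cosetP n (M N : 'M[rat]_(n + n)) :
  left_coset M N <-> exists2 g, is_sp g & N = toQ g *m M.
Proof.
split=> [[_ [g hg <-] <-]|[g hg ->]].
  by exists g => //; rewrite /is_sp /simil scale1r.
by exists (toQ g) => //; exists g => //; move: hg; rewrite /is_sp /simil
  scale1r.
Qed.

Lemma left_coset_eq n (M N : 'M[rat]_(n + n)) : left_coset M N -> left_coset N =
  left_coset M.
Proof.
move=> /left_cosetP[g gs eN]; apply/seteqP; split=> P /left_cosetP[h hs eP];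
  apply/left_cosetP.
  by exists (h *m g); [exact: is_spM | rewrite eP eN toQM mulmxA].
have [g' gs' [g'g _]] := is_spV gs.
exists (h *m g'); first exact: is_spM.
by rewrite eP eN mulmxA -toQM -mulmxA g'g mulmx1.
Qed.

Lemma left_coset_refl n (M : 'M[rat]_(n + n)) : left_coset M M.
Proof.
by apply/left_cosetP; exists 1%:M; [exact: simil1 | rewrite /toQ map_mx1
  mul1mx].
Qed.

Section Cosets.
Variables (p n : nat).
Hypothesis pp : prime p.
Variables (delta N : nat).
Hypothesis dN : (delta < N)%N.
Implicit Types (D A B : 'M[int]_n).

Let N0 : (0 < N)%N. Proof. by apply: leq_ltn_trans dN. Qed.

Definition lift_sym (Y : 'M['Z_(p ^ N)]_n) : 'M[int]_n :=
  map_mx (fun z : 'Z_(p ^ N) => (z : nat)%:Z) Y.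
Definition redq (M : 'M[int]_n) : 'M['Z_(p ^ N)]_n := map_mx intr M.

Lemma redq_lift Y : redq (lift_sym Y) = Y.
Proof. by apply/matrixP=> i j; rewrite !mxE /= -[RHS]natr_Zp. Qed.

Lemma redqM M M' : redq (M *m M') = redq M *m redq M'.
Proof. exact: map_mxM. Qed.

Lemma redq_scale M : redq ((p ^ N)%N%:R *: M) = 0.
Proof.
rewrite /redq map_mxZ rmorph_nat; have -> : ((p ^ N)%N%:R : 'Z_(p ^ N)) = 0.
  by apply/eqP; rewrite natZq_eq0.
by rewrite scale0r.
Qed.

Lemma redq_eq0 M : redq M = 0 -> exists M', M = (p ^ N)%N%:R *: M'.
Proof.
move=> /matrixP h; exists (map_mx (fun x => (x %/ (p ^ N)%N%:Z)%Z) M).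
apply/matrixP=> i j; rewrite !mxE natz mulrC divzK // -(intZq_eq0 pp N0).
by have := h i j; rewrite !mxE => ->.
Qed.

(** The representative (p^delta D^-T, S D; 0, D) with S = Y / p^N. *)
Definition coset_rep D Y : 'M[rat]_(n + n) :=
  block_mx (p%:R ^+ delta *: (invmx (toQ D))^T) (p%:R ^- N *:
    (toQ (lift_sym Y) *m toQ D)) 0 (toQ D).

Lemma toQ_coset_rep D Y A B : A^T *m D = (p ^ delta)%N%:R%:M ->
  (p ^ N)%N%:R *: B = lift_sym Y *m D -> toQ (block_mx A B 0 D) = coset_rep D Y.
Proof.
move=> hA hB; rewrite toQ_block /coset_rep /toQ map_mx0 -/(toQ _) -/(toQ _)
  -/(toQ _) -/(toQ _).
have pq k : (p%:R ^+ k : rat) != 0 by rewrite expf_neq0 // pnatr_eq0 -lt0n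
  prime_gt0.
congr block_mx; last first.
  rewrite -toQM -hB /toQ map_mxZ rmorph_nat scalerA natrX mulVf ?scale1r //.
have hq : toQ A^T *m toQ D = (p%:R ^+ delta)%:M by rewrite -toQM hA toQ_scalar
  rmorph_nat natrX.
have Du : toQ D \in unitmx.
  have : (p%:R ^- delta *: toQ A^T) *m toQ D = 1%:M.
    by rewrite -scalemxAl hq -scalemx1 scalerA mulVf // scale1r.
  by case/mulmx1_unit.
rewrite -[toQ A]trmxK; have -> : (toQ A)^T = toQ A^T by rewrite /toQ map_trmx.
have -> : toQ A^T = p%:R ^+ delta *: invmx (toQ D).
  by rewrite -[LHS](mulmxK Du) hq mul_scalar_mx.
by apply/matrixP=> i j; rewrite !mxE.
Qed.

(** Integrality of S D is the condition Y D = 0 modulo p^N; the remaining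
    relation for a similitude is the symmetry of S. *)
Lemma coset_rep_int D Y : divides_pow p delta D -> Y \in symker p N D ->
  exists A B, [/\ A^T *m D = (p ^ delta)%N%:R%:M, (p ^ N)%N%:R *: B = lift_sym Y
    *m D &
    simil (p ^ delta)%N%:R (block_mx A B 0 D)].
Proof.
case=> Ds hD; rewrite inE => /andP[/eqP sY /eqP YD].
have [B hB] : exists B, lift_sym Y *m D = (p ^ N)%N%:R *: B.
  by apply: redq_eq0; rewrite redqM redq_lift; exact: YD.
exists Ds^T, B; split; rewrite ?trmxK //.
apply/simil_block; split; rewrite ?mulmx0 ?trmx0 ?mul0mx ?trmxK ?subr0 //.
apply: (scalemx_inj (pow_neq0 pp N)); rewrite [LHS]scalemxAl [RHS]scalemxAr
  -trmxZ -hB.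
have sL : (lift_sym Y)^T = lift_sym Y by rewrite -{2}sY; apply/matrixP=> i j;
  rewrite !mxE.
by rewrite trmx_mul sL mulmxA.
Qed.

(** A symplectic matrix that relates two block triangular similitudes is
    itself block triangular, because the upper left block A is invertible over
    Q. *)
Lemma upper_block_cancel (c : int) g A B D A' B' D' : c != 0 -> is_sp g ->
  A^T *m D = c%:M ->
  g *m block_mx A B 0 D = block_mx A' B' 0 D' ->
  exists a b d : 'M[int]_n, [/\ a^T *m d = 1%:M, b^T *m d = d^T *m b, A' =
    a *m A, D' = d *m D
    & B' = a *m B + b *m D].
Proof.
move=> c0 gs hA; rewrite -(submxK g) mulmx_block !mulmx0 !addr0.
case/eq_block_mx => h1 h2 h3 h4.
have hA2 : A *m D^T = c%:M.
  by apply: (mulmx_scalarC c0); rewrite -[D^T *m A]trmxK trmx_mul trmxK hA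
    tr_scalar_mx.
have g0 : dlsubmx g = 0.
  apply: (scalemx_inj c0); rewrite scaler0.
  by rewrite -mul_mx_scalar -hA2 mulmxA h3 mul0mx.
exists (ulsubmx g), (ursubmx g), (drsubmx g).
move: gs; rewrite -{1}(submxK g) => /simil_block[_ k2 k3].
split=> //; first by rewrite g0 trmx0 mul0mx subr0 in k2.
by rewrite -h4 g0 mul0mx add0r.
Qed.

(** After block triangularisation, D is replaced by a representative of
    its class, and p^N times B D^-1 = B A^T / p^delta is an integral symmetric
    matrix; it is reduced modulo p^N by a translation. *)
Lemma coset_rep_complete M : simil (p ^ delta)%N%:R M -> exists D Y,
  [/\ D \in lattice_reps p delta finset.set0, Y \in symker p N D &
    left_coset (toQ M) = left_coset (coset_rep D Y)].
Proof.
move=> sM; have pd0 := pow_neq0 pp delta.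
have [g gs g0] := simil_upper pd0 sM.
have sgM := similM gs sM; rewrite mul1r in sgM.
move: (sgM); rewrite -(submxK (g *m M)) g0 => /simil_block[_ hAD _].
rewrite trmx0 mul0mx subr0 in hAD.
have [U Uu hU] : exists2 U, U \in unitmx & U *m drsubmx (g *m M) \in
  lattice_reps p delta finset.set0.
  by apply: (lattice_reps_exist pp); [eexists; exact: hAD | exact: cols_free0].
set h := levi (invmx U)^T U *m g.
have hs : is_sp h by apply: is_spM => //; exact: levi_sp.
pose D := U *m drsubmx (g *m M); rewrite -/D in hU.
pose A := (invmx U)^T *m ulsubmx (g *m M); pose B := (invmx U)^T *m ursubmx
  (g *m M).
have eh : h *m M = block_mx A B 0 D.
  rewrite /h -mulmxA -{1}(submxK (g *m M)) g0 mulmx_block !mul0mx !mulmx0 !addr0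
    !add0r.
  by [].
have shM := similM hs sM; rewrite mul1r eh in shM.
move: (shM) => /simil_block[_ AD BD].
rewrite trmx0 mul0mx subr0 in AD.
have sT := simil_tr pd0 shM.
rewrite tr_block_mx trmx0 in sT; case/simil_block: sT => AB _ _;
  rewrite !trmxK in AB.
(* p^N S, since D^-1 = A^T / p^delta. *)
pose Z := (p ^ (N - delta))%N%:R *: (B *m A^T).
have sZ : Z^T = Z.
  by rewrite /Z trmxZ trmx_mul trmxK AB.
have ZD : Z *m D = (p ^ N)%N%:R *: B.
  by rewrite /Z -scalemxAl -mulmxA AD mul_mx_scalar scalerA -natrM -expnD subnK
    // ltnW.
pose Y := redq Z.
have YD : Y \in symker p N D.
  rewrite inE /Y; apply/andP; split; apply/eqP; last by rewrite -redqM ZD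
    redq_scale.
  by rewrite -{2}sZ; apply/matrixP=> i j; rewrite !mxE.
have [T hT] : exists T, lift_sym Y - Z = (p ^ N)%N%:R *: T.
  by apply: redq_eq0; rewrite /redq map_mxB -/(redq _) -/(redq _) redq_lift
    subrr.
have sT' : T^T = T.
  apply: (scalemx_inj (pow_neq0 pp N)); rewrite -trmxZ -hT.
  have sY : Y^T = Y by move: YD; rewrite inE => /andP[/eqP].
  rewrite -[in RHS]sZ -[in RHS]sY; apply/matrixP=> i j; rewrite !mxE.
  by [].
exists D, Y; split=> //.
have e2 : block_mx 1%:M T 0 1%:M *m h *m M = block_mx A (B + T *m D) 0 D.
  by rewrite -mulmxA eh mulmx_block !mul1mx !mul0mx !mulmx0 !addr0 add0r.
rewrite -(@toQ_coset_rep D Y A (B + T *m D)) //; last first.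
  by rewrite scalerDr -ZD scalemxAl -hT mulmxBl addrC subrK.
symmetry; apply: left_coset_eq; apply/left_cosetP;
  exists (block_mx 1%:M T 0 1%:M *m h).
  by apply: is_spM => //; exact: shear_sp.
by rewrite -toQM e2.
Qed.

Lemma pow_cancel_r (A D X X' : 'M[int]_n) : A^T *m D = (p ^ delta)%N%:R%:M ->
  X *m D = X' *m D -> X = X'.
Proof.
move=> hA h; have hD := mulmx_scalarC (pow_neq0 pp delta) hA.
apply: (scalemx_inj (pow_neq0 pp delta)).
by rewrite -!mul_mx_scalar -hD !mulmxA h.
Qed.

(** The Levi part of the relating matrix is unimodular, so it is trivial
    by uniqueness of the representatives D; what remains is an integral
    translation of S. *)
Lemma coset_rep_inj D Y D' Y' : D \in lattice_reps p delta finset.set0 ->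
  Y \in symker p N D ->
  D' \in lattice_reps p delta finset.set0 -> Y' \in symker p N D' ->
  left_coset (coset_rep D Y) = left_coset (coset_rep D' Y') -> D = D' /\ Y = Y'.
Proof.
move=> hD hY hD' hY' h.
have [A [B [AD BD _]]] := coset_rep_int (lattice_reps_divides hD) hY.
have [A' [B' [AD' BD' _]]] := coset_rep_int (lattice_reps_divides hD') hY'.
have : left_coset (coset_rep D Y) (coset_rep D' Y') by rewrite h;
  exact: left_coset_refl.
case/left_cosetP=> g gs; rewrite -(toQ_coset_rep AD BD) -(toQ_coset_rep AD' BD')
  -toQM.
move/toQ_inj/esym => eg.
have [a [b [d [ad bd _ eD eB]]]] := upper_block_cancel (pow_neq0 pp delta) gs AD
  eg.
have du : d \in unitmx by have [] := mulmx1_unit ad.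
have DD' : D = D' by apply: (lattice_reps_uniq_mod pp hD hD' du).
split=> //; rewrite -DD' in BD' eD.
have d1 : d = 1%:M by apply: (pow_cancel_r AD); rewrite mul1mx -eD.
have eY : lift_sym Y' = lift_sym Y + (p ^ N)%N%:R *: b.
  apply: (pow_cancel_r AD); rewrite -BD' eB mulmxDl -BD -scalemxAl -scalerDr;
    congr (_ *: (_ + _)).
  have a1 : a = 1%:M by rewrite -[a]trmxK -(mulmx1 a^T) -d1 ad trmx1.
  by rewrite a1 mul1mx.
rewrite -(redq_lift Y) -(redq_lift Y') eY.
by rewrite [redq (_ + _)]map_mxD -/(redq _) -/(redq _) redq_scale addr0.
Qed.

(** If the factor M has nonzero diagonal, its columns can be solved from
    left to right. *)
Lemma upper_left_factor (d : 'M[rat]_n) (M M' : 'M[rat]_n) :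
  (forall i j : 'I_n, (j < i)%N -> M i j = 0) -> (forall i j : 'I_n,
    (j < i)%N -> M' i j = 0) ->
  (forall i, M i i != 0) -> d *m M = M' ->
  (forall i j : 'I_n, (j < i)%N -> d i j = 0) /\ forall i, d i i * M i i =
    M' i i.
Proof.
move=> hM hM' nz e.
have up : forall i j : 'I_n, (j < i)%N -> d i j = 0.
  move=> i j; have [m] := ubnP (j : nat); elim: m j => // m IH j jm ji.
  move/matrixP: e => /(_ i j); rewrite hM' // mxE (bigD1 j) //= big1 ?addr0.
    by move/eqP; rewrite mulf_eq0 (negPf (nz j)) orbF => /eqP.
  move=> k; rewrite -val_eqE neq_ltn => /orP[kj|jk]; last by rewrite hM ?mulr0.
  by rewrite IH ?mul0r //; [exact: leq_trans kj _ | exact: ltn_trans kj ji].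
split=> // i; rewrite -e mxE (bigD1 i) //= big1 ?addr0 // => k.
rewrite -val_eqE neq_ltn => /orP[ki|ik]; first by rewrite up ?mul0r.
by rewrite hM ?mulr0.
Qed.

Lemma pow_int_le (c : int) a b : (c%:~R : rat) * p%:R ^+ a = p%:R ^+ b ->
  (a <= b)%N.
Proof.
rewrite -!natrX !pmulrn -intrM => /intr_inj /(congr1 absz); rewrite abszM /= =>
  h.
by rewrite -(dvdn_Pexp2l _ _ (prime_gt1 pp)) -h dvdn_mull.
Qed.

(** The monomial does not depend on the representative: two block
    triangular representatives of the same coset differ by a unimodular
    triangular matrix, whose diagonal entries and their inverses are integral
    powers of p; and delta is read off from the product A^T D. For n = 0 the
    latter is empty, hence the hypothesis. *)
Lemma spherical_coset_rep D Y : (0 < n)%N -> D \in lattice_reps p delta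
  finset.set0 -> Y \in symker p N D ->
  spherical_coset p (left_coset (coset_rep D Y)) = spherical_monomial p delta
    (@dexp p n D).
Proof.
move=> n0 hD hY.
have [A [B [AD BD sM]]] := coset_rep_int (lattice_reps_divides hD) hY.
have [up [e he]] := lattice_reps_upper hD.
have eD i : dexp p D i = e i by apply: dexpE.
have repr : is_spherical_repr p delta (dexp p D) (coset_rep D Y).
  exists (p%:R ^- N *: (toQ (lift_sym Y) *m toQ D)), (toQ D); split=> //.
  - exists (p ^ delta)%N%:R; first by rewrite ltr0n expn_gt0 prime_gt0.
    rewrite -(toQ_coset_rep AD BD); move: sM => /(congr1 (@toQ _ _)).
    rewrite !toQM toQ_symplectic /toQ map_mxZ rmorph_nat
      -/(toQ (symplectic_form _ _)) toQ_symplectic.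
    by rewrite map_trmx.
  - by move=> i j ji; rewrite mxE up.
  - by move=> i; rewrite mxE he eD rmorphXn /= rmorph_nat.
rewrite /spherical_coset; set S := (X in xget 0 X).
suff uniqS m : S m -> m = spherical_monomial p delta (dexp p D).
  apply: uniqS; apply: xgetPex; exists (spherical_monomial p delta (dexp p D)),
    delta, (dexp p D).
  by split=> //; exists (coset_rep D Y) => //; exact: left_coset_refl.
case=> delta' [d' [-> [M hM [B1 [D1 [_ up1 hd1 eM]]]]]].
case/left_cosetP: hM => g gs; rewrite -(toQ_coset_rep AD BD) -toQM => eM'.
have := eM'; rewrite eM -(submxK (g *m _)) toQ_block =>
  /eq_block_mx[e1 e2 e3 e4].
have z0 : dlsubmx (g *m block_mx A B 0 D) = 0.
  by apply: toQ_inj; rewrite -e3 /toQ map_mx0.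
have eg : g *m block_mx A B 0 D = block_mx (ulsubmx (g *m block_mx A B 0 D))
  (ursubmx (g *m block_mx A B 0 D)) 0 (drsubmx (g *m block_mx A B 0 D)).
  by rewrite -{1}(submxK (g *m _)) z0.
have [a [b [d [ad _ eA eD1 _]]]] := upper_block_cancel (pow_neq0 pp delta) gs AD
  eg.
have da : d *m a^T = 1%:M by exact: mulmx1C.
rewrite eA in e1; rewrite eD1 in e4.
have Dnz i : toQ D i i != 0 by rewrite mxE he rmorphXn /= rmorph_nat expf_neq0
  // pnatr_eq0 -lt0n prime_gt0.
have D1nz i : D1 i i != 0 by rewrite hd1 expf_neq0 // pnatr_eq0 -lt0n prime_gt0.
have upQ (i j : 'I_n) : (j < i)%N -> toQ D i j = 0 by move=> ji; rewrite mxE up.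
have [_ f1] := upper_left_factor upQ up1 Dnz (esym (etrans e4 (toQM d D))).
have e5 : toQ a^T *m D1 = toQ D by rewrite e4 toQM mulmxA -toQM ad /toQ map_mx1
  mul1mx.
have [_ f2] := upper_left_factor up1 upQ D1nz e5.
have dd i : d' i = dexp p D i.
  rewrite eD; apply/eqP; rewrite eqn_leq; apply/andP; split.
    apply: (@pow_int_le (a^T i i)); rewrite -hd1; have := f2 i;
      rewrite [toQ _ i i]mxE => ->.
    by rewrite mxE he rmorphXn /= rmorph_nat.
  apply: (@pow_int_le (d i i)); rewrite -hd1 -f1 [toQ d i i]mxE [toQ D i i]mxE
    he rmorphXn /=.
  by rewrite rmorph_nat.
have D1u : D1 \in unitmx.
  have : (p%:R ^- delta *: toQ A^T *m toQ a^T) *m D1 = 1%:M.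
    rewrite -mulmxA e5 -scalemxAl -toQM AD toQ_scalar rmorph_nat natrX
      scale_scalar_mx mulVf //.
    by rewrite expf_neq0 // pnatr_eq0 -lt0n prime_gt0.
  by case/mulmx1_unit.
have ddelta : delta' = delta.
  have : (p%:R ^+ delta')%:M = toQ ((p ^ delta)%N%:R%:M : 'M[int]_n).
    rewrite -AD -[A^T]mulmx1 -ad mulmxA -trmx_mul -mulmxA toQM -e4.
    have -> : toQ (a *m A)^T = p%:R ^+ delta' *: invmx D1.
      by rewrite /toQ -map_trmx -/(toQ (a *m A)) -e1 trmxZ trmxK.
    by rewrite -scalemxAl mulVmx // scalemx1.
  move/matrixP/(_ (Ordinal n0) (Ordinal n0)); rewrite toQ_scalar !mxE eqxx
    !mulr1n rmorph_nat -natrX.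
  by move/eqP; rewrite eqr_nat eqn_exp2l ?prime_gt1 // => /eqP.
rewrite ddelta; congr (spherical_monomial _ _ _); exact/funext.
Qed.

End Cosets.

(** * Uniqueness of symplectic elementary divisors *)

(** The vectors v with diag(p^f) v = 0 modulo p^k are spanned modulo p by
    the basis vectors with f_i >= k; a unimodular equivalence maps these
    spaces injectively into each other. *)
Lemma pow_diag_card_le p m (f f' : 'I_m -> nat) (g h : 'M[int]_m) k : prime p ->
  g \in unitmx -> h \in unitmx -> pow_diag p f = g *m pow_diag p f' *m h ->
  (#|[set i | k <= f i]%N| <= #|[set i | k <= f' i]%N|)%N.
Proof.
move=> pp gu hu e; set S := finset _; set S' := finset _.
have e' : pow_diag p f' *m h = invmx g *m pow_diag p f by rewrite e -mulmxA
  mulKmx.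
have fix_S : proj 'F_p S' *m redp p h *m proj _ S = redp p h *m proj _ S.
  apply/matrixP=> j i; rewrite !mulr_projE mul_projE; case iS: (i \in S);
    last by rewrite !mulr0.
  case jS: (j \in S'); rewrite ?mul1r // !mulr1 mul0r mxE; apply/esym/eqP.
  rewrite -(dvdz_pcharf (pchar_Fp pp)).
  move: iS jS; rewrite !inE => iS /negbT; rewrite -ltnNge => jS.
  have fij : (f' j < f i)%N := leq_trans jS iS.
  have pf : ((p ^ f' j)%N%:R : int) != 0 by exact: pow_neq0.
  move/matrixP: e' => /(_ j i); rewrite mul_diag_mx mul_mx_diag !mxE => eji.
  have : h j i = (invmx g j i * (p ^ (f i - f' j))%N%:R).
    apply: (mulfI pf); rewrite eji mulrCA -natrM -expnD subnKC // ltnW //.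
  move=> ->; apply: dvdz_mull; by rewrite natz dvdzE /= dvdn_exp // subn_gt0.
rewrite -(rank_proj 'F_p S) -(rank_proj 'F_p S').
have <- : \rank (redp p h *m proj 'F_p S) = \rank (proj 'F_p S).
  by rewrite (eqmxMfull (proj 'F_p S)) //; rewrite row_full_unit redp_unit.
by rewrite -fix_S -mulmxA mxrankM_maxl.
Qed.

Lemma pow_diag_card p m (f f' : 'I_m -> nat) (g h : 'M[int]_m) k : prime p ->
  g \in unitmx -> h \in unitmx -> pow_diag p f = g *m pow_diag p f' *m h ->
  #|[set i | k <= f i]%N| = #|[set i | k <= f' i]%N|.
Proof.
move=> pp gu hu e; apply/eqP; rewrite eqn_leq; apply/andP; split; first exact:
  pow_diag_card_le e.
apply: (@pow_diag_card_le p m f' f (invmx g) (invmx h)); rewrite ?unitmx_inv //.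
by rewrite e -!mulmxA mulKmx // mulmxV // mulmx1.
Qed.

Lemma is_sp_unit n (g : 'M[int]_(n + n)) : is_sp g -> g \in unitmx.
Proof. by case/is_spV=> h _ [/mulmx1_unit[]]. Qed.

Definition sp_exp n delta (a : 'I_n -> nat) (i : 'I_(n + n)) : nat :=
  match fintype.split i with inl j => a j | inr j => (delta - a j)%N end.

Lemma sp_exp_diag n p delta (a : 'I_n -> nat) : sp_diag p delta a = pow_diag p
  (sp_exp delta a).
Proof.
rewrite /sp_diag /pow_diag; symmetry.
rewrite -(diag_mx_row (\row_i (p ^ a i)%N%:R)
  (\row_i (p ^ (delta - a i))%N%:R)).
congr diag_mx; apply/rowP=> i; rewrite !mxE /sp_exp; case: fintype.splitP =>
  j _; by rewrite mxE.
Qed.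

(** The exponents of the matrices in SD(p^delta): d_n | e_n means that
    twice the largest one is at most delta. *)
Definition elem_exps n delta (a : 'I_n -> nat) : Prop :=
  (forall i j : 'I_n, (i <= j)%N -> (a i <= a j)%N) /\ forall i,
    ((a i).*2 <= delta)%N.

Lemma mono_lt_card n (a : 'I_n -> nat) k i : (forall i j : 'I_n, (i <= j)%N ->
  (a i <= a j)%N) ->
  (a i < k)%N = (i < #|[set j | (a j < k)%N]|)%N.
Proof.
move=> mono; have cardlt (m : nat) : (m <= n)%N ->
  #|[set j : 'I_n | (j < m)%N]| = m.
  move=> mn; rewrite -sum1_card (eq_bigl (fun l : 'I_n => (l < m)%N)) => [|l];
    last by rewrite inE.
  by rewrite (big_ord_narrow mn) sum1_card card_ord.
apply/idP/idP => [ik|].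
  rewrite -(cardlt i.+1) //; apply/subset_leq_card/subsetP=> j;
    rewrite !inE ltnS => /mono.
  by move=> h; exact: leq_ltn_trans h ik.
apply: contraTT; rewrite -!leqNgt => ki.
rewrite -[leqRHS](cardlt i) ?(ltnW (ltn_ord i)) //;
  apply/subset_leq_card/subsetP=> j; rewrite !inE => jk.
by rewrite ltnNge; apply/negP=> /mono/(leq_trans ki); rewrite leqNgt jk.
Qed.

(** The number of exponents that are at least k is an invariant of the
    double coset. For 2k <= delta all the exponents delta - a_i are counted,
    so the number of a_i >= k is an invariant for every k, and a monotone
    sequence is determined by these numbers. *)
Lemma sp_diag_inj n p delta (a a' : 'I_n -> nat) g h : prime p ->
  elem_exps delta a ->
  elem_exps delta a' -> is_sp g -> is_sp h -> sp_diag p delta a = g *m sp_diag p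
    delta a' *m h ->
  a =1 a'.
Proof.
move=> pp [ma da] [ma' da'] gs hs; rewrite !sp_exp_diag => e.
have cardS b k : elem_exps delta b -> #|[set i | (k <= sp_exp delta b i)%N]| =
    (#|[set i | (k <= b i)%N]| + #|[set i : 'I_n | (k <= delta - b i)%N]|)%N.
  move=> _; rewrite -!sum1dep_card big_mkcond big_split_ord /= -!big_mkcond /=.
  by congr (_ + _)%N; apply: eq_bigl => i; rewrite /sp_exp (unsplitK (inl i),
    unsplitK (inr i)).
have half b k : elem_exps delta b -> (k.*2 <= delta)%N ->
  #|[set i : 'I_n | (k <= delta - b i)%N]| = n.
  move=> [_ db] kd; rewrite -[RHS]card_ord -cardsT; apply: eq_card => i;
    rewrite !inE.
  by have := db i; lia.
have cardge k : #|[set i | (k <= a i)%N]| = #|[set i | (k <= a' i)%N]|.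
  have [kd|kd] := leqP k.*2 delta.
    have := pow_diag_card k pp (is_sp_unit gs) (is_sp_unit hs) e.
    by rewrite !cardS // !half // => /addIn.
  have z b : elem_exps delta b -> #|[set i | (k <= b i)%N]| = 0%N.
    by move=> [_ db]; apply/eqP; rewrite cards_eq0; apply/eqP/setP=> i;
      rewrite !inE; have := db i; lia.
  by rewrite !z.
have cardlt k : #|[set i | (a i < k)%N]| = #|[set i | (a' i < k)%N]|.
  have E b : [set i : 'I_n | (b i < k)%N] = ~: [set i | (k <= b i)%N].
    by apply/setP=> i; rewrite !inE ltnNge.
  apply: (@addnI #|[set i | (k <= a i)%N]|); rewrite {2}cardge !E !cardsC //.
have lt k i : (a i < k)%N = (a' i < k)%N by rewrite (mono_lt_card _ _ ma)
  (mono_lt_card _ _ ma') cardlt.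
move=> i; apply/eqP; rewrite eqn_leq; apply/andP; split; rewrite -ltnS.
  by rewrite (lt (a' i).+1).
by rewrite -(lt (a i).+1).
Qed.

Lemma SD_powP n p delta (M : 'M[rat]_(n + n)) : prime p ->
  SD (p ^ delta) M <-> exists2 a, elem_exps delta a &
    M = toQ (sp_diag p delta a).
Proof.
move=> pp; have p1 := prime_gt1 pp.
have diagE (f : 'I_n -> nat) : toQ (diag_mx (\row_i (f i)%:R)) =
  diag_mx (\row_i (f i)%:R).
  by rewrite /toQ map_diag_mx; congr diag_mx; apply/rowP=> i;
    rewrite !mxE rmorph_nat.
split.
  case=> d [e [pos chain last de ->]].
  have hd i : exists a, (a <= delta)%N /\ d i = (p ^ a)%N.
    have /dvdn_pfactor : (d i %| p ^ delta)%N by rewrite -(de i) dvdn_mulr.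
    by case=> // a; exists a.
  have /fin_all_exists[a ha] := hd.
  have he i : e i = (p ^ (delta - a i))%N.
    have [ai di] := ha i; apply/eqP; rewrite -(@eqn_pmul2l (p ^ a i)) ?expn_gt0
      ?prime_gt0 //.
    by rewrite -{1}di de -expnD subnKC.
  have mono (i j : 'I_n) : (i <= j)%N -> (a i <= a j)%N.
    move=> ij; have [m] : exists m, j = (i + m)%N :> nat by exists (j - i)%N;
      rewrite subnKC.
    elim: m j {ij} => [|m IH] j; first by rewrite addn0 => /val_inj ->.
    rewrite addnS => jm; have mn : (i + m < n)%N by rewrite -ltnS -jm ltnS ltnW.
    have /andP[+ _] := chain (Ordinal mn) j jm.
    have [_ ->] := ha (Ordinal mn); have [_ ->] := ha j.
    by rewrite dvdn_Pexp2l // => /(leq_trans (IH (Ordinal mn) erefl)).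
  exists a.
    split=> // i.
    have nn : (n.-1 < n)%N by have := ltn_ord i; lia.
    pose l := Ordinal nn.
    have il : (a i <= a l)%N by apply: mono; rewrite /=; have := ltn_ord i; lia.
    have := last l; rewrite /= prednK; last by have := ltn_ord i; lia.
    move=> /(_ erefl); have [al ->] := ha l; rewrite he dvdn_Pexp2l //.
    by move: il al; lia.
  rewrite /sp_diag toQ_block /toQ !map_mx0 -!/(toQ _).
  rewrite -!/(toQ (diag_mx _)) !diagE; congr block_mx; congr diag_mx;
    apply/rowP=> i; rewrite !mxE ?he //.
  by have [_ ->] := ha i.
case=> a [mono half] ->; exists (fun i => p ^ a i)%N,
  (fun i => p ^ (delta - a i))%N; split.
- by move=> i; rewrite !expn_gt0 prime_gt0.
- move=> i j ij; have aij : (a i <= a j)%N by apply: mono; rewrite ij.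
  by rewrite !dvdn_Pexp2l // aij leq_sub2l.
- by move=> i _; rewrite dvdn_Pexp2l //; have := half i; lia.
- by move=> i; rewrite -expnD subnKC //; have := half i; lia.
by rewrite /sp_diag toQ_block /toQ !map_mx0 -!/(toQ (diag_mx _)) !diagE.
Qed.

(** * The image of the Hecke operators under the spherical map *)

Section HeckeT.
Local Open Scope classical_set_scope.
Local Open Scope ring_scope.
Variables (p n : nat).
Hypotheses (pp : prime p) (n0 : (0 < n)%N).
Variables (delta N : nat).
Hypothesis dN : (delta < N)%N.

Definition coset_list : seq (set 'M[rat]_(n + n)) :=
  [seq left_coset (coset_rep delta D Y) | D <- lattice_reps p delta finset.set0,
    Y <- enum (symker p N D)].

Lemma coset_list_uniq : uniq coset_list.
Proof.
apply: allpairs_uniq_dep; [exact: lattice_reps_uniq | by move=> D _;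
  exact: enum_uniq |].
move=> _ _ /allpairsPdep[D [Y [hD hY ->]]] /allpairsPdep[D' [Y' [hD' hY' ->]]]
  /=.
rewrite !mem_enum in hY hY' => h.
by have [-> ->] := coset_rep_inj pp dN hD hY hD' hY' h.
Qed.

Lemma mem_coset_list C : C \in coset_list <->
  exists2 M, simil (p ^ delta)%N%:R M & C = left_coset (toQ M).
Proof.
split=> [/allpairsPdep[D [Y [hD hY ->]]]|[M sM ->]].
  rewrite mem_enum in hY.
  have [A [B [AD BD sM]]] := coset_rep_int pp dN (lattice_reps_divides hD) hY.
  by exists (block_mx A B 0 D) => //; rewrite (toQ_coset_rep pp AD BD).
have [D [Y [hD hY ->]]] := coset_rep_complete pp dN sM.
by apply/allpairsPdep; exists D, Y; rewrite mem_enum.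
Qed.

Definition cosets_in (M : 'M[rat]_(n + n)) : set (set 'M[rat]_(n + n)) :=
  [set left_coset P | P in double_coset M].

Lemma siegel_groupP (g : 'M[rat]_(n + n)) : siegel_group g <-> exists2 h,
  is_sp h & g = toQ h.
Proof.
split=> [[h hs <-]|[h hs ->]]; exists h => //; first by rewrite /is_sp /simil
  scale1r.
by move: hs; rewrite /is_sp /simil scale1r.
Qed.

Lemma cosets_inP (M : 'M[int]_(n + n)) C : cosets_in (toQ M) C <->
  exists g h, [/\ is_sp g, is_sp h & C = left_coset (toQ (g *m M *m h))].
Proof.
split=> [[_ [_ [_ [/siegel_groupP[g gs ->] /siegel_groupP[h hs ->] ->]]] <-]|[g
  [h [gs hs ->]]]].
  by exists g, h; rewrite !toQM.
exists (toQ (g *m M *m h)) => //; exists (toQ g), (toQ h); rewrite !toQM;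
  split=> //.
  by apply/siegel_groupP; exists g.
by apply/siegel_groupP; exists h.
Qed.

Lemma sp_diag_simil (a : 'I_n -> nat) : elem_exps delta a ->
  simil (p ^ delta)%N%:R (sp_diag p delta a).
Proof.
move=> [_ half]; apply/simil_block; split; rewrite ?trmx0 ?mul0mx ?mulmx0 ?subr0
  //.
rewrite tr_diag_mx mulmx_diag; apply/matrixP=> i j; rewrite !mxE -natrM -expnD
  subnKC //.
by have := half i; lia.
Qed.

Lemma cosets_in_list M C : SD (p ^ delta) M -> cosets_in M C ->
  C \in coset_list.
Proof.
case/(SD_powP _ _ pp) => a ha -> /cosets_inP[g [h [gs hs ->]]];
  apply/mem_coset_list.
exists (g *m sp_diag p delta a *m h) => //.
by have := similM (similM gs (sp_diag_simil ha)) hs; rewrite mul1r mulr1.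
Qed.

Lemma cosets_in_exists C : C \in coset_list -> exists2 M, SD (p ^ delta) M &
  cosets_in M C.
Proof.
case/mem_coset_list=> M /(simil_SNF pp)[g [h [a [gs hs ma da ->]]]] ->.
exists (toQ (sp_diag p delta a)); first by apply/(SD_powP _ _ pp); exists a.
by apply/cosets_inP; exists g, h.
Qed.

Lemma cosets_in_unique C M M' : SD (p ^ delta) M -> SD (p ^ delta) M' ->
  cosets_in M C -> cosets_in M' C -> M = M'.
Proof.
case/(SD_powP _ _ pp) => a ha -> /(SD_powP _ _ pp)[a' ha' ->].
case/cosets_inP=> g [h [gs hs ->]] /cosets_inP[g' [h' [gs' hs' e]]].
have : left_coset (toQ (g' *m sp_diag p delta a' *m h'))
  (toQ (g *m sp_diag p delta a *m h)).
  by rewrite -e; exact: left_coset_refl.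
case/left_cosetP=> k ks; rewrite -toQM => /toQ_inj e2.
have [g1 g1s [g1g _]] := is_spV gs; have [h1 h1s [_ hh1]] := is_spV hs.
have e3 : sp_diag p delta a = (g1 *m k *m g') *m sp_diag p delta a' *m
  (h' *m h1).
  have := congr1 (fun X => g1 *m X *m h1) e2; rewrite /= -!mulmxA hh1 mulmx1
    (mulmxA g1) g1g mul1mx => ->.
  by rewrite !mulmxA.
have aa' := sp_diag_inj pp ha ha' (is_spM (is_spM g1s ks) gs') (is_spM hs' h1s)
  e3.
by congr toQ; congr sp_diag; exact/funext.
Qed.

Lemma hecke_cosetE M : SD (p ^ delta) M ->
  hecke_coset M = \sum_(C <- coset_list | `[< cosets_in M C >])
    (<< C >> : hecke_module n).
Proof.
move=> hM; rewrite /hecke_coset.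
rewrite -[RHS]big_filter [RHS]fsbig_seq; last by rewrite filter_uniq //
  coset_list_uniq.
apply: eq_fsbigl; apply/seteqP; split=> C /=.
  by move=> hC; rewrite mem_filter (cosets_in_list hM) // andbT; apply/asboolP.
by rewrite mem_filter => /andP[/asboolP].
Qed.

Definition SD_list : seq 'M[rat]_(n + n) :=
  undup [seq toQ (sp_diag p delta (fun i => a i : nat)) |
          a : {ffun 'I_n -> 'I_delta.+1} <- enum {ffun 'I_n -> 'I_delta.+1} &
            `[< elem_exps delta (fun i => a i : nat) >]].

Lemma mem_SD_list M : M \in SD_list <-> SD (p ^ delta) M.
Proof.
rewrite mem_undup; split=> [/mapP[a]|/(SD_powP _ _ pp)[a ha ->]].
  by rewrite mem_filter => /andP[/asboolP ha _] ->; apply/(SD_powP _ _ pp);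
    eexists; first exact: ha.
have ad i : (a i < delta.+1)%N by have [_ /(_ i)] := ha; lia.
apply/mapP; exists [ffun i => Ordinal (ad i)]; last first.
  by congr toQ; congr sp_diag; apply/funext=> i; rewrite ffunE.
rewrite mem_filter mem_enum andbT; apply/asboolP.
by have -> : (fun i => [ffun i => Ordinal (ad i)] i : nat) = a by apply/funext=>
  i; rewrite ffunE.
Qed.

(** Every coset in the list lies in the double coset of exactly one M. *)
Lemma hecke_TE : hecke_T n (p ^ delta) = \sum_(C <- coset_list)
  (<< C >> : hecke_module n).
Proof.
rewrite /hecke_T.
have -> : SD (n:=n) (p ^ delta) = [set` SD_list].
  by apply/seteqP; split=> M /=; [move/mem_SD_list | move=> /mem_SD_list].
rewrite -(fsbig_seq _ _ (undup_uniq _)).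
rewrite big_seq (eq_bigr (fun M => \sum_(C <- coset_list | `[< cosets_in M C >])
  (<< C >> : hecke_module n))); last first.
  by move=> M /mem_SD_list; exact: hecke_cosetE.
rewrite -big_seq (exchange_big_dep xpredT) //= big_seq [RHS]big_seq;
  apply: eq_bigr => C hC.
have [M hM hMC] := cosets_in_exists hC.
have /mem_SD_list Ml := hM.
rewrite (big_rem M) //= asboolT // big_seq_cond big1 ?addr0 // => M' /andP[].
rewrite mem_rem_uniq ?undup_uniq // inE => /andP[/eqP MM' /mem_SD_list hM']
  /asboolP hC'.
by case: MM'; exact: cosets_in_unique hM' hM hC' hMC.
Qed.

Lemma spherical_map_list (L : seq (set 'M[rat]_(n + n))) : uniq L ->
  spherical_map p (\sum_(C <- L) (<< C >> : hecke_module n)) = \sum_(C <- L)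
    spherical_coset p C.
Proof.
move=> uL; set X := \sum_(C <- L) _.
have cX C : coeff C X = (C \in L)%:R.
  rewrite /X raddf_sum /=; under eq_bigr do rewrite coeffU mul1r.
  have [CL|CL] := boolP (C \in L).
    by rewrite (bigD1_seq C) //= eqxx big1 ?addr0 // => C' /negPf ->;
      rewrite mulr0n.
  rewrite big_seq big1 // => C' C'L; case: eqP => // e; by rewrite -e C'L in CL.
rewrite /spherical_map.
rewrite (perm_big L); last first.
  apply: uniq_perm => //; first exact: uniq_dom.
  by move=> C; rewrite mem_dom cX; case: (C \in L).
by apply: eq_big_seq => C CL; rewrite cX CL.
Qed.

(** The factor (x_j p^-j) of the spherical map, with indices shifted by
    one. *)
Definition satake_weight (j : 'I_n) : {mpoly rat[n.+1]} := p%:R ^- j.+1 *: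
  'X_(inord j.+1).

Lemma spherical_map_hecke_T : spherical_map p (hecke_T n (p ^ delta)) =
  'X_(inord 0) ^+ delta * layer_sum p satake_weight N delta finset.set0.
Proof.
rewrite hecke_TE spherical_map_list ?coset_list_uniq // /coset_list
  big_allpairs_dep /=.
rewrite /layer_sum mulr_sumr; apply: eq_big_seq => D hD.
rewrite (eq_big_seq (fun=> spherical_monomial p delta (@dexp p n D)));
  last first.
  by move=> Y; rewrite mem_enum => hY; exact: spherical_coset_rep.
rewrite big_const_seq count_predT -cardE iter_addr_0 /spherical_monomial
  -/(satake_weight _).
by rewrite mulrCA [RHS]mulr_natl.
Qed.

End HeckeT.

(** * Sparse polynomials and the transfer matrix for n = 4 *)

(** The exponents of x_1, ..., x_4 and of t = 1/p, in this order. *)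
Definition monom := seq nat.
Definition spoly := seq (int * monom).

Fixpoint mmul (m m' : monom) : monom :=
  match m, m' with
  | e :: m1, e' :: m1' => (e + e')%N :: mmul m1 m1'
  | [::], _ => m'
  | _, [::] => m
  end.

Fixpoint mlt (m m' : monom) : bool :=
  match m, m' with
  | e :: m1, e' :: m1' => if (e == e')%N then mlt m1 m1' else (e < e')%N
  | [::], _ :: _ => true
  | _, [::] => false
  end.

(** Merging of two lists sorted by monomials, which drops the terms that
    cancel. The identities of evaluations below hold for all lists; sorting
    only matters for the zero test to succeed. *)
Fixpoint spadd (p : spoly) : spoly -> spoly :=
  match p with
  | [::] => id
  | (c, m) :: p' =>
    fix insert q := match q with
    | [::] => p
    | (d, n) :: q' =>
      if m == n then
        let s := c + d in if s == 0 then spadd p' q' else (s, m) :: spadd p' q'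
      else if mlt m n then (c, m) :: spadd p' q else (d, n) :: insert q'
    end
  end.

Definition spscale (c : int) (m : monom) (p : spoly) : spoly :=
  [seq (c * dn.1, mmul m dn.2) | dn <- p].

Definition spopp (p : spoly) : spoly := [seq (- cm.1, cm.2) | cm <- p].

Definition spmul (p q : spoly) : spoly :=
  foldr (fun cm acc => spadd (spscale cm.1 cm.2 q) acc) [::] p.

Section Eval.
Variables (R : comNzRingType) (xs : seq R).

Fixpoint mev_at (ys : seq R) (m : monom) : R :=
  match ys, m with
  | y :: ys', e :: m' => y ^+ e * mev_at ys' m'
  | _, _ => 1
  end.

Definition mev := mev_at xs.

Definition ev (p : spoly) : R := \sum_(cm <- p) cm.1%:~R * mev cm.2.

Lemma mevM m m' : mev (mmul m m') = mev m * mev m'.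
Proof.
rewrite /mev; elim: xs m m' => [|y ys IH] [|e m] [|e' m'] //=;
  rewrite ?mul1r ?mulr1 //.
by rewrite exprD IH mulrACA.
Qed.

Lemma ev0 : ev [::] = 0. Proof. exact: big_nil. Qed.

Lemma ev_cons c m p : ev ((c, m) :: p) = c%:~R * mev m + ev p.
Proof. by rewrite /ev big_cons. Qed.

Lemma evD p q : ev (spadd p q) = ev p + ev q.
Proof.
elim: p q => [|[c m] p IHp] q /=; first by rewrite ev0 add0r.
elim: q => [|[d n] q IHq]; first by rewrite ev0 addr0.
case: eqP => [<-|_].
  case: eqP => [cd|_]; rewrite ?ev_cons IHp.
    have -> : c%:~R = - d%:~R :> R by apply/eqP; rewrite -subr_eq0 opprK -intrD
      cd.
    by rewrite mulNr addrACA addNr add0r.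
  by rewrite intrD mulrDl addrACA.
case: ifP => _; first by rewrite !ev_cons IHp ev_cons addrA.
by rewrite ev_cons IHq !ev_cons addrCA.
Qed.

Lemma ev_scale c m p : ev (spscale c m p) = c%:~R * mev m * ev p.
Proof.
rewrite /ev big_map mulr_sumr; apply: eq_bigr => -[d n] _ /=.
by rewrite intrM mevM mulrACA.
Qed.

Lemma evN p : ev (spopp p) = - ev p.
Proof.
by rewrite /ev big_map -sumrN; apply: eq_bigr => cm _; rewrite mulrNz mulNr.
Qed.

Lemma evM p q : ev (spmul p q) = ev p * ev q.
Proof.
elim: p => [|[c m] p IH] /=; first by rewrite ev0 mul0r.
by rewrite evD ev_scale IH ev_cons mulrDl.
Qed.

(** Equality of evaluations is tested by normalising the difference. *)
Lemma ev_eq p q : spadd p (spopp q) = [::] -> ev p = ev q.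
Proof. by move=> h; apply/eqP; rewrite -subr_eq0 -evN -evD h ev0. Qed.
End Eval.

Arguments spadd : simpl never.
Arguments spmul : simpl never.
Arguments spopp : simpl never.

Definition bitsets : seq bitseq :=
  [seq ab ++ cd | ab <- [seq [:: a; b] | a <- [:: false; true], b <- [:: false;
    true]],
     cd <- [seq [:: c; d] | c <- [:: false; true], d <- [:: false; true]]].

Definition spone : spoly := [:: (1, nseq 5 0%N)].
Definition spvar (i e : nat) : spoly := [:: (1, set_nth 0%N (nseq 5 0%N) i e)].

Arguments spvar : simpl never.

(** The entry A_JK restricted to the columns from i on, where j and k are
    the numbers of elements of J and K among the earlier columns. Reading the
    columns from left to right, a vanishing factor 1 - t^0 is met before k - j
    could become negative, so the truncated subtraction is harmless. *)
Fixpoint transfer_at (i j k : nat) (J K : bitseq) : spoly :=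
  match J, K with
  | b :: J', a :: K' =>
    if a then transfer_at i.+1 (b + j) k.+1 J' K'
    else if b && (j == k) then [::]
    else
      let r := spmul (spvar i 1) (transfer_at i.+1 (b + j) k J' K') in
      if b then spadd r (spopp (spmul (spvar 4 (k - j)) r)) else r
  | _, _ => spone
  end.
Definition transfer := transfer_at 0 0 0.

Definition spmonom (I : bitseq) : spoly :=
  [:: (1, rcons (map nat_of_bool I) 0%N)].

(** Multiplication by 1 - x_I z of a polynomial in z given by the list of
    its coefficients. *)
Definition qmul (q : seq spoly) (I : bitseq) : seq spoly :=
  [seq spadd (nth [::] q i) (spopp (if i is i'.+1 then spmul (spmonom I)
    (nth [::] q i') else [::]))
     | i <- iota 0 (size q).+1].

(** The subsets in the order of the factors of the denominator. *)
Definition subsets_by_size : seq bitseq :=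
  [:: [:: false; false; false; false];
      [:: true; false; false; false]; [:: false; true; false; false];
      [:: false; false; true; false]; [:: false; false; false; true];
      [:: true; true; false; false]; [:: true; false; true; false];
      [:: true; false; false; true]; [:: false; true; true; false];
      [:: false; true; false; true]; [:: false; false; true; true];
      [:: true; true; true; false]; [:: true; true; false; true];
      [:: true; false; true; true]; [:: false; true; true; true];
      [:: true; true; true; true]].

Definition qcoefs : seq spoly := foldl qmul [:: spone] subsets_by_size.

Definition spsum (ps : seq spoly) : spoly := foldr spadd [::] ps.

Definition row_step (r : seq spoly) (q : spoly) : seq spoly :=
  [seq spadd (spsum [seq spmul (transfer Jr.1 K) Jr.2 | Jr <- zip bitsets r])
     (if K == nseq 4 false then q else [::]) | K <- bitsets].

(** The row vectors r_d, indexed by the list of subsets. *)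
Fixpoint row (d : nat) : seq spoly :=
  if d is d'.+1 then row_step (row d') (nth [::] qcoefs d)
  else [seq (if K == nseq 4 false then spone else [::]) | K <- bitsets].

Fixpoint rows (r : seq spoly) (qs : seq spoly) : seq (seq spoly) :=
  if qs is q :: qs' then r :: rows (row_step r q) qs' else [:: r].

(** * Evaluation of the transfer matrix *)

Section TransferEntries.
Variable p : nat.
Hypothesis pp : prime p.

Let pnz : (p%:R : rat) != 0. Proof. by rewrite pnatr_eq0 -lt0n prime_gt0. Qed.

Definition satake_env : seq {mpoly rat[5]} := [:: x1; x2; x3; x4; (p%:R^-1)%:A].

Definition transfer_coef (J K : {set 'I_4}) : {mpoly rat[5]} :=
  \prod_(c | c \notin K)
    ((1 - (c \in J)%:R * (p%:R ^+ #|below J c| / p%:R ^+ #|below K c|)) *: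
      'X_(inord c.+1)).

(** The three powers of p, from the count of symmetric matrices, from the
    count of tails and from the weights x_j p^-j, combine by the identity for
    the gaps. *)
Lemma transfer_coefE (J K : {set 'I_4}) :
  (p ^ 'C(#|~: K|.+1, 2))%N%:R *
    (\prod_(c | c \notin K) ((p ^ #|below K c|)%N%:R - (c \in J)%:R *
      (p ^ #|below J c|)%N%:R))%:~R *
    (\prod_(c | c \notin K) satake_weight p c) = transfer_coef J K.
Proof.
rewrite /transfer_coef /satake_weight !scaler_prod.
have natA (m : nat) : (m%:R : {mpoly rat[5]}) = m%:R%:A by rewrite scaler_nat.
have intA (m : int) : (m%:~R : {mpoly rat[5]}) = m%:~R%:A by rewrite scaler_int.
rewrite natA intA -mulrA !mulr_algl !scalerA; congr (_ *: _).
have -> : \prod_(c < 4 | c \notin K) (p%:R ^- c.+1 : rat) =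
    (p%:R ^+ 'C(#|~: K|.+1, 2))^-1 * \prod_(c < 4 | c \notin K) (p%:R ^+ #|below
      K c|)^-1.
  by rewrite !prodfV !prodrXr -invfM -exprD -sum_gaps.
rewrite mulrA [X in X / _]mulrC natrX mulfK ?expf_neq0 // rmorph_prod -big_split
  /=.
apply: eq_bigr => c _; rewrite rmorphB rmorphM /= !rmorph_nat !natrX mulrBl
  divff ?expf_neq0 //.
by rewrite mulrA.
Qed.

Definition setb (m : bitseq) : {set 'I_4} := [set i : 'I_4 | nth false m i].

Lemma card_below_setb a0 a1 a2 a3 (c : 'I_4) :
  #|below (setb [:: a0; a1; a2; a3]) c| = count id (take c [:: a0; a1; a2; a3]).
Proof.
rewrite -sum1_card big_mkcond !big_ord_recl big_ord0 !inE /=.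
by case: c => [[|[|[|[|]]]]] //= _; case: a0; case: a1; case: a2; case: a3.
Qed.

Fixpoint coef_at (i j k : nat) (J K : bitseq) : {mpoly rat[5]} :=
  match J, K with
  | b :: J', a :: K' =>
    (if a then 1 else (1 - b%:R * (p%:R ^+ j / p%:R ^+ k)) *: 'X_(inord i.+1)) *
    coef_at i.+1 (b + j) (a + k) J' K'
  | _, _ => 1
  end.

Lemma transfer_coef_at b0 b1 b2 b3 a0 a1 a2 a3 :
  transfer_coef (setb [:: b0; b1; b2; b3]) (setb [:: a0; a1; a2; a3]) =
  coef_at 0 0 0 [:: b0; b1; b2; b3] [:: a0; a1; a2; a3].
Proof.
rewrite /transfer_coef big_mkcond !big_ord_recl big_ord0 !inE !card_below_setb
  /=.
rewrite !addn0 !if_neg.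
by rewrite ![(b1 + _)%N]addnC ![(b2 + _)%N]addnC ![(a1 + _)%N]addnC
  ![(a2 + _)%N]addnC -?addnA.
Qed.

Lemma ev_var i e : (i < 4)%N -> ev satake_env (spvar i e) = 'X_(inord i.+1) ^+
  e.
Proof.
by case: i => [|[|[|[|]]]] //= _; rewrite /ev big_seq1 /mev /= ?expr0 ?mul1r
  ?mulr1.
Qed.

Lemma ev_t e : ev satake_env (spvar 4 e) = (p%:R ^- e)%:A.
Proof.
by rewrite /ev big_seq1 /mev /= !expr0 !mul1r mulr1 -exprVn exprZn expr1n.
Qed.

Lemma ev_one : ev satake_env spone = 1.
Proof. by rewrite /ev big_seq1 /mev /= !expr0 !mul1r. Qed.

(** The hypothesis j <= k is the invariant that makes the truncated
    subtraction exact. *)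
Lemma ev_transfer_at i j k (J K : bitseq) : (j <= k)%N -> (i + size J <= 4)%N ->
  ev satake_env (transfer_at i j k J K) = coef_at i j k J K.
Proof.
elim: J K i j k => [|b J IH] [|a K] i j k jk iJ //=; rewrite ?ev_one //.
rewrite addnS -addSn in iJ.
have i4 : (i < 4)%N by apply: leq_trans iJ; rewrite ltnS leq_addr.
case: a; first by rewrite mul1r IH //; case: b; rewrite ?ltnS // ltnW.
case: b => /=; last by rewrite mul0r subr0 scale1r evM ev_var // expr1 IH.
case: eqP => [->|/eqP njk]; first by rewrite divff ?expf_neq0 // mulr1 subrr
  scale0r mul0r ev0.
have jk' : (j < k)%N by rewrite ltn_neqAle njk.
rewrite evD evN !evM ev_t ev_var // expr1 IH // mulr_algl -[X in X - _]scale1r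
  -scalerBl scalerAl.
congr (_ *: _ * _); congr (_ - _); rewrite mul1r.
by rewrite -{2}(subnKC jk) exprD invfM mulrA divff ?expf_neq0 // mul1r.
Qed.

Lemma ev_transfer b0 b1 b2 b3 a0 a1 a2 a3 :
  ev satake_env (transfer [:: b0; b1; b2; b3] [:: a0; a1; a2; a3]) =
  transfer_coef (setb [:: b0; b1; b2; b3]) (setb [:: a0; a1; a2; a3]).
Proof. by rewrite transfer_coef_at ev_transfer_at. Qed.

Lemma bitsetsP m : m \in bitsets -> exists a b c d, m = [:: a; b; c; d].
Proof.
have /allP sz : all (fun m => size m == 4) bitsets by [].
by move=> /sz; case: m => [|a [|b [|c [|d [|]]]]] //= _; exists a, b, c, d.
Qed.

Lemma mem_bitsets a b c d : [:: a; b; c; d] \in bitsets.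
Proof. by case: a; case: b; case: c; case: d. Qed.

Lemma sum_bitsets (F : {set 'I_4} -> {mpoly rat[5]}) :
  \sum_(K : {set 'I_4}) F K = \sum_(K <- bitsets) F (setb K).
Proof.
rewrite -(big_map setb xpredT F); apply: perm_big; apply: uniq_perm.
- exact: index_enum_uniq.
- rewrite map_inj_in_uniq // => m m' /bitsetsP[a [b [c [d ->]]]]
  /bitsetsP[a' [b' [c' [d' ->]]]].
  move=> /setP h; have := (h ord0, h (inord 1), h (inord 2), h (inord 3)).
  by rewrite !inE !inordK //= => -[[[-> ->] ->] ->].
move=> K; rewrite mem_index_enum; apply/esym/mapP.
exists [:: inord 0 \in K; inord 1 \in K; inord 2 \in K; inord 3 \in K];
  first exact: mem_bitsets.
apply/setP=> i; rewrite inE -{1}[i]inord_val.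
by case: i => [[|[|[|[|]]]]].
Qed.

Definition bit_sum N delta (K : bitseq) : {mpoly rat[5]} :=
  layer_sum p (@satake_weight p 4) N delta (setb K).

Lemma bit_sumS N delta (J : bitseq) : (delta < N)%N -> J \in bitsets ->
  bit_sum N delta.+1 J = \sum_(K <- bitsets) ev satake_env (transfer J K) *
    bit_sum N delta K.
Proof.
move=> dN /bitsetsP[b0 [b1 [b2 [b3 ->]]]]; rewrite /bit_sum (layer_sumS pp) //
  sum_bitsets.
apply: eq_big_seq => K /bitsetsP[a0 [a1 [a2 [a3 ->]]]].
by rewrite transfer_coefE ev_transfer.
Qed.

Definition row_dot (r : seq spoly) N delta : {mpoly rat[5]} :=
  \sum_(Kr <- zip bitsets r) ev satake_env Kr.2 * bit_sum N delta Kr.1.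

Lemma ev_spsum (ps : seq spoly) : ev satake_env (spsum ps) = \sum_(q <- ps) ev
  satake_env q.
Proof.
by elim: ps => [|q ps IH] /=; rewrite ?ev0 ?big_nil // evD big_cons IH.
Qed.

Lemma row_dot_map (f : bitseq -> spoly) N delta :
  row_dot [seq f K | K <- bitsets] N delta =
  \sum_(K <- bitsets) ev satake_env (f K) * bit_sum N delta K.
Proof.
rewrite /row_dot; have -> : zip bitsets [seq f K | K <- bitsets] =
  [seq (K, f K) | K <- bitsets].
  by elim: bitsets => //= K s ->.
by rewrite big_map.
Qed.

Lemma sum_empty (g : bitseq -> {mpoly rat[5]}) (q : spoly) :
  \sum_(K <- bitsets) ev satake_env (if K == nseq 4 false then q else [::]) * g
    K =
  ev satake_env q * g (nseq 4 false).
Proof.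
rewrite (bigD1_seq (nseq 4 false)) //= big1 ?addr0 // => K /negPf ->.
by rewrite ev0 mul0r.
Qed.

Lemma mem_zip1 (T1 T2 : eqType) (s : seq T1) (r : seq T2) x : x \in zip s r ->
  x.1 \in s.
Proof.
elim: s r => [|a s IH] [|b r] //=; rewrite !inE => /orP[/eqP -> /=|/IH ->];
  by rewrite ?eqxx ?orbT.
Qed.

Lemma row_stepE r q N delta : (delta < N)%N ->
  row_dot (row_step r q) N delta =
  row_dot r N delta.+1 + ev satake_env q * bit_sum N delta (nseq 4 false).
Proof.
move=> dN; rewrite row_dot_map; under eq_bigr do rewrite evD mulrDl.
rewrite big_split /= sum_empty; congr (_ + _).
under eq_bigr do rewrite ev_spsum big_map mulr_suml.
rewrite exchange_big /= /row_dot big_seq [RHS]big_seq; apply: eq_bigr =>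
  -[J a] /= hJ.
have Jb : J \in bitsets.
  exact: mem_zip1 hJ.
rewrite (bit_sumS dN Jb) mulr_sumr; apply: eq_bigr => K _.
by rewrite evM mulrCA mulrA mulrAC.
Qed.

Lemma row_dotE d N delta : (d + delta <= N)%N ->
  row_dot (row d) N delta =
  \sum_(i < d.+1) ev satake_env (nth [::] qcoefs i) * bit_sum N (d + delta - i)
    (nseq 4 false).
Proof.
elim: d delta => [|d IH] delta dN.
  rewrite row_dot_map sum_empty big_ord1 add0n subn0.
  by [].
rewrite row_stepE; last by apply: leq_trans dN; rewrite ltnS leq_addl.
rewrite IH; last by rewrite addnS -addSn.
rewrite [RHS]big_ord_recr; congr (_ + _ * bit_sum _ _ _).
  by apply: eq_bigr => i _; rewrite addnS.
by rewrite addSn -[nat_of_ord ord_max]/d.+1 subSS addKn.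
Qed.
End TransferEntries.

(** * The coefficients of the numerator as sparse polynomials *)

Fixpoint tpoly_at (i : nat) (cs : seq int) : spoly :=
  if cs is c :: cs' then
    if c == 0 then tpoly_at i.+1 cs' else (c, [:: 0; 0; 0; 0; i]%N) :: tpoly_at
      i.+1 cs'
  else [::].

(** Multiplication by a polynomial in t, given by the list of its
    coefficients. *)
Definition tscale (cs : seq int) (q : spoly) : spoly := spmul (tpoly_at 0 cs) q.

Definition spsym (a b c d : nat) : spoly :=
  spsum [seq [:: (1, rcons m 0%N)] | m <- permutations [:: a; b; c; d]].

(** Expressions in the monomial symmetric polynomials, with coefficients
    that are polynomials in t = 1/p given by lists. Being syntax trees, they
    unfold to the corresponding sums in the polynomial ring and to sparse
    polynomials. *)
Inductive symexpr :=
  | Sym of nat & nat & nat & nat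
  | SymAdd of symexpr & symexpr
  | SymOpp of symexpr
  | SymScale of seq int & symexpr.

Fixpoint symexpr_spoly (e : symexpr) : spoly :=
  match e with
  | Sym a b c d => spsym a b c d
  | SymAdd e1 e2 => spadd (symexpr_spoly e1) (symexpr_spoly e2)
  | SymOpp e1 => spopp (symexpr_spoly e1)
  | SymScale cs e1 => tscale cs (symexpr_spoly e1)
  end.

Declare Scope symexpr_scope.
Delimit Scope symexpr_scope with sx.
Local Notation "p + q" := (SymAdd p q) : symexpr_scope.
Local Notation "- p" := (SymOpp p) : symexpr_scope.
Local Notation "p - q" := (SymAdd p (SymOpp q)) : symexpr_scope.
Local Notation "cs *: p" := (SymScale cs%R p) : symexpr_scope.
Local Notation S := Sym.

Definition kpoly2 : symexpr :=
  ([:: 0; (-1)] *: (S 2 2 1 1 + S 2 1 1 0 + S 1 1 0 0)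
    + [:: (-1); (-1); (-1)] *: (S 2 1 1 1 + S 1 1 1 0)
    + [:: (-2); (-4); (-1)] *: S 1 1 1 1)%sx.

Definition kpoly3 : symexpr :=
  ([:: 0; 1; 1] *: (S 3 2 2 2 + S 3 2 2 1 + S 3 2 1 1 + S 3 1 1 1 +
      S 2 2 2 0 + S 2 2 1 0 + S 2 1 1 0 + S 1 1 1 0)
    + [:: 1; 5; 5; 1] *: (S 2 2 2 2 + S 2 2 2 1 + S 2 2 1 1 + S 2 1 1 1 +
      S 1 1 1 1))%sx.

Definition kpoly4 : symexpr :=
  ([:: 0; 0; (-1)] *: (S 4 3 2 2 + S 4 2 2 1 + S 3 2 2 0 + S 2 2 1 0)
    + [:: 0; (-1); (-1); (-1)] *: (S 4 2 2 2 + S 3 3 3 3 + S 3 3 3 1 +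
      S 3 3 1 1 + S 3 1 1 1 + S 2 2 2 0 + S 1 1 1 1)
    + [:: 0; (-1); (-4); (-1)] *: (S 3 3 3 2 + S 3 3 2 1 + S 3 2 1 1 +
      S 2 1 1 1)
    + [:: 0; (-3); (-6); (-4)] *: (S 3 3 2 2 + S 3 2 2 1 + S 2 2 1 1)
    + [:: 0; (-5); (-15); (-6); (-1)] *: (S 3 2 2 2 + S 2 2 2 1)
    + [:: 0; (-12); (-22); (-16); (-1)] *: S 2 2 2 2)%sx.

Definition kpoly5 : symexpr :=
  ([:: 0; 0; 1; 1] *: (S 4 4 3 3 + S 4 4 3 2 + S 4 4 2 2 + S 4 3 3 1 +
      S 4 3 2 1 + S 4 2 2 1 + S 3 3 1 1 + S 3 2 1 1 + S 2 2 1 1)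
    + [:: 0; 0; 4; 5; 1] *: (S 4 3 3 3 + S 4 3 3 2 + S 4 3 2 2 + S 4 2 2 2 +
      S 3 3 3 1 + S 3 3 2 1 + S 3 2 2 1 + S 2 2 2 1)
    + [:: (-1); 0; 14; 18; 5] *: (S 3 3 3 3 + S 3 3 3 2 + S 3 3 2 2 +
      S 3 2 2 2 + S 2 2 2 2))%sx.

Definition kpoly6 : symexpr :=
  ([:: 0; 1; 0; (-5); (-4)] *: (S 4 4 3 2 + S 4 3 2 2 + S 3 2 2 2 +
      S 4 4 4 3)
    + [:: 1; 5; 0; (-17); (-15); (-1)] *: (S 4 3 3 3 + S 3 3 3 2)
    - [:: 0; 0; 0; 1; 1] *: (S 4 3 3 1 + S 3 3 2 1 + S 5 3 3 2 + S 5 4 3 3)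
    + [:: 0; 3; 0; (-12); (-6); (-1)] *: (S 4 3 3 2 + S 3 3 2 2 + S 4 4 3 3)
    + [:: 0; 1; 0; (-3); (-1)] *: (S 4 2 2 2 + S 3 3 3 1 + S 2 2 2 2 +
      S 4 4 2 2 + S 4 4 4 2 + S 4 4 4 4 + S 5 3 3 3)
    + [:: 0; 0; 0; 1] *: (S 6 3 3 3 - S 5 4 4 3 - S 5 4 3 2 - S 5 3 2 2 -
      S 4 4 3 1 - S 4 3 2 1 + S 3 3 3 0 - S 3 2 2 1)
    + [:: 2; 12; 0; (-32); (-22); (-4); 1] *: S 3 3 3 3)%sx.

Definition kpoly7 : symexpr :=
  ([:: 0; 0; (-1); 0; 1] *: (S 5 5 4 4 + S 5 5 4 3 + S 5 5 3 3 + S 5 4 4 2 +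
      S 5 4 3 2 + S 5 3 3 2 + S 4 4 2 2 + S 4 3 2 2 + S 3 3 2 2)
    + [:: 0; (-1); (-4); 0; 4; 1] *: (S 5 4 4 4 + S 5 4 4 3 + S 5 4 3 3 +
      S 5 3 3 3 + S 4 4 4 2 + S 4 4 3 2 + S 4 3 3 2 + S 3 3 3 2)
    + [:: 0; (-5); (-14); 0; 14; 5] *: (S 4 4 4 4 + S 4 4 4 3 + S 4 4 3 3 +
      S 4 3 3 3 + S 3 3 3 3))%sx.

Definition kpoly8 : symexpr :=
  ([:: 0; 1; 15; 17; 0; (-5); (-1)] *: (S 5 4 4 4 + S 4 4 4 3)
    + [:: 0; 0; 0; 1] *: (- S 7 4 4 4 + S 6 5 5 4 + S 6 5 4 3 + S 6 4 3 3 +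
      S 5 5 4 2 + S 5 4 3 2 - S 4 4 4 1 + S 4 3 3 2)
    + [:: 0; 0; 4; 5; 0; (-1)] *: (S 5 5 5 4 + S 5 5 4 3 + S 5 4 3 3 +
      S 4 3 3 3)
    + [:: 0; 0; 1; 1] *: (S 6 5 4 4 + S 6 4 4 3 + S 5 4 4 2 + S 4 4 3 2)
    + [:: 0; 0; 1; 3; 0; (-1)] *: (S 4 4 4 2 + S 5 3 3 3 + S 5 5 3 3 +
      S 5 5 5 5 + S 6 4 4 4 + S 5 5 5 3 + S 3 3 3 3)
    - [:: 1; (-4); (-22); (-32); 0; 12; 2] *: S 4 4 4 4
    + [:: 0; 1; 6; 12; 0; (-3)] *: (S 5 5 4 4 + S 5 4 4 3 + S 4 4 3 3))%sx.

Definition kpoly9 : symexpr :=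
  ([:: 0; 0; 0; (-1); (-1)] *: (S 6 6 5 5 + S 6 6 5 4 + S 6 6 4 4 +
      S 6 5 5 3 + S 6 5 4 3 + S 6 4 4 3 + S 5 5 3 3 + S 5 4 3 3 + S 4 4 3 3)
    + [:: 0; 0; (-1); (-5); (-4)] *: (S 6 5 5 5 + S 6 5 5 4 + S 6 5 4 4 +
      S 6 4 4 4 + S 5 5 5 3 + S 5 5 4 3 + S 5 4 4 3 + S 4 4 4 3)
    + [:: 0; 0; (-5); (-18); (-14); 0; 1] *: (S 5 5 5 5 + S 5 5 5 4 +
      S 5 5 4 4 + S 5 4 4 4 + S 4 4 4 4))%sx.

Definition kpoly10 : symexpr :=
  ([:: 0; 0; 0; 1; 1; 1] *: (S 4 4 4 4 + S 5 5 5 3 + S 6 4 4 4 + S 6 6 4 4 +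
      S 6 6 6 4 + S 6 6 6 6 + S 7 5 5 5)
    + [:: 0; 0; 0; 1; 4; 1] *: (S 5 4 4 4 + S 6 5 4 4 + S 6 6 5 4 + S 6 6 6 5)
    + [:: 0; 0; 0; 0; 1] *: (S 5 5 4 3 + S 6 5 5 3 + S 7 5 5 4 + S 7 6 5 5)
    + [:: 0; 0; 0; 4; 6; 3] *: (S 5 5 4 4 + S 6 5 5 4 + S 6 6 5 5)
    + [:: 0; 0; 1; 6; 15; 5] *: (S 5 5 5 4 + S 6 5 5 5)
    + [:: 0; 0; 1; 16; 22; 12] *: S 5 5 5 5)%sx.

Definition kpoly11 : symexpr :=
  ([:: 0; 0; 0; 0; (-1); (-1)] *: (S 7 6 6 6 + S 7 6 6 5 + S 7 6 5 5 +
      S 7 5 5 5 + S 6 6 6 4 + S 6 6 5 4 + S 6 5 5 4 + S 5 5 5 4)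
    + [:: 0; 0; 0; (-1); (-5); (-5); (-1)] *: (S 6 6 6 6 + S 6 6 6 5 +
      S 6 6 5 5 + S 6 5 5 5 + S 5 5 5 5))%sx.

Definition kpoly12 : symexpr :=
  ([:: 0; 0; 0; 0; 1; 1; 1] *: (S 6 6 6 5 + S 7 6 6 6)
    + [:: 0; 0; 0; 0; 1; 4; 2] *: S 6 6 6 6
    + [:: 0; 0; 0; 0; 0; 1] *: (S 7 6 6 5 + S 7 7 6 6 + S 6 6 5 5))%sx.

Definition kpoly14 : symexpr := ([:: 0; 0; 0; 0; 0; 0; (-1)] *: S 7 7 7 7)%sx.

(** The numerator coefficients divided by x_0^k; the last entry stands for
    the vanishing coefficient of degree 15. *)
Definition kpolys : seq spoly :=
  [:: spone; [::]] ++
  map symexpr_spoly [:: kpoly2; kpoly3; kpoly4; kpoly5; kpoly6; kpoly7; kpoly8;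
    kpoly9; kpoly10;
                        kpoly11; kpoly12] ++
  [:: [::]; symexpr_spoly kpoly14; [::]].

(** A single boolean, so that one evaluation computes each row r_k once; k
    = 15 is included because the numerator has no such term. *)
Definition numerator_check : bool :=
  let rs := rows (row 0) (behead qcoefs) in
  let ks := kpolys in
  [&& size qcoefs == 17%N,
      all (fun k => spadd (spsum (nth [::] rs k)) (spopp (nth [::] ks k)) ==
        [::]) (iota 0 16)
    & nth [::] rs 16 == nseq 16 [::]].

Lemma numerator_checkT : numerator_check.
Proof. by vm_compute. Qed.

Lemma row_step0 : row_step (nseq 16 [::]) [::] = nseq 16 [::].
Proof. by vm_compute. Qed.

Section Numerator.
Variable p : nat.
Hypothesis pp : prime p.
Let pnz : (p%:R : rat) != 0. Proof. by rewrite pnatr_eq0 -lt0n prime_gt0. Qed.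
Notation evp := (ev (satake_env p)).

Fixpoint tval (cs : seq int) : rat :=
  if cs is c :: cs' then c%:~R + tval cs' / p%:R else 0.

Lemma ev_tpoly_at i cs : evp (tpoly_at i cs) = (tval cs * p%:R ^- i)%:A.
Proof.
elim: cs i => [|c cs IH] i /=; first by rewrite ev0 mul0r scale0r.
have E : evp (tpoly_at i.+1 cs) = (tval cs / p%:R * p%:R ^- i)%:A.
  by rewrite IH exprS invfM mulrA.
case: eqP => [->|_]; first by rewrite E add0r.
rewrite ev_cons E mulrDl scalerDl; congr (_ + _).
have -> : mev (satake_env p) [:: 0; 0; 0; 0; i]%N = (p%:R ^- i)%:A.
  by rewrite /mev /= !expr0 !mul1r mulr1 exprZn expr1n exprVn.
by rewrite -scalerA scaler_int mulrzl.
Qed.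

Lemma ev_tscale cs q : evp (tscale cs q) = tval cs *: evp q.
Proof. by rewrite evM ev_tpoly_at expr0 invr1 mulr1 mulr_algl. Qed.

Lemma ev_spsym a b c d : evp (spsym a b c d) = s a b c d.
Proof.
rewrite /spsym ev_spsum big_map /s; apply: eq_big_seq => m.
rewrite mem_permutations => /perm_size; case: m => [|e1 [|e2 [|e3 [|e4 [|]]]]]
  //= _.
by rewrite /ev big_seq1 /mev /= expr0 !mulr1 mul1r !mulrA.
Qed.

Fixpoint symexpr_val (e : symexpr) : {mpoly rat[5]} :=
  match e with
  | Sym a b c d => s a b c d
  | SymAdd e1 e2 => symexpr_val e1 + symexpr_val e2
  | SymOpp e1 => - symexpr_val e1
  | SymScale cs e1 => tval cs *: symexpr_val e1
  end.

Lemma ev_symexpr e : evp (symexpr_spoly e) = symexpr_val e.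
Proof.
elim: e => [a b c d|e1 IH1 e2 IH2|e IH|cs e IH] /=; first exact: ev_spsym.
- by rewrite evD IH1 IH2.
- by rewrite evN IH.
- by rewrite ev_tscale IH.
Qed.

(** The scalar c is distributed over the top-level sum only, so that the
    sums of monomial symmetric polynomials agree on both sides and rational
    functions of p remain to be compared. *)
Ltac numerator_coef c :=
  congr (_ * _); rewrite !(scalerDr c) ?(scalerN c) !(scalerA c);
  do ?[congr (_ + _)]; do ?[congr (- _)]; congr (_ *: _); rewrite /tval; field;
    exact: pnz.

Lemma K2E : K2 p%:R = x0 ^+ 2 * symexpr_val kpoly2.
Proof.
rewrite /K2 -scaleNr -scalerAl scalerAr /=; numerator_coef (- (p%:R ^- 2) :
  rat).
Qed.

Lemma K3E : K3 p%:R = x0 ^+ 3 * symexpr_val kpoly3.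
Proof.
rewrite /K3 -scalerAl scalerAr /=; numerator_coef (p%:R ^- 3 : rat).
Qed.

Lemma K4E : K4 p%:R = x0 ^+ 4 * symexpr_val kpoly4.
Proof.
rewrite /K4 -scaleNr -scalerAl scalerAr /=; numerator_coef (- (p%:R ^- 4) :
  rat).
Qed.

Lemma K5E : K5 p%:R = x0 ^+ 5 * symexpr_val kpoly5.
Proof.
rewrite /K5 -scalerAl scalerAr /=; numerator_coef (p%:R ^- 4 : rat).
Qed.

Lemma K6E : K6 p%:R = x0 ^+ 6 * symexpr_val kpoly6.
Proof.
rewrite /K6 -scalerAl scalerAr /=; numerator_coef (p%:R ^- 6 : rat).
Qed.

Lemma K7E : K7 p%:R = x0 ^+ 7 * symexpr_val kpoly7.
Proof.
rewrite /K7 -scaleNr -scalerAl scalerAr /=; numerator_coef (- (p%:R ^- 5) :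
  rat).
Qed.

Lemma K8E : K8 p%:R = x0 ^+ 8 * symexpr_val kpoly8.
Proof.
rewrite /K8 -scalerAl scalerAr /=; numerator_coef (p%:R ^- 6 : rat).
Qed.

Lemma K9E : K9 p%:R = x0 ^+ 9 * symexpr_val kpoly9.
Proof.
rewrite /K9 -scaleNr -scalerAl scalerAr /=; numerator_coef (- (p%:R ^- 6) :
  rat).
Qed.

Lemma K10E : K10 p%:R = x0 ^+ 10 * symexpr_val kpoly10.
Proof.
rewrite /K10 -scalerAl scalerAr /=; numerator_coef (p%:R ^- 5 : rat).
Qed.

Lemma K11E : K11 p%:R = x0 ^+ 11 * symexpr_val kpoly11.
Proof.
rewrite /K11 -scaleNr -scalerAl scalerAr /=; numerator_coef (- (p%:R ^- 6) :
  rat).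
Qed.

Lemma K12E : K12 p%:R = x0 ^+ 12 * symexpr_val kpoly12.
Proof.
rewrite /K12 -scalerAl scalerAr /=; numerator_coef (p%:R ^- 6 : rat).
Qed.

Lemma K14E : K14 p%:R = x0 ^+ 14 * symexpr_val kpoly14.
Proof.
rewrite /K14 -scaleNr -scalerAl scalerAr /=; congr (_ * (_ *: _)).
by rewrite /tval; field; exact: pnz.
Qed.
End Numerator.

(** * The quotient of power series *)

Section Denominator.
Variable p : nat.
Notation evp := (ev (satake_env p)).

Lemma coef_mul_linear (R : comNzRingType) (P : {poly R}) (a : R) i :
  (P * (1 - a *: 'X))`_i = P`_i - (if i is j.+1 then a * P`_j else 0).
Proof.
by rewrite mulrBr mulr1 coefB -scalerAr coefZ coefMX; case: i => [|i] /=;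
  rewrite ?mulr0.
Qed.

(** The power of x_0 is the degree in the series variable. *)
Lemma foldl_qmul_coef (Is : seq bitseq) (P : {poly {mpoly rat[5]}})
  (q : seq spoly) :
  (forall i, P`_i = x0 ^+ i * evp (nth [::] q i)) ->
  forall i, (foldl (fun P I => P * (1 - (x0 * evp (spmonom I)) *: 'X)) P Is)`_i
    =
    x0 ^+ i * evp (nth [::] (foldl qmul q Is) i).
Proof.
elim: Is P q => [|I Is IH] P q hP //=; apply: IH => i; rewrite coef_mul_linear.
have [iq|iq] := ltnP i (size q).+1.
  rewrite (nth_map 0%N) ?size_iota // nth_iota // add0n evD evN.
  case: i iq => [|i] iq; first by rewrite hP ev0 !subr0.
  by rewrite !hP evM exprS; ring.
rewrite (nth_default _ (s := qmul q I)) ?size_map ?size_iota // ev0 mulr0.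
case: i iq => [|i] //; rewrite ltnS => iq.
by rewrite !hP !nth_default ?(leqW iq) // ev0 !mulr0 subr0.
Qed.

Lemma Q4E : Q4 = foldl (fun P I => P * (1 - (x0 * evp (spmonom I)) *: 'X)) 1
  subsets_by_size.
Proof.
have monE a b c d : evp (spmonom [:: a; b; c; d]) = x1 ^+ a * x2 ^+ b * x3 ^+ c
  * x4 ^+ d.
  by rewrite /ev big_seq1 /mev /= mul1r expr0 !mulr1 !mulrA.
rewrite /Q4 /= !monE !expr0 !expr1 !mulr1 !mul1r !mulrA.
by [].
Qed.

Lemma Q4_coef i : Q4`_i = x0 ^+ i * evp (nth [::] qcoefs i).
Proof.
rewrite Q4E; apply: foldl_qmul_coef => -[|j]; rewrite coef1 /=; first by rewrite
  ev_one mulr1.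
by rewrite nth_nil ev0 mulr0.
Qed.
End Denominator.

Arguments row : simpl never.
Arguments row_step : simpl never.

(** The list of all rows, which computes each of them once, agrees with
    the recursive definition. *)
Lemma nth_rows d0 qs i : (forall j, (j < size qs)%N -> nth [::] qs j =
  nth [::] qcoefs (d0 + j).+1) ->
  (i <= size qs)%N -> nth [::] (rows (row d0) qs) i = row (d0 + i).
Proof.
elim: qs d0 i => [|q qs IH] d0 i hq; first by case: i => // _; rewrite addn0.
case: i => [_|i iqs]; first by rewrite addn0.
have step : row_step (row d0) q = row d0.+1 by rewrite -(addn0 d0)
  -[q]/(nth [::] (q :: qs) 0) hq.
rewrite -[LHS]/(nth [::] (rows (row_step (row d0) q) qs) i) step IH ?addnS //.
by move=> j jqs; rewrite addSn -addnS -hq.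
Qed.

Lemma row_stationary m j : (size qcoefs <= m.+1)%N -> row m = nseq 16 [::] ->
  row (m + j) = nseq 16 [::].
Proof.
move=> qm rm; elim: j => [|j IH]; first by rewrite addn0.
have rowS i : row i.+1 = row_step (row i) (nth [::] qcoefs i.+1) by [].
by rewrite addnS rowS IH nth_default ?row_step0 // (leq_trans qm) // ltnS
  leq_addr.
Qed.

Lemma qcoefs0 : nth [::] qcoefs 0 = spone.
Proof. by vm_compute. Qed.

Lemma numerator_rows k : spadd (spsum (row k)) (spopp (nth [::] kpolys k)) =
  [::].
Proof.
have /and3P[/eqP sq /allP hall /eqP h16] := numerator_checkT.
have rowE i : (i <= 16)%N -> nth [::] (rows (row 0) (behead qcoefs)) i = row i.
  move=> i16; apply: (@nth_rows 0) => [j _|]; first by rewrite nth_behead.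
  by rewrite size_behead sq.
have [k16|k16] := ltnP k 16.
  have := hall k; rewrite (rowE k (ltnW k16)) => h.
  by apply/eqP/h; rewrite mem_iota.
have -> : row k = nseq 16 [::].
  rewrite -(subnKC k16); apply: row_stationary; first by rewrite sq.
  by move: h16; rewrite (rowE 16%N (leqnn 16)) => ->.
by rewrite nth_default // -[size kpolys]/16%N.
Qed.

Lemma row_mapE d : exists f, row d = [seq f K | K <- bitsets].
Proof. by case: d => [|d]; eexists. Qed.

Lemma P4_coef p k : prime p ->
  (P4 p%:R)`_k = x0 ^+ k * ev (satake_env p) (nth [::] kpolys k).
Proof.
move=> pp; rewrite coef_poly.
have [k15|k15] := ltnP k 15; last first.
  have -> : nth [::] kpolys k = [::].
    by move: k15; rewrite leq_eqVlt => /orP[/eqP <- //|k16];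
      rewrite nth_default.
  by rewrite ev0 mulr0.
do 2![case: k k15 => [_|k k15]; first by rewrite /= ?ev_one ?ev0 ?mulr0 ?mulr1].
case: k k15 => [_|k k15].
  by rewrite -[nth 0 _ _]/(K2 p%:R) -[nth [::] _ _]/(symexpr_spoly kpoly2)
    ev_symexpr (K2E pp).
case: k k15 => [_|k k15].
  by rewrite -[nth 0 _ _]/(K3 p%:R) -[nth [::] _ _]/(symexpr_spoly kpoly3)
    ev_symexpr (K3E pp).
case: k k15 => [_|k k15].
  by rewrite -[nth 0 _ _]/(K4 p%:R) -[nth [::] _ _]/(symexpr_spoly kpoly4)
    ev_symexpr (K4E pp).
case: k k15 => [_|k k15].
  by rewrite -[nth 0 _ _]/(K5 p%:R) -[nth [::] _ _]/(symexpr_spoly kpoly5)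
    ev_symexpr (K5E pp).
case: k k15 => [_|k k15].
  by rewrite -[nth 0 _ _]/(K6 p%:R) -[nth [::] _ _]/(symexpr_spoly kpoly6)
    ev_symexpr (K6E pp).
case: k k15 => [_|k k15].
  by rewrite -[nth 0 _ _]/(K7 p%:R) -[nth [::] _ _]/(symexpr_spoly kpoly7)
    ev_symexpr (K7E pp).
case: k k15 => [_|k k15].
  by rewrite -[nth 0 _ _]/(K8 p%:R) -[nth [::] _ _]/(symexpr_spoly kpoly8)
    ev_symexpr (K8E pp).
case: k k15 => [_|k k15].
  by rewrite -[nth 0 _ _]/(K9 p%:R) -[nth [::] _ _]/(symexpr_spoly kpoly9)
    ev_symexpr (K9E pp).
case: k k15 => [_|k k15].
  by rewrite -[nth 0 _ _]/(K10 p%:R) -[nth [::] _ _]/(symexpr_spoly kpoly10)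
    ev_symexpr (K10E pp).
case: k k15 => [_|k k15].
  by rewrite -[nth 0 _ _]/(K11 p%:R) -[nth [::] _ _]/(symexpr_spoly kpoly11)
    ev_symexpr (K11E pp).
case: k k15 => [_|k k15].
  by rewrite -[nth 0 _ _]/(K12 p%:R) -[nth [::] _ _]/(symexpr_spoly kpoly12)
    ev_symexpr (K12E pp).
case: k k15 => [_|k k15]; first by rewrite /= ev0 mulr0.
case: k k15 => [_|k k15] //.
by rewrite -[nth 0 _ _]/(K14 p%:R) -[nth [::] _ _]/(symexpr_spoly kpoly14)
  ev_symexpr (K14E pp).
Qed.

Theorem theorem2p1 (p : nat) (hp : prime p) :
  is_fps_quotient (fun delta : nat => spherical_map p (hecke_series 4 p delta))
    (P4 p%:R) Q4.
Proof.
split; first by rewrite (Q4_coef p) expr0 mul1r qcoefs0 ev_one unitr1.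
move=> k; pose N := k.+1.
have c_eq delta : (delta < N)%N -> spherical_map p (hecke_series 4 p delta) =
    x0 ^+ delta * bit_sum p N delta (nseq 4 false).
  move=> dN; rewrite /hecke_series (spherical_map_hecke_T hp _ dN) // /bit_sum.
  congr (_ * layer_sum _ _ _ _ _); apply/setP=> i; rewrite !inE.
  by case: i => [[|[|[|[|]]]]].
transitivity (x0 ^+ k * ev (satake_env p) (spsum (row k))).
  transitivity (x0 ^+ k * row_dot p (row k) N 0).
    rewrite (row_dotE hp) ?addn0 ?leqnSn // mulr_sumr; apply: eq_bigr => i _.
    have ik : (i <= k)%N by rewrite -ltnS.
    rewrite (Q4_coef p) c_eq ?ltnS ?leq_subr // mulrACA -exprD subnKC //.
  congr (_ * _); rewrite ev_spsum; have [f ->] := row_mapE k.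
  rewrite row_dot_map big_map; apply: eq_bigr => K _.
  by rewrite /bit_sum (layer_sum0 hp) ?mulr1.
by rewrite (ev_eq (satake_env p) (numerator_rows k)) (P4_coef _ hp).
Qed.
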